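(* Let $G$ be a finite non-nilpotent soluble group, write $\sigma=\sigma(G)$, and suppose $\mathfrak{m}(G)=2\sigma$. Then $G/\Phi(G)$ is isomorphic to one of the following groups: (i) $\mathbb{Z}_2\times S_3$; (ii) $(E_{\sigma}\rtimes\mathbb{Z}_q)\times\mathbb{Z}_q$, where $\sigma-1=q$ is a Mersenne prime; (iii) $(E_{\sigma-1}\rtimes\mathbb{Z}_t)\times\mathbb{Z}_{p_1\cdots p_{\ell}}$, where $p_1,\dots,p_\ell$ are distinct primes coprime to $t$, $\sigma\neq 3$ and $\ell=\sigma-\mathfrak{m}(\mathbb{Z}_t)+1$; (iv) $(\mathbb{Z}_{\sigma-1}\rtimes \mathbb{Z}_t)\times\mathbb{Z}_{\sigma-1}\times\mathbb{Z}_{\sigma-1}$, where $\sigma-1$ is an odd prime and $\mathfrak{m}(\mathbb{Z}_t)=1$; (v) $(E_{\sigma-1}\rtimes\mathbb{Z}_{t_1})\times(E_{\sigma-1}\rtimes\mathbb{Z}_{t_2})$, where $t_1$ and $t_2$ are coprime positive integers with $\mathfrak{m}(\mathbb{Z}_{t_1})=\mathfrak{m}(\mathbb{Z}_{t_2})=1$ and $\sigma-1$ is not a Fermat prime number; (vi) $(E_{\sigma-1}\times E_{\sigma-1})\rtimes\mathbb{Z}_t$, where $\mathfrak{m}(\mathbb{Z}_t)=2$ and $\sigma\neq 3$; (vii) $((E_{\sigma-1}\times E_{\sigma-1})\rtimes\mathbb{Z}_t)\times\mathbb{Z}_p$, where $p$ is a prime, $\mathfrak{m}(\mathbb{Z}_t)=1$,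 $\gcd(p,t)=1$, $t>2$ and $\sigma\neq 3$; (viii) $E_{\sigma}\rtimes(\mathbb{Z}_q \rtimes\mathbb{Z}_t)$, where $\sigma-1=q$ is a Mersenne prime and $\mathfrak{m}(\mathbb{Z}_t)=1$ with $t$ dividing $\sigma-2$.
   Context: For a finite group $G$, $\mathfrak{m}(G)$ is the number of maximal subgroups of $G$ (so $\mathfrak{m}(\mathbb{Z}_t)$ is the number of distinct prime divisors of $t$), and, for $G$ non-cyclic, $\sigma(G)$ is the least positive integer $n$ such that $G$ is the union of $n$ proper subgroups. $\Phi(G)$ is the Frattini subgroup. $E_n$ denotes an elementary abelian group of order $n$ (so $n$ is a prime power whenever $E_n$ occurs), $\mathbb{Z}_n$ the cyclic group of order $n$, and $S_3$ the symmetric group of degree 3. Throughout, $t$ denotes a positive integer. *)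

(* Defs.v *)
From mathcomp Require Import all_boot all_order all_fingroup all_algebra all_solvable.

Set Implicit Arguments.
Unset Strict Implicit.
Unset Printing Implicit Defensive.

Import GroupScope.
Local Open Scope nat_scope.

Definition num_maximal (gT : finGroupType) (G : {set gT}) : nat :=
  #|[set M : {group gT} | maximal M G]|.

Definition proper_cover (gT : finGroupType) (G : {set gT})
    (C : {set {group gT}}) : bool :=
  [forall H in C, H \proper G] && (\bigcup_(H in C) (H : {set gT}) == G).

(* The default, the family of all proper subgroups, is a cover exactly when G
   is not cyclic; the value is only meaningful in that case. *)
Definition covering_number (gT : finGroupType) (G : {set gT}) : nat :=
  #|[arg min_(C < [set H : {group gT} | H \proper G] | proper_cover G C)
       #|C| ]|.

Lemma covering_numberP (gT : finGroupType) (G : {group gT}) :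
  ~~ cyclic G ->
  [/\ 0 < covering_number G,
      exists2 C, proper_cover G C & #|C| = covering_number G
    & forall C, proper_cover G C -> covering_number G <= #|C|].
Proof.
move=> ncG; rewrite /covering_number; case: arg_minnP => [|C covC minC].
  apply/andP; split; first by apply/forall_inP=> H; rewrite inE.
  rewrite eqEsubset; apply/andP; split.
    by apply/bigcupsP=> H; rewrite inE => /proper_sub.
  apply/subsetP=> x Gx; apply/bigcupP; exists <[x]>%G; last exact: cycle_id.
  rewrite inE properEneq cycle_subG Gx andbT.
  by apply: contraNneq ncG => <-; apply: cycle_cyclic.
split=> //; last by exists C.
rewrite card_gt0; apply: contraTneq covC => ->.
rewrite /proper_cover big_set0 negb_and eq_sym; apply/orP; right.
by apply/set0Pn; exists 1%g; apply: group1.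
Qed.

Definition elementary_abelian_of_order (n : nat) (gT : finGroupType)
    (A : {set gT}) : Prop :=
  exists2 p, prime p & p.-abelem A /\ #|A| = n.

Definition mersenne_prime (p : nat) : Prop :=
  prime p /\ exists k, p = 2 ^ k - 1.

Definition fermat_prime (p : nat) : Prop :=
  prime p /\ exists k, p = 2 ^ (2 ^ k) + 1.

(* Main.v *)
(** Write the covering number as [q + 1].  By Tomkinson's argument [q] is the
    least index of a maximal subgroup which is not normal, or is normal and
    shares its index with another normal maximal subgroup ([multimax]).
    Everything factors through the Frattini quotient, so assume that the
    Frattini subgroup is trivial.  A conjugacy class of non-normal maximal
    subgroups has as many members as its index, which is at least [q] and at
    least [3], so having [2 (q + 1)] maximal subgroups leaves room for only one
    or two such classes.  With a single class represented by [M], the core of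
    [M] is central and [G = V ><| M] with [V] minimal normal and [M] nilpotent;
    counting the maximal subgroups of [M] gives (i)-(iv).  With two classes,
    either representatives of both complement minimal normal subgroups [V1] and
    [V2] inside the derived subgroup and [G = (V1 \x V2) ><| X] with [X] cyclic,
    which is (vi), or one finds prime powers [#|V|] and [r ^ b] that differ by
    one, and the Mersenne case (viii) is the only surviving possibility.  Types (v) and (vii) are special
    cases of (vi): take for the complement the product of the cyclic factors. *)

Require Import Defs.
From mathcomp Require Import all_boot all_order all_fingroup all_algebra all_solvable.
From mathcomp Require Import all_character zify.

Set Implicit Arguments.
Unset Strict Implicit.
Unset Printing Implicit Defensive.

Import GroupScope.

(** * Coprime action on an elementary abelian group *)

Section CoprimeModules.
Local Open Scope group_scope.
Implicit Types (gT : finGroupType) (p r : nat).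

(** The hard half of the value [q + 1] is a cover with that many members. When a [multimax] subgroup
    of least index is not normal, dividing by its core gives [V ><| M] with [V] minimal normal of
    order [q] and [M] acting faithfully on it. If [M] is cyclic, [V] and the conjugates of [M] form
    a cover. If not, [M] has a [multimax] subgroup [X] of its own, and [V <*> X] has index
    [#|M : X|] in the whole group, so minimality is contradicted as soon as [#|M : X| < #|V|]. For
    normal [X] this says that a prime divisor of [#|M|] is less than [#|V|], which an orbit shows.
    For non-normal [X] it says that a chief factor of [M] inside some ['O_r(M)] is smaller than the
    faithful module [V], and the coprime action lemmas lead up to this bound. Splitting a module
    destroys faithfulness and passing to a subgroup destroys irreducibility; therefore they bound
    the index of a centraliser taken modulo the kernel of the action. *)

Lemma maschke_compl gT p (V U N : {group gT}) :
    p.-abelem V -> p^'.-group N -> N \subset 'N(V) -> N \subset 'N(U) ->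
    U \subset V ->
  exists2 W : {group gT}, U \x W = V & N \subset 'N(W).
Proof.
move=> abV p'N nVN nUN sUV.
have cVV := abelem_abelian abV.
have nUV: V \subset 'N(U) := subset_trans cVV (subset_trans (centS sUV) (cent_sub U)).
pose G := (V <*> N)%G.
have defG : G :=: V * N by rewrite /G /= norm_joinEr.
have tiVN: V :&: N = 1.
  by apply: coprime_TIg; apply: (pnat_coprime (abelem_pgroup abV)).
have nsUG: U <| G.
  rewrite /normal (subset_trans sUV) ?joing_subl //=.
  by rewrite join_subG nUV.
have iGV : #|G : V| = #|N|.
  by rewrite -divgS ?joing_subl // defG TI_cardMg // mulKn.
(* By the theorem of Gaschutz the splitting of [V] over [U] extends to [V * N], because [#|N|] is
   prime to [#|U|]. A complement of [U] in the whole product meets [V] in a complement that [N]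
   normalises. *)
have splU : [splits G, over U].
  rewrite (Gaschutz_split nsUG sUV (joing_subl _ _)).
  - exact: abelem_splits abV sUV.
  - exact: abelianS sUV cVV.
  rewrite iGV; apply: (@pnat_coprime p); last exact: p'N.
  exact: pgroupS sUV (abelem_pgroup abV).
case/splitsP: splU => K /complP[tiUK defUK].
exists (K :&: V)%G.
  rewrite dprodE /=.
  - by rewrite group_modl // defUK (setIidPr (joing_subl _ _)).
  - by rewrite (subset_trans (subsetIr _ _)) // (subset_trans cVV) ?centS.
  by rewrite setIA tiUK setI1g.
have sKG: K \subset G by rewrite -defUK mulG_subr.
have nVG: G \subset 'N(V) by rewrite join_subG normG.
have nWU: U \subset 'N(K :&: V).
  apply: subset_trans sUV _; apply: subset_trans cVV _.
  by rewrite (subset_trans _ (cent_sub _)) // centS ?subsetIr.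
have nWK: K \subset 'N(K :&: V).
  by rewrite normsI ?normG // (subset_trans sKG).
apply: subset_trans (joing_subr V N) _.
by rewrite -[V <*> N]/(gval G) -defUK mul_subG.
Qed.

Lemma minnormal_or_split gT p (V N : {group gT}) :
    p.-abelem V -> p^'.-group N -> N \subset 'N(V) -> V :!=: 1 ->
    minnormal V N \/
  exists U W : {group gT}, [/\ U \x W = V, N \subset 'N(U), N \subset 'N(W),
    U \proper V & W \proper V].
Proof.
move=> abV p'N nVN ntV.
have [U minU sUV] := minnormal_exists ntV nVN.
have [eqUV | neUV] := eqVneq (U : {set gT}) V; first by left; rewrite -eqUV.
right; have /andP[ntU nUN] := mingroupp minU.
have [W defV nWN] := maschke_compl abV p'N nVN nUN sUV.
have [_ defUW _ tiUW] := dprodP defV.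
have sWV : W \subset V by rewrite -defUW mulG_subr.
exists U, W; split=> //; first by rewrite properEneq neUV.
rewrite properEneq sWV andbT; apply: contra ntU => /eqP eWV.
by rewrite -(setIidPl sUV) -eWV tiUW.
Qed.

Lemma dprod_conj_fix gT (V U W A : {group gT}) u w x :
    U \x W = V -> A \subset 'N(U) -> A \subset 'N(W) -> x \in A ->
    u \in U -> w \in W -> u ^ x * w ^ x = u * w ->
  u ^ x = u /\ w ^ x = w.
Proof.
move=> defV nUA nWA Ax Uu Ww Jx; have [_ _ _ tiUW] := dprodP defV.
have Uux: u ^ x \in U by rewrite memJ_norm ?(subsetP nUA).
have Wwx: w ^ x \in W by rewrite memJ_norm ?(subsetP nWA).
have eq1: u^-1 * u ^ x = w * (w ^ x)^-1.
  by apply: (mulgI u); rewrite mulKVg mulgA -Jx mulgK.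
have /set1P e1 : u^-1 * u ^ x \in [1 gT].
  by rewrite -tiUW inE groupM ?groupV //= eq1 groupM ?groupV.
split; first by apply/eqP; rewrite eq_sym eq_mulVg1 e1.
by apply/eqP; rewrite eq_sym eq_mulgV1 -eq1 e1.
Qed.

(** For irreducible [V] any [v != 1] works: as [A] is abelian, the fixed points of ['C_A[v]] form an
    [A]-invariant subgroup, hence all of [V]. Points chosen in two direct factors multiply to a
    point for the product. *)
Lemma regular_point gT p (V A : {group gT}) :
    p.-abelem V -> abelian A -> p^'.-group A -> A \subset 'N(V) ->
  exists2 v, v \in V & 'C_A[v] = 'C_A(V).
Proof.
move: {2}_.+1 (ltnSn #|V|) => n; elim: n V => // n IHn V leVn abV cAA p'A nVA.
have [V1 | ntV] := eqsVneq V 1.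
  by exists 1; rewrite ?V1 ?inE // -cent_set1.
have [minV | [U [W [defV nUA nWA ltU ltW]]]] := minnormal_or_split abV p'A nVA ntV.
  have [v Vv ntv] := trivgPn _ ntV; exists v => //.
  apply/eqP; rewrite eqEsubset andbC setIS; last by rewrite -cent_set1 centS ?sub1set.
  rewrite subsetI subsetIl centsC /=.
  have [_ min_V] := mingroupP minV.
  apply/setIidPl; rewrite -[V :&: _]/(gval 'C_V('C_A[v])%G); apply: min_V; last exact: subsetIl.
  apply/andP; split.
    by apply/trivgPn; exists v => //; rewrite inE Vv; apply/centP=> x /setIP[_ /cent1P].
  rewrite normsI // (subset_trans _ (cent_norm _)) ?norms_cent //.
  by rewrite sub_abelian_norm ?subsetIl.
have [cVV [sUV sWV]] := (abelem_abelian abV, (proper_sub ltU, proper_sub ltW)).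
have lt_n (X : {group gT}) : X \proper V -> #|X| < n.
  by move=> ltX; rewrite (leq_trans (proper_card ltX)).
have [u Uu Cu] := IHn U (lt_n _ ltU) (abelemS sUV abV) cAA p'A nUA.
have [w Ww Cw] := IHn W (lt_n _ ltW) (abelemS sWV abV) cAA p'A nWA.
have [_ defUW cUW tiUW] := dprodP defV.
exists (u * w); first by rewrite -defUW mem_mulg.
apply/eqP; rewrite eqEsubset andbC setIS; last first.
  by rewrite -cent_set1 centS ?sub1set // -defUW mem_mulg.
apply/subsetP=> x /setIP[Ax cx]; rewrite inE Ax -defUW centM inE.
have Jx: (u ^ x) * (w ^ x) = u * w.
  by rewrite -conjMg; apply/conjg_fixP/commgP; rewrite cent1C in cx; apply/cent1P.
have [ux wx] := dprod_conj_fix defV nUA nWA Ax Uu Ww Jx.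
have : x \in 'C_A[u] by rewrite inE Ax cent1C; apply/cent1P/commgP/conjg_fixP.
have : x \in 'C_A[w] by rewrite inE Ax cent1C; apply/cent1P/commgP/conjg_fixP.
by rewrite Cu Cw => /setIP[_ ->] /setIP[_ ->].
Qed.

Lemma regular_abelian_card gT p (V A : {group gT}) :
    p.-abelem V -> abelian A -> p^'.-group A -> A \subset 'N(V) ->
    'C_A(V) = 1 -> V :!=: 1 -> #|A| < #|V|.
Proof.
move=> abV cAA p'A nVA CAV ntV; have [v Vv Cv] := regular_point abV cAA p'A nVA.
have [v1 | ntv] := eqVneq v 1.
  move: Cv; rewrite CAV v1 cent11T setIT => ->.
  by rewrite cards1 cardG_gt1.
rewrite -indexg1 -CAV -Cv index_cent1.
apply: leq_trans (_ : #|V^#|.+1 <= _); last first.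
  by rewrite (cardsD1 1 V) group1.
rewrite ltnS subset_leq_card //; apply/subsetP=> _ /imsetP[x Ax ->].
by rewrite !inE conjg_eq1 ntv memJ_norm ?(subsetP nVA).
Qed.

Lemma minnormal_faithful_abelian_cyclic gT p (V A : {group gT}) :
    p.-abelem V -> minnormal V A -> abelian A -> 'C_A(V) = 1 -> cyclic A.
Proof.
move=> abV minV cAA CAV; have /andP[ntV nVA] := mingroupp minV.
apply: (@mx_faithful_irr_abelian_cyclic _ _ _ _ (abelem_repr abV ntV nVA)) => //.
  exact: abelem_mx_faithful.
exact/abelem_mx_irrP.
Qed.

(** A non-cyclic abelian group is never faithful on an irreducible module, so some nontrivial [e]
    centralises a minimal [E]-invariant subgroup of [V]. *)
Lemma noncyclic_fixpoint gT p (V E : {group gT}) :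
    p.-abelem V -> V :!=: 1 -> E \subset 'N(V) -> abelian E -> ~~ cyclic E ->
  exists2 e, e \in E^# & 'C_V[e] != 1.
Proof.
move=> abV ntV nVE cEE ncE; have [U minU sUV] := minnormal_exists ntV nVE.
have /andP[ntU nUE] := mingroupp minU.
have /trivgPn[e /setIP[Ee cUe] nte]: 'C_E(U) != 1.
  apply: contraNneq ncE => CEU; exact: minnormal_faithful_abelian_cyclic (abelemS sUV abV) minU
    cEE CEU.
exists e; first by rewrite !inE nte.
apply: contra ntU => /eqP CVe; rewrite -subG1 -CVe subsetI sUV.
by apply/subsetP=> u Uu; rewrite cent1C; apply/cent1P/(centP cUe).
Qed.

Lemma index_setI gT (G A B : {group gT}) :
  A \subset G -> B \subset G -> #|G : A :&: B| <= #|G : A| * #|G : B|.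
Proof.
move=> sAG sBG.
rewrite -(Lagrange_index sAG (subsetIl A B)) leq_mul2l; apply/orP; right.
have [sIA gt0I] := (subsetIl A B, cardG_gt0 (A :&: B)%G).
rewrite -(leq_pmul2r gt0I) mulnC Lagrange //.
rewrite -(leq_pmul2r (cardG_gt0 B)) mul_cardG -mulnA [(#|_ :&: _| * _)%N]mulnC mulnA.
rewrite leq_mul2r [(_ * #|B|)%N]mulnC Lagrange // subset_leq_card ?orbT //.
by rewrite mul_subG.
Qed.

(* The elements of [N] that centralise [A] modulo the kernel of the action of [N]
   on [V]; it replaces ['C_N(A)] when that action is not faithful. *)
Definition cent_mod gT (N A V : {group gT}) : {set gT} :=
  N :&: coset 'C_N(V) @*^-1 'C(A / 'C_N(V)).
Canonical cent_mod_group gT (N A V : {group gT}) := [group of cent_mod N A V].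

Lemma cent_modP gT (N A V : {group gT}) x :
    N \subset 'N(V) -> A \subset N ->
  reflect (x \in N /\ {in A, forall a, [~ x, a] \in 'C(V)})
          (x \in cent_mod N A V).
Proof.
move=> nVN sAN; set K := 'C_N(V)%G.
have nKN: N \subset 'N(K) by rewrite normsI ?normG // norms_cent.
have nKA := subset_trans sAN nKN.
apply: (iffP idP) => [/setIP[Nx /morphpreP[nKx cx]] | [Nx cx]].
  split=> // a Aa; have : [~ x, a] \in K.
    apply: coset_idr; first by rewrite groupR // (subsetP nKA).
    rewrite morphR //; last exact: (subsetP nKA).
    by apply/eqP/commgP/(centP cx)/mem_quotient.
  by case/setIP.
rewrite inE Nx; apply/morphpreP; split; first exact: (subsetP nKN).
apply/centP=> _ /morphimP[a nKa Aa ->]; apply/commgP.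
rewrite -morphR //; last exact: (subsetP nKN).
rewrite /= coset_id // /K.
by rewrite inE cx // groupR // (subsetP sAN).
Qed.

Lemma cent_mod_faithful gT (N A V : {group gT}) :
  N \subset 'N(V) -> A \subset N -> 'C_N(V) = 1 -> cent_mod N A V = 'C_N(A).
Proof.
move=> nVN sAN CNV; apply/setP=> x; apply/cent_modP/setIP=> // [] [Nx cx].
  split=> //; apply/centP=> a Aa; apply/commgP; rewrite -in_set1 -[[set 1]]CNV.
  by rewrite inE cx // groupR // (subsetP sAN).
by split=> // a Aa; rewrite (eqP (introT commgP (centP cx a Aa))) group1.
Qed.

Lemma cent_mod_dprod gT (N A V U W : {group gT}) :
    N \subset 'N(U) -> N \subset 'N(W) -> A \subset N -> U \x W = V ->
  cent_mod N A V = cent_mod N A U :&: cent_mod N A W.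
Proof.
move=> nUN nWN sAN defV; have [_ defUW _ _] := dprodP defV.
have nVN : N \subset 'N(V) by rewrite -defUW normsM.
have cV : 'C(V) = 'C(U) :&: 'C(W) by rewrite -defUW centM.
apply/setP=> x; rewrite [RHS]inE; apply/cent_modP/andP=> // [[Nx cx] | []].
  by split; apply/cent_modP=> //; split=> // a /cx; rewrite cV inE => /andP[].
move=> /cent_modP-[] // Nx cUx /cent_modP-[] // _ cWx; split=> // a Aa.
by rewrite cV inE cUx ?cWx.
Qed.

Lemma index_cent_mod_dprod gT (N A V U W : {group gT}) :
    N \subset 'N(U) -> N \subset 'N(W) -> A \subset N -> U \x W = V ->
  #|N : cent_mod N A V| <= #|N : cent_mod N A U| * #|N : cent_mod N A W|.
Proof.
move=> nUN nWN sAN defV; rewrite (cent_mod_dprod nUN nWN sAN defV).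
by apply: index_setI; apply: subsetIl.
Qed.

(** [V] is divided by the kernel along with [N], so that both stay subgroups of one group; this
    costs nothing, since [K] and [V] have coprime orders. *)
Lemma faithful_quotient gT p (N A V : {group gT}) (K := 'C_N(V)%G) :
    p.-abelem V -> p^'.-group N -> N \subset 'N(V) -> A \subset N ->
  [/\ p.-abelem (V / K), N / K \subset 'N(V / K), 'C_(N / K)(V / K) = 1,
      #|V / K| = #|V|
    & #|N / K : cent_mod (N / K) (A / K) (V / K)| = #|N : cent_mod N A V|].
Proof.
move=> abV p'N nVN sAN.
have nKN: N \subset 'N(K) by rewrite normsI ?normG // norms_cent.
have nKV: V \subset 'N(K).
  by rewrite (subset_trans _ (cent_sub _)) // centsC subsetIr.
have tiKV : K :&: V = 1.
  rewrite setIC; apply: coprime_TIg; apply: (pnat_coprime (abelem_pgroup abV)).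
  exact: pgroupS (subsetIl _ _) p'N.
have tiNV : N :&: V = 1.
  by rewrite setIC; apply: coprime_TIg; apply: (pnat_coprime (abelem_pgroup abV)).
have nVNb : N / K \subset 'N(V / K) by rewrite quotient_norms.
have CNVb : 'C_(N / K)(V / K) = 1.
  apply/trivgP/subsetP=> _ /setIP[/morphimP[x nKx Nx ->] cVx]; apply/set1P.
  apply: coset_id; rewrite inE Nx; apply/centP=> v Vv; apply/commgP.
  rewrite -in_set1 -[[set 1]]tiKV inE; apply/andP; split; last first.
    by rewrite commgEr groupM // memJ_norm ?groupV // (subsetP nVN).
  apply: coset_idr; first by rewrite groupR // (subsetP nKV).
  rewrite morphR //; last exact: (subsetP nKV).
  by apply/eqP/commgP/(centP cVx)/mem_quotient.
split=> //.
- exact: quotient_abelem.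
- by rewrite -(card_isog (quotient_isog nKV tiKV)).
rewrite cent_mod_faithful ?quotientS //= -index_cosetpre quotientGK ?/normal ?subsetIl //.
congr #|_ : _|; rewrite /cent_mod -/K.
by rewrite morphpreI quotientGK ?/normal ?subsetIl.
Qed.

(** The automorphism group of a cyclic group of order [r ^ m.+1] has [r]-part [r ^ m]; the factor
    [r] is the difference. *)
Lemma index_cent_cyclic gT r (N A : {group gT}) :
    r.-group N -> A \subset N -> N \subset 'N(A) -> cyclic A -> A :!=: 1 ->
  r * #|N : 'C_N(A)| <= #|A|.
Proof.
move=> rN sAN nAN cycA ntA; have rA := pgroupS sAN rN.
have [pr_r _ [m oA]] := pgroup_pdiv rA ntA.
have := logn_quotient_cent_cyclic_pgroup nAN rA cycA.
have nCN : N \subset 'N('C_N(A)) by rewrite normsI ?normG // norms_cent.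
rewrite oA pfactorK //= -card_quotient // => le_m.
have /card_pgroup-> : r.-group (N / 'C_N(A)) by apply: quotient_pgroup.
by rewrite -expnS leq_exp2l ?(prime_gt1 pr_r).
Qed.

Lemma normal_p2_subgroup gT r (N A : {group gT}) :
    r.-group N -> A <| N -> abelian A -> ~~ cyclic A ->
  exists E : {group gT}, [/\ E \subset A, E <| N, r.-abelem E & #|E| = (r ^ 2)%N].
Proof.
move=> rN nsAN cAA ncA; have rA := pgroupS (normal_sub nsAN) rN.
have lt1 : 1 < logn r #|'Ohm_1(A)|.
  rewrite -p_rank_abelian // -(rank_pgroup rA) ltnNge.
  by rewrite -(abelian_rank1_cyclic cAA).
have nsON: 'Ohm_1(A) <| N by apply: gFnormal_trans.
have [E [sEO nsEN oE]] := normal_pgroup rN nsON lt1.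
exists E; split=> //; first exact: subset_trans sEO (Ohm_sub _ _).
exact: abelemS sEO (Ohm1_abelem rA cAA).
Qed.

(** [E] contains some [z] central in [N] and is generated by [z] and one more element [e], so
    ['C_N(E) = 'C_N[e]]. The class of [e] misses [z], so its size is a power of [r] below
    [r ^ 2]. *)
Lemma index_cent_p2 gT r (N E : {group gT}) :
    prime r -> r.-group N -> E <| N -> r.-abelem E -> #|E| = (r ^ 2)%N ->
  #|N : 'C_N(E)| <= r.
Proof.
move=> pr_r rN nsEN abE oE; have [sEN nEN] := andP nsEN.
have ntE: E :!=: 1 by rewrite -cardG_gt1 oE -(expn0 r) ltn_exp2l ?(prime_gt1 pr_r).
have := meet_center_nil (pgroup_nil rN) nsEN ntE.
case/trivgPn=> z /setIP[Ez /centerP[Nz cNz]] ntz.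
have oz: #[z] = r := abelem_order_p abE Ez ntz.
have [e Ee nze]: exists2 e, e \in E & e \notin <[z]>.
  apply/subsetPn; apply/negP=> /subset_leq_card.
  by rewrite oE -orderE oz -[X in _ <= X]expn1 leq_exp2l // prime_gt1.
have defE : <[z]> <*> <[e]> = E.
  have sXE : <[z]> <*> <[e]> \subset E by rewrite join_subG !cycle_subG Ez.
  apply/eqP; rewrite eqEcard sXE oE /=.
  have rX := pgroupS sXE (abelem_pgroup abE).
  rewrite (card_pgroup rX) leq_exp2l ?(prime_gt1 pr_r) //.
  have /(properG_ltn_log rX) : <[z]> \proper <[z]> <*> <[e]>.
    by rewrite properE joing_subl join_subG subxx cycle_subG.
  by rewrite -orderE oz logn_prime // eqxx.
have -> : 'C_N(E) = 'C_N[e].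
  rewrite -defE centY !cent_cycle setIA.
  suff /setIidPl-> : N \subset 'C[z] by [].
  by apply/subsetP=> x /cNz czx; apply/cent1P.
rewrite index_cent1.
have rc : r.-nat #|e ^: N|.
  by rewrite -index_cent1; apply: pnat_dvd (dvdn_indexg _ _) rN.
have : #|e ^: N| < r ^ 2.
  rewrite -oE proper_card // properE class_sub_norm // Ee.
  apply/subsetPn; exists z => //; apply: contra nze => /imsetP[x Nx def_z].
  suff -> : e = z by apply: cycle_id.
  apply: (conjg_inj x); rewrite -def_z; apply/esym/conjg_fixP/commgP.
  exact: cNz.
have [k ->] := p_natP rc; rewrite ltn_exp2l ?(prime_gt1 pr_r) // ltnS => lek1.
by rewrite -[X in _ <= X]expn1 leq_exp2l ?(prime_gt1 pr_r).
Qed.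

(* A cyclic [A] acts regularly on some vector. Otherwise [A] contains a normal
   subgroup [E] of order [r ^ 2], some [e] in [E] has fixed points, and over the
   centraliser of [E], of index at most [r], [V] splits along these fixed points. *)
Lemma cent_mod_abelian_bound gT p r (N A V : {group gT}) :
    p.-abelem V -> prime r -> r.-group N -> r != p -> N \subset 'N(V) ->
    A <| N -> abelian A -> ~~ (A \subset 'C(V)) ->
  r * #|N : cent_mod N A V| < #|V|.
Proof.
move=> abV pr_r rN nrp; have p'N gT' (X : {group gT'}) : r.-group X -> p^'.-group X.
  by move=> rX; apply: pi_pgroup rX _; rewrite !inE.
have [n] := ubnP (#|N| + #|V|); elim: n => // n IHn in gT N A V abV rN *.
rewrite ltnS => leNVn nVN nsAN cAA nAV; have [sAN nAN] := andP nsAN.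
have ntV: V :!=: 1 by apply: contraNneq nAV => ->; apply: cents1.
set K := 'C_N(V)%G; have [ntK | tiK] := boolP (K :!=: 1).
  have [abVq nVNq CNVq oVq iNq] := faithful_quotient abV (p'N _ _ rN) nVN sAN.
  rewrite -/K in abVq nVNq CNVq oVq iNq; rewrite -iNq -oVq.
  apply: IHn; rewrite ?quotient_pgroup ?quotient_abelian ?quotient_normal //.
    rewrite oVq (leq_trans _ leNVn) // ltn_add2r.
    by rewrite ltn_quotient ?subsetIl.
  apply: contra nAV => cAVq.
  have : A / K \subset 'C_(N / K)(V / K) by rewrite subsetI quotientS.
  rewrite CNVq quotient_sub1.
    by rewrite subsetI => /andP[].
  by rewrite (subset_trans sAN) // normsI ?normG // norms_cent.
have{K tiK} CNV : 'C_N(V) = 1 by apply/eqP; rewrite negbK in tiK.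
have p'Ng := p'N _ _ rN.
(* Each of the two factors contributes its own [r]. One is the [r] of the statement, the other pays
   for the index of the centraliser [S] when [V] splits only over [S]. *)
have red (M U W : {group gT}) : M \subset N -> A \subset M -> U \x W = V ->
    M \subset 'N(U) -> M \subset 'N(W) -> U \proper V -> W \proper V ->
  ~~ (A \subset 'C(U)) -> ~~ (A \subset 'C(W)) ->
  r * (r * #|M : cent_mod M A V|) < #|V|.
- move=> sMN sAM defV nUM nWM ltU ltW nAU nAW.
  have rM := pgroupS sMN rN; have nsAM := normalS sAM sMN nsAN.
  have lt_n (X : {group gT}) : X \proper V -> #|M| + #|X| < n.
    move=> ltX; apply: leq_trans leNVn; rewrite -addnS leq_add ?subset_leq_card //.
    exact: proper_card.
  have bU := IHn _ _ _ _ (abelemS (proper_sub ltU) abV) rM (lt_n _ ltU) nUM nsAM cAA nAU.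
  have bW := IHn _ _ _ _ (abelemS (proper_sub ltW) abV) rM (lt_n _ ltW) nWM nsAM cAA nAW.
  rewrite -(dprod_card defV); apply: leq_ltn_trans (ltn_mul bU bW).
  rewrite mulnACA mulnA leq_mul2l; apply/orP; right.
  exact: index_cent_mod_dprod.
have [minV | [U [W [defV nUN nWN ltU ltW]]]] := minnormal_or_split abV p'Ng nVN ntV; last first.
  have one (U1 W1 : {group gT}) : U1 \x W1 = V -> N \subset 'N(U1) -> N \subset 'N(W1) ->
      W1 \proper V -> A \subset 'C(U1) -> r * #|N : cent_mod N A V| < #|V|.
    move=> defV1 nUN1 nWN1 ltW1 cAU1.
    have [_ defUW1 _ _] := dprodP defV1.
    have nAW1: ~~ (A \subset 'C(W1)).
      by apply: contra nAV => cAW1; rewrite -defUW1 centM subsetI cAU1.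
    have e : cent_mod N A V = cent_mod N A W1.
      rewrite (cent_mod_dprod nUN1 nWN1 sAN defV1); apply/setIidPr.
      apply/subsetP=> x /cent_modP-[] // Nx _; apply/cent_modP=> //; split=> // a Aa.
      have nCx : x \in 'N('C(U1)) by apply: subsetP Nx; apply: norms_cent.
      by rewrite commgEr groupM ?memJ_norm ?groupV ?(subsetP cAU1).
    rewrite e; apply: leq_trans (proper_card ltW1); apply: leqW.
    apply: IHn => //; first exact: abelemS (proper_sub ltW1) abV.
    by apply: leq_trans leNVn; rewrite ltn_add2l proper_card.
  have [cAU | nAU] := boolP (A \subset 'C(U)); first exact: (one U W).
  have [cAW | nAW] := boolP (A \subset 'C(W)).
    by apply: (one W U) => //; rewrite dprodC.
  have := red N U W (subxx _) sAN defV nUN nWN ltU ltW nAU nAW.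
  by apply: leq_ltn_trans; rewrite leq_pmull ?prime_gt0.
have [_ min_V] := mingroupP minV.
have fixV (X : {group gT}) : X \subset V -> N \subset 'N(X) -> ~~ (V \subset X) -> X :=: 1.
  move=> sXV nXN; apply: contraNeq => ntX; rewrite (min_V X) //.
  by rewrite ntX.
(* By irreducibility [A] fixes no nontrivial vector, so it acts nontrivially on every nontrivial
   subgroup of [V], in particular on both factors of the splitting over [S]. *)
have CVA : 'C_V(A) = 1.
  apply: fixV; rewrite ?subsetIl //=; first by rewrite normsI ?norms_cent.
  by apply: contra nAV; rewrite subsetI centsC => /andP[].
have ntA : A :!=: 1 by apply: contraNneq nAV => ->; apply: sub1G.
rewrite cent_mod_faithful //.
have CAV : 'C_A(V) = 1.
  by apply/trivgP; rewrite -CNV setSI.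
have [cycA | ncA] := boolP (cyclic A).
  apply: leq_ltn_trans (index_cent_cyclic rN sAN nAN cycA ntA) _.
  apply: regular_abelian_card abV cAA _ _ CAV ntV; first exact/p'N/(pgroupS sAN).
  exact: subset_trans nVN.
have [E [sEA nsEN abE oE]] := normal_p2_subgroup rN nsAN cAA ncA.
have sEN := subset_trans sEA sAN; have cEE := abelem_abelian abE.
have ncE : ~~ cyclic E.
  by rewrite (abelem_cyclic abE) oE pfactorK.
pose S := 'C_N(E)%G.
have sAS : A \subset S by rewrite subsetI sAN (subset_trans cAA) ?centS.
have [e /setD1P[nte Ee] ntU] :=
  noncyclic_fixpoint abV ntV (subset_trans sEN nVN) cEE ncE.
pose U := 'C_V[e]%G.
have nVS : S \subset 'N(V) := subset_trans (subsetIl _ _) nVN.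
have nUS : S \subset 'N(U).
  rewrite /= -cent_cycle normsI // norms_cent // cents_norm // centsC cycle_subG.
  by rewrite (subsetP _ e Ee) // centsC subsetIr.
have [W defV nWS] := maschke_compl abV (pgroupS (subsetIl _ _) p'Ng) nVS nUS (subsetIl _ _).
have [_ defUW _ tiUW] := dprodP defV.
have [sUV sWV]: U \subset V /\ W \subset V by rewrite -defUW mulG_subl mulG_subr.
have nVU : ~~ (V \subset U).
  apply: contra nte; rewrite subsetI sub_cent1 => /andP[_ cVe].
  by rewrite -in_set1 -[[set 1]]CNV inE (subsetP sEN).
have ltU : U \proper V by rewrite properE sUV.
have ltW : W \proper V.
  rewrite properE sWV; apply: contra ntU => sVW.
  by rewrite -subG1 -tiUW subsetI subxx (subset_trans sUV).
have ntW : W :!=: 1.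
  by apply: contraNneq nVU => W1; rewrite -defUW W1 mulg1.
have nAX (X : {group gT}) : X \subset V -> X :!=: 1 -> ~~ (A \subset 'C(X)).
  by move=> sXV; apply: contra; rewrite centsC -subG1 -CVA subsetI sXV.
have := red S U W (subsetIl _ _) sAS defV nUS nWS ltU ltW (nAX _ sUV ntU) (nAX _ sWV ntW).
apply: leq_ltn_trans; rewrite leq_mul2l; apply/orP; right.
have sCS : cent_mod S A V \subset 'C_N(A).
  apply/subsetP=> x /cent_modP-[] // /setIP[Nx _] cx; rewrite inE Nx.
  apply/centP=> a Aa; apply/commgP; rewrite -in_set1 -[[set 1]]CNV.
  by rewrite inE cx // groupR // (subsetP sAN).
apply: leq_trans (_ : #|N : cent_mod S A V| <= _).
  by rewrite dvdn_leq // indexgS.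
rewrite -(Lagrange_index (subsetIl N 'C(E)) (subsetIl S _)) leq_mul2r.
by rewrite (index_cent_p2 pr_r rN) ?orbT.
Qed.

Lemma cent1_semiregular gT (V Z : {group gT}) z :
  semiregular V Z -> z \in Z -> 'C_V[z] != 1 -> z = 1.
Proof.
by move=> regZ Zz; apply: contraNeq => ntz; rewrite regZ ?inE ?ntz.
Qed.

Lemma cent1_sub_semiregular gT (V Z : {group gT}) z v :
  semiregular V Z -> z \in Z -> v \in V -> z != 1 -> commute v z -> v = 1.
Proof.
move=> regZ Zz Vv ntz cvz; apply/set1P.
suff : v \in 'C_V[z] by rewrite regZ // !inE ntz.
by rewrite inE Vv cent1C; apply/cent1P.
Qed.

(** A vector fixed by two of the conjugates is fixed by their quotient, which lies in the
    semiregular [Z]; so their fixed spaces, all of one size, meet trivially in pairs. As [g]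
    commutes with [e] and [f], it normalises their fixed spaces, and a vector of the product fixed
    by [g] has both components fixed by [g], hence trivial. *)
Lemma three_cent1_card gT (V N Z : {group gT}) e f g :
    N \subset 'N(V) -> abelian V -> Z \subset 'C(N) -> Z \subset N -> semiregular V Z ->
    e \in N -> f \in e ^: N -> g \in e ^: N -> e^-1 * f \in Z -> e^-1 * g \in Z ->
    f != e ->
  (#|'C_V[e]| ^ 2 <= #|V|)%N
    /\ (g != e -> g != f -> (#|'C_V[e]| ^ 3 <= #|V|)%N).
Proof.
move=> nVN cVV cNZ sZN regZ Ne ef eg Zf Zg nfe.
have cardC h : h \in e ^: N -> #|'C_V[h]| = #|'C_V[e]|.
  case/imsetP=> y Ny ->; rewrite -(cardJg 'C_V[e] y) conjIg -!cent_cycle cycleJ centJ.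
  by rewrite (normsP nVN).
have NcE h : h \in e ^: N -> h \in N.
  by case/imsetP=> y Ny ->; rewrite groupJ.
have tiC a b v : a^-1 * b \in Z -> a != b -> v \in V -> commute v a -> commute v b -> v = 1.
  move=> Zab nab Vv cva cvb; apply: (cent1_sub_semiregular regZ Zab) => //.
    by rewrite -eq_mulVg1.
  by apply: commuteM => //; apply: commuteV.
have memC h v : v \in 'C_V[h] -> v \in V /\ commute v h.
  by case/setIP=> Vv /cent1P.
have tiU : 'C_V[e] :&: 'C_V[f] = 1.
  apply/trivgP/subsetP=> v /setIP[/memC[Vv cve] /memC[_ cvf]]; apply/set1P.
  by apply: (tiC e f); rewrite 1?eq_sym.
have cUW : 'C_V[f] \subset 'C('C_V[e]).
  apply: subset_trans (subsetIl _ _) _.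
  exact: subset_trans cVV (centS (subsetIl _ _)).
pose X := ('C_V[e] <*> 'C_V[f])%G.
have defX : X :=: 'C_V[e] * 'C_V[f] by rewrite /= cent_joinEr.
have defU : 'C_V[e] \x 'C_V[f] = X by rewrite dprodE.
have sUV : 'C_V[e] * 'C_V[f] \subset V by rewrite mul_subG ?subsetIl.
have cardU : #|'C_V[e] * 'C_V[f]| = (#|'C_V[e]| ^ 2)%N.
  by rewrite TI_cardMg // (cardC f).
split=> [|nge ngf]; first by rewrite -cardU subset_leq_card.
suff tiW : ('C_V[e] * 'C_V[f]) :&: 'C_V[g] = 1.
  rewrite expnSr -cardU -(cardC g) // -defX -TI_cardMg ?defX //.
  by rewrite subset_leq_card // mul_subG ?subsetIl.
rewrite -defX; apply/trivgP/subsetP=> x /setIP[]; rewrite defX.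
case/mulsgP=> u w Uu Ww -> /memC[Vuw cg]; apply/set1P.
have [[Vu cu] [Vw cw]] := (memC _ _ Uu, memC _ _ Ww).
have [Nf Ng] := (NcE _ ef, NcE _ eg).
have nC h : h \in N -> e^-1 * h \in Z -> <[g]> \subset 'N('C_V[h]).
  move=> Nh Zh; rewrite cycle_subG.
  have cgh : commute g h.
    have -> : g = h * ((e^-1 * h)^-1 * (e^-1 * g)) by rewrite invMg invgK -!mulgA mulKVg mulKVg.
    apply/commute_sym; apply: commuteM => //; apply/commute_sym.
    by apply: (centP (subsetP cNZ _ _)) => //; rewrite groupM ?groupV.
  have nCg : g \in 'N('C[h]).
    by apply: (subsetP (normG _)); apply/cent1P; apply: commute_sym.
  by apply/normP; rewrite conjIg (normsP nVN) // (normP nCg).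
have ngg := cycle_id g.
have Jx : u ^ g * w ^ g = u * w by rewrite -conjMg; apply/conjg_fixP/commgP.
have Zee : e^-1 * e \in Z by rewrite mulVg.
have [ug wg] := dprod_conj_fix defU (nC e Ne Zee) (nC f Nf Zf) ngg Uu Ww Jx.
have cug : commute u g by apply/commgP/conjg_fixP.
have cwg : commute w g by apply/commgP/conjg_fixP.
rewrite (tiC e g u) // 1?eq_sym // mul1g (tiC f g w) // 1?eq_sym //.
have -> : f^-1 * g = (e^-1 * f)^-1 * (e^-1 * g) by rewrite invMg invgK mulgA mulgK.
by rewrite groupM ?groupV.
Qed.

Lemma cube_bound r u v : 1 < r -> r < u -> (u ^ 2 <= v)%N ->
  (2 < r -> (u ^ 3 <= v)%N) -> r * (u.-1 * r) < v.
Proof.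
case: u => // u lt1r; rewrite ltnS => le_ru V2 V3; rewrite succnK.
have [le2r | gt2r] := leqP r 2.
  have -> : r = 2 by apply/eqP; rewrite eqn_leq le2r.
  by apply: leq_trans V2; nia.
apply: leq_trans (V3 gt2r); rewrite (_ : u.+1 ^ 3 = u.+1 * (u.+1 * u.+1))%N; last first.
  by rewrite !expnS expn0 muln1.
have le2 : r * r <= u * u by apply: leq_mul.
nia.
Qed.

(* If the action is irreducible but not semiregular, some [e] of order [r] has a
   fixed space [U]; the centraliser [S] of [e] has index [r] and acts on [U], while
   two or three conjugates of [e] have independent fixed spaces, so that
   [#|U| ^ 2] or [#|U| ^ 3] is at most [#|V|]. *)
Lemma cent_mod_class2_bound gT p r (N V : {group gT}) :
    p.-abelem V -> prime r -> r.-group N -> r != p -> N \subset 'N(V) ->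
    N^`(1) \subset 'C(N) -> V :!=: 1 ->
  #|N : cent_mod N N V| < #|V|.
Proof.
move=> abV pr_r rN nrp; have p'N gT' (X : {group gT'}) : r.-group X -> p^'.-group X.
  by move=> rX; apply: pi_pgroup rX _; rewrite !inE.
have [n] := ubnP (#|N| + #|V|); elim: n => // n IHn in gT N V abV rN *.
rewrite ltnS => leNVn nVN cN'N ntV.
set K := 'C_N(V)%G; have [ntK | tiK] := boolP (K :!=: 1).
  have [abVq nVNq CNVq oVq iNq] := faithful_quotient abV (p'N _ _ rN) nVN (subxx _).
  rewrite -/K in abVq nVNq CNVq oVq iNq; rewrite -iNq -oVq.
  apply: IHn; rewrite ?quotient_pgroup //.
  - rewrite oVq (leq_trans _ leNVn) // ltn_add2r.
    by rewrite ltn_quotient ?subsetIl.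
  - rewrite -quotient_der ?quotient_cents //.
    by rewrite normsI ?normG // norms_cent.
  by rewrite -cardG_gt1 oVq cardG_gt1.
have{K tiK} CNV : 'C_N(V) = 1 by apply/eqP; rewrite negbK in tiK.
have p'Ng := p'N _ _ rN.
have [minV | [U [W [defV nUN nWN ltU ltW]]]] := minnormal_or_split abV p'Ng nVN ntV; last first.
  have [_ defUW _ _] := dprodP defV.
  have lt_n (X : {group gT}) : X \proper V -> #|N| + #|X| < n.
    by move=> ltX; apply: leq_trans leNVn; rewrite ltn_add2l proper_card.
  have ntU : U :!=: 1.
    by apply: contraTneq ltW => U1; rewrite -defUW U1 mul1g properxx.
  have ntW : W :!=: 1.
    by apply: contraTneq ltU => W1; rewrite -defUW W1 mulg1 properxx.
  have bU := IHn _ _ _ (abelemS (proper_sub ltU) abV) rN (lt_n _ ltU) nUN cN'N ntU.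
  have bW := IHn _ _ _ (abelemS (proper_sub ltW) abV) rN (lt_n _ ltW) nWN cN'N ntW.
  rewrite -(dprod_card defV); apply: leq_ltn_trans (ltn_mul bU bW).
  exact: index_cent_mod_dprod.
have [_ min_V] := mingroupP minV.
have fixV (X : {group gT}) : X \subset V -> N \subset 'N(X) -> ~~ (V \subset X) -> X :=: 1.
  move=> sXV nXN; apply: contraNeq => ntX; rewrite (min_V X) //.
  by rewrite ntX.
rewrite cent_mod_faithful //.
have regZ : semiregular V 'Z(N).
  move=> z /setD1P[ntz /setIP[Nz cNz]]; apply: fixV; rewrite ?subsetIl //=.
    rewrite -cent_cycle normsI // norms_cent // cents_norm // centsC cycle_subG.
    by [].
  apply: contra ntz; rewrite subsetI sub_cent1 => /andP[_ cVz].
  by rewrite -in_set1 -[[set 1]]CNV inE Nz.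
have [regN | ] := boolP [forall x in N^#, 'C_V[x] == 1].
  have regN' : semiregular V N by move=> x Nx; apply/eqP/(forall_inP regN).
  have gt1V : 1 < #|V| by rewrite cardG_gt1.
  have leN : #|N| <= #|V|.-1.
    by apply: dvdn_leq (regular_norm_dvd_pred nVN regN'); rewrite -ltnS prednK // ltnW.
  rewrite -(ltn_predK gt1V) ltnS (leq_trans _ leN) //.
  by rewrite dvdn_leq // dvdn_indexg.
rewrite negb_forall_in => /exists_inP[x /setD1P[ntx Nx] ntCx].
have rx : r.-elt x := mem_p_elt rN Nx.
have [e Ne [oe ntCe]] : exists2 e, e \in N & #[e] = r /\ 'C_V[e] != 1.
  have rX : r.-group <[x]> by [].
  have ntX : <[x]> != 1 by rewrite cycle_eq1.
  have [_ rdX _] := pgroup_pdiv rX ntX; have [e Xe oe] := Cauchy pr_r rdX.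
  exists e; first by apply: subsetP Xe; rewrite cycle_subG.
  split=> //; apply: contraNneq ntCx => CVe; rewrite -subG1 -CVe.
  by apply: setIS; rewrite /= -(cent_cycle x) -(cent_cycle e) centS // cycle_subG.
(* ['Z(N)] acts semiregularly, so it is cyclic and [T] has order [r]. All conjugates of [e] lie in
   its coset of [T], since [[~ e, y] ^+ r = [~ e ^+ r, y] = 1] in class two. *)
pose T := 'Ohm_1('Z(N))%G.
have sZN : 'Z(N) \subset N := center_sub N.
have sTZ : T \subset 'Z(N) := Ohm_sub 1 _.
have cycZ : cyclic 'Z(N).
  apply: contraT => ncZ.
  have [z Zz] := noncyclic_fixpoint abV ntV (subset_trans sZN nVN) (center_abelian N) ncZ.
  by rewrite regZ ?eqxx.
have ntN : N :!=: 1 by apply/trivgPn; exists x.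
have ntZ : 'Z(N) != 1 by rewrite (center_nil_eq1 (pgroup_nil rN)).
have rZ : r.-group 'Z(N) := pgroupS sZN rN.
have oT : #|T| = r := Ohm1_cyclic_pgroup_prime cycZ rZ ntZ.
have memT z : z \in 'Z(N) -> z ^+ r = 1 -> z \in T.
  by move=> Zz zr; rewrite /T /= (OhmE 1 rZ) mem_gen //; apply/LdivP; rewrite expn1.
have comZ a b : a \in N -> b \in N -> [~ a, b] \in 'Z(N).
  move=> Na Nb; rewrite inE groupR //= (subsetP cN'N) //.
  by rewrite mem_commg.
have comX a b k : a \in N -> b \in N -> [~ a ^+ k, b] = [~ a, b] ^+ k.
  move=> Na Nb; apply: commXg; have /setIP[_ /centP cab] := comZ _ _ Na Nb.
  exact/commute_sym/cab.
have nZe : e \notin 'Z(N).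
  apply: contraL (prime_gt1 pr_r) => Ze.
  by rewrite -oe (cent1_semiregular regZ Ze ntCe) order1.
pose S := 'C_N[e]%G.
have sSN : S \subset N := subsetIl _ _.
have nsSN : S <| N.
  apply: sub_der1_normal => //; rewrite subsetI der_sub /=.
  by apply: subset_trans cN'N _; rewrite -cent_set1 centS // sub1set.
have clT f : f \in e ^: N -> e^-1 * f \in T.
  case/imsetP=> y Ny ->; rewrite -commgEl memT ?comZ //.
  by rewrite -comX // -oe expg_order comm1g.
have icl : #|e ^: N| = r.
  have le_r : #|e ^: N| <= r.
    rewrite -oT -(card_lcoset T e); apply: subset_leq_card; apply/subsetP=> f /clT.
    by rewrite mem_lcoset.
  have gt1 : 1 < #|e ^: N|.
    rewrite ltn_neqAle card_gt0 andbC; apply/andP; split.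
      by apply/set0Pn; exists e; apply: class_refl.
    rewrite eq_sym -index_cent1 indexg_eq1 subsetI subxx /=.
    by apply: contra nZe; rewrite sub_cent1 inE Ne.
  have [[|k] ek] : {k | #|e ^: N| = r ^ k}%N.
  - by apply: p_natP; rewrite -index_cent1; apply: pnat_dvd (dvdn_indexg _ _) rN.
  - by rewrite ek in gt1.
  apply/eqP; rewrite eqn_leq le_r ek -[X in X <= _]expn1 leq_exp2l //.
  exact: prime_gt1.
pose u := #|'C_V[e]|.
have [y Ny nSy] : exists2 y, y \in N & y \notin S.
  apply/subsetPn; apply/negP=> sNS; have := icl; rewrite -index_cent1.
  have /eqP-> : #|N : S| == 1%N by rewrite indexg_eq1.
  by move=> r1; rewrite -r1 in pr_r.
have yrS : y ^+ r \in S.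
  have nSyN : y \in 'N(S) by apply: subsetP Ny; apply: normal_norm.
  apply: coset_idr; first exact: groupX.
  rewrite morphX // -icl -index_cent1 -card_quotient ?normal_norm //.
  exact: expg_cardG (mem_quotient _ Ny).
have defN : S <*> <[y]> = N.
  have maxS : maximal S N by apply: (p_index_maximal sSN); rewrite index_cent1 icl.
  have [_ maxS'] := maxgroupP maxS.
  apply/eqP; rewrite eqEproper join_subG sSN cycle_subG Ny /=.
  apply: contra nSy => ltN; rewrite -(maxS' _ ltN) ?joing_subl //.
  by rewrite -cycle_subG joing_subr.
have sZS : 'Z(N) \subset S.
  by rewrite subsetI sZN sub_cent1 (subsetP _ e Ne) // centsC subsetIr.
have cS'S : S^`(1) \subset 'C(S).
  by apply: subset_trans (dergS 1 sSN) (subset_trans cN'N (centS sSN)).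
have nUS : S \subset 'N('C_V[e]).
  apply: normsI; first exact: subset_trans sSN nVN.
  apply: subset_trans (normG _); exact: subsetIr.
(* Induction for [S] acting on ['C_V[e]]: a commutator of elements of [S] lies in ['Z(N)], so if it
   is trivial on this nontrivial space it has a fixed point and is [1]. The centraliser modulo the
   kernel is therefore contained in ['Z(S)]. *)
have iSZS : #|S : 'Z(S)| < u.
  apply: (@leq_ltn_trans #|S : cent_mod S S 'C_V[e]%G|).
    rewrite dvdn_leq // indexgS //; apply/subsetP=> s /cent_modP-[] // Ss cs.
    rewrite inE Ss; apply/centP=> t St; apply/commgP; apply: contraR ntCe => nt1.
    rewrite -subG1; apply/subsetP=> v Cv; apply/set1P.
    apply: (cent1_sub_semiregular regZ _ _ nt1).
    - by apply: comZ; apply: (subsetP sSN).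
    - by case/setIP: Cv.
    exact/commute_sym/(centP (cs t St)).
  apply: (IHn _ S 'C_V[e]%G) => //; first exact: abelemS (subsetIl _ _) abV.
    exact: pgroupS rN.
  apply: leq_trans leNVn; rewrite -addSn leq_add //; last by rewrite subset_leq_card ?subsetIl.
  by rewrite proper_card // properE sSN; apply/subsetPn; exists y.
(* [N] is generated by [S] and [y], so an element of ['Z(S)] is central in [N] once it commutes with
   [y]. As [y ^+ r] lies in [S], the conjugates of [y] under ['Z(S)] stay in one coset of [T]. *)
have iZ : #|'Z(S) : 'Z(N)| <= r.
  have sC : 'C_('Z(S))[y] \subset 'Z(N).
    have cN : 'C(N) = 'C(S) :&: 'C[y] by rewrite -cent_cycle -centY defN.
    rewrite /('Z(N)) cN setIA setSI // subsetI subsetIr andbT.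
    exact: subset_trans (subsetIl _ _) sSN.
  apply: leq_trans (_ : #|'Z(S) : 'C_('Z(S))[y]| <= _).
    by rewrite dvdn_leq // indexgS.
  rewrite index_cent1 -oT -(card_lcoset T y) subset_leq_card //.
  apply/subsetP=> _ /imsetP[s Zs ->]; have /setIP[Ss cSs] := Zs.
  have Ns := subsetP sSN s Ss.
  rewrite mem_lcoset -commgEl memT ?comZ // -comX //; apply/eqP/commgP.
  exact/commute_sym/(centP cSs).
have iN : #|N : 'C_N(N)| <= r * (u.-1 * r).
  rewrite -/('Z(N)) -(Lagrange_index sSN sZS) index_cent1 icl leq_mul2l.
  apply/orP; right.
  have sZZ : 'Z(N) \subset 'Z(S) by rewrite subsetI sZS (subset_trans (subsetIr _ _)) // centS.
  rewrite -(Lagrange_index (center_sub S) sZZ) leq_mul // -ltnS.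
  by rewrite prednK // (leq_ltn_trans _ iSZS).
have regTU : semiregular 'C_V[e] T.
  exact: semiregularS (subsetIl _ _) sTZ regZ.
have gt1u : 1 < u by rewrite /u cardG_gt1.
have lt_ru : r < u.
  have nUT : T \subset 'N('C_V[e]) by rewrite (subset_trans sTZ) // (subset_trans sZS).
  have le_ru : r <= u.-1.
    by rewrite -oT dvdn_leq ?(regular_norm_dvd_pred nUT regTU) // -subn1 subn_gt0.
  by rewrite -(ltn_predK gt1u) ltnS.
have [f ef nfe] : exists2 f, f \in e ^: N & f != e.
  apply/exists_inP; apply: contraLR (prime_gt1 pr_r).
  rewrite negb_exists_in => /forall_inP all_e; rewrite -leqNgt -icl -(cards1 e).
  by rewrite subset_leq_card //; apply/subsetP=> f /all_e; rewrite negbK inE.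
have cardV2 : (u ^ 2 <= #|V|)%N /\ (2 < r -> (u ^ 3 <= #|V|)%N).
  have sTN := subset_trans sTZ sZN.
  have cNT : T \subset 'C(N) by apply: subset_trans sTZ (subsetIr _ _).
  have regT : semiregular V T := semiregularS (subxx _) sTZ regZ.
  have three g (eg : g \in e ^: N) :=
    three_cent1_card nVN (abelem_abelian abV) cNT sTN regT Ne ef eg (clT f ef) (clT g eg) nfe.
  split=> [|gt2r]; first by case: (three f ef).
  have [g eg /norP[nge ngf]] : exists2 g, g \in e ^: N & ~~ ((g == e) || (g == f)).
    apply/exists_inP; apply: contraLR gt2r.
    rewrite negb_exists_in => /forall_inP all_ef; rewrite -leqNgt -icl.
    apply: (@leq_trans #|[set e; f]|); last by rewrite cards2; case: (e != f).
    by apply: subset_leq_card; apply/subsetP=> g /all_ef; rewrite negbK !inE.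
  by case: (three g eg) => _; apply.
apply: leq_ltn_trans iN _; have [V2 V3] := cardV2.
exact: (cube_bound (prime_gt1 pr_r) lt_ru).
Qed.

Lemma abelian_second_center_der gT (G : {group gT}) :
  abelian ('Z_2(G) :&: G^`(1)).
Proof.
have cZG : [~: 'Z_2(G), G, G] = 1.
  apply/commG1P; apply: subset_trans (ucn_comm 1 G) _.
  by rewrite ucn1 subsetIr.
have : [~: G, G, 'Z_2(G)] = 1 by apply: three_subgroup; rewrite // [[~: G, _]]commGC.
move/commG1P=> cG'Z; apply: subset_trans (subsetIl _ _) _.
by rewrite centsC; apply: subset_trans (subsetIr _ _) cG'Z.
Qed.

Lemma second_center_der_sub gT (G : {group gT}) :
  nilpotent G -> 'Z_2(G) :&: G^`(1) \subset 'Z(G) -> G^`(1) \subset 'Z(G).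
Proof.
move=> nilG sZ; have nZG : G^`(1) \subset 'N('Z(G)).
  by rewrite (subset_trans (der_sub 1 G)) ?normal_norm ?center_normal.
rewrite -quotient_sub1 //; apply/trivgP.
apply: (TI_center_nil (quotient_nil 'Z(G) nilG)).
  by rewrite quotient_normal ?der_normal.
have := ucn_central 1 G; rewrite ucn1 => <-.
rewrite -quotientIG; last by have := ucn_subS 1 G; rewrite ucn1.
by apply/trivgP; rewrite setIC in sZ; rewrite quotient_sub1 // subIset ?nZG.
Qed.

Lemma index_mulg_setI gT (R N L : {group gT}) :
  N * L = R -> #|R : L| = #|N : N :&: L|.
Proof.
move=> defR; have sLR : L \subset R by rewrite -defR mulG_subr.
apply/eqP; rewrite -(eqn_pmul2l (cardG_gt0 L)) Lagrange // -defR.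
rewrite -(eqn_pmul2r (cardG_gt0 (N :&: L)%G)) -mul_cardG.
by rewrite -mulnA [(#|N : _| * _)%N]mulnC Lagrange ?subsetIl // mulnC.
Qed.

(* Pass to a minimal [H]-invariant subgroup [N] of [R] not contained in [L]. Either
   some [H]-invariant abelian subgroup of [N] is not central in [N], or [N] has
   class at most two. *)
Lemma chief_pgroup_bound gT p r (V H R L : {group gT}) :
    p.-abelem V -> V :!=: 1 -> prime r -> r != p -> r.-group R -> R \subset 'N(V) ->
    'C_R(V) = 1 -> R <| H -> L \proper R ->
    (forall Y : {group gT}, L \subset Y -> Y \subset R -> H \subset 'N(Y) ->
       Y :=: L \/ Y :=: R) -> H \subset 'N(L) ->
  #|R : L| < #|V|.
Proof.
move=> abV ntV pr_r nrp rR nVR CRV /andP[sRH nRH] /andP[sLR nsRL] maxL nLH.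
have p'N (X : {group gT}) : r.-group X -> p^'.-group X.
  by move=> rX; apply: pi_pgroup rX _; rewrite !inE.
have [N /mingroupP[/andP[nNL nNH] minN] sNR] :
    {N : {group gT} | [min N | ~~ (N \subset L) && (H \subset 'N(N))] & N \subset R}.
  by apply: mingroup_exists; rewrite nsRL.
have sN (X : {group gT}) : X \subset N -> H \subset 'N(X) -> X :!=: N -> X \subset L.
  move=> sXN nXH; apply: contraNT => nXL; apply/eqP; apply: minN => //.
  by rewrite nXL.
have defR : N * L = R.
  have nLN : N \subset 'N(L) := subset_trans (subset_trans sNR sRH) nLH.
  rewrite -norm_joinEl //.
  have sYR : N <*> L \subset R by rewrite join_subG sNR.
  have [eL | //] := maxL (N <*> L)%G (joing_subr _ _) sYR (normsY nNH nLH).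
  by case/negP: nNL; rewrite -eL joing_subl.
rewrite (index_mulg_setI defR).
have rN := pgroupS sNR rR; have nVN := subset_trans sNR nVR.
have CNV : 'C_N(V) = 1 by apply/trivgP; rewrite -CRV setSI.
(* By minimality of [N] its proper [H]-invariant subgroups lie in [L], so any of them may replace
   [N :&: L] in the estimate. *)
have iX (X : {group gT}) : X \subset N -> H \subset 'N(X) -> X :!=: N -> #|N : X| < #|V| ->
    #|N : N :&: L| < #|V|.
  move=> sXN nXH neXN; apply: leq_ltn_trans.
  by rewrite dvdn_leq // indexgS // subsetI sXN sN.
have [cNN | ncN] := boolP (abelian N).
  apply: leq_ltn_trans (regular_abelian_card abV cNN (p'N _ rN) nVN CNV ntV).
  by rewrite dvdn_leq // dvdn_indexg.
have [/existsP[A /and4P[sAN nAH cAA ncNA]] | ] :=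
  boolP [exists A : {group gT}, [&& A \subset N, H \subset 'N(A), abelian A & ~~ (N \subset
    'C(A))]].
  have nsAN : A <| N by rewrite /normal sAN (subset_trans (subset_trans sNR sRH)).
  have nCA : ~~ (A \subset 'C(V)).
    apply: contra ncNA => cVA.
    have /trivgP-> : A \subset [1] by rewrite -CNV subsetI sAN.
    by rewrite cents1.
  have := cent_mod_abelian_bound abV pr_r rN nrp nVN nsAN cAA nCA.
  rewrite cent_mod_faithful // => bA.
  apply: (iX 'C_N(A)%G) => /=; rewrite ?subsetIl //.
  - by rewrite normsI // norms_cent.
  - by apply: contra ncNA => /eqP<-; apply: subsetIr.
  by apply: leq_ltn_trans bA; rewrite leq_pmull ?prime_gt0.
rewrite negb_exists => /forallP allA.
(* The second centre meets the derived subgroup in an abelian group, by the three subgroup lemma;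
   under the present assumption this group is central in [N], and for nilpotent [N] that forces
   class at most two. *)
have cN'N : N^`(1) \subset 'Z(N).
  apply: second_center_der_sub (pgroup_nil rN) _.
  have nXH : H \subset 'N('Z_2(N) :&: N^`(1)).
    by rewrite normsI ?(char_norm_trans (ucn_char _ _)) ?(char_norm_trans (der_char _ _)).
  have sXN : 'Z_2(N) :&: N^`(1) \subset N by rewrite subIset // ucn_sub.
  have := allA ('Z_2(N) :&: N^`(1))%G; rewrite /= sXN nXH abelian_second_center_der /=.
  by rewrite negbK centsC subsetI sXN.
have := cent_mod_class2_bound abV pr_r rN nrp nVN (subset_trans cN'N (subsetIr _ _)) ntV.
rewrite cent_mod_faithful //; apply: (iX 'Z(N)%G); first exact: center_sub.
  exact: char_norm_trans (center_char N) nNH.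
by apply: contra ncN => /eqP defN; apply/center_idP.
Qed.

End CoprimeModules.

(** * Maximal subgroups of solvable groups *)

Section MaximalSubgroups.
Local Open Scope group_scope.
Implicit Types (gT : finGroupType) (p r : nat).

Lemma maximal_mulg gT (G M X : {group gT}) :
    maximal M G -> X \subset G -> M \subset 'N(X) -> ~~ (X \subset M) -> X * M = G.
Proof.
case/maxgroupP=> /andP[sMG _] maxM sXG nXM nXsM.
rewrite -norm_joinEr //; apply/eqP; rewrite eqEproper join_subG sXG sMG.
apply: contra nXsM => ltG; rewrite -(maxM (X <*> M)%G ltG) ?joing_subr //.
exact: joing_subl.
Qed.

Lemma normal_maximal_prime gT (G M : {group gT}) :
  maximal M G -> M <| G -> prime #|G : M|.
Proof.
move=> maxM nsMG; rewrite -card_quotient ?normal_norm //.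
rewrite -(quotient_maximal (normal_refl M) nsMG) trivg_quotient in maxM.
case/maxgroupP: maxM => /andP[_ nt1] max1.
have ntGM : G / M != 1 by apply: contra nt1 => /eqP->.
have [p p_pr pdv] : exists2 p, prime p & p %| #|G / M|.
  by exists (pdiv #|G / M|); rewrite ?pdiv_dvd // pdiv_prime // cardG_gt1.
have [x Gx ox] := Cauchy p_pr pdv.
have sxG : <[x]> \subset G / M by rewrite cycle_subG.
have [defG | ltG] := eqVproper sxG.
  by rewrite -defG -orderE ox.
by move: (max1 <[x]>%G ltG (sub1G _)) => x1; move: p_pr; rewrite -ox orderE x1 cards1.
Qed.

Lemma normal_maximal_der gT (G M : {group gT}) :
  maximal M G -> M <| G -> G^`(1) \subset M.
Proof.
move=> maxM nsMG; rewrite der1_min ?normal_norm // cyclic_abelian // prime_cyclic //.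
by rewrite card_quotient ?normal_norm // normal_maximal_prime.
Qed.

Lemma maximal_der_normal gT (G M : {group gT}) :
  maximal M G -> G^`(1) \subset M -> M <| G.
Proof. by move=> maxM sG'M; apply: sub_der1_normal sG'M (proper_sub (maxgroupp maxM)). Qed.

Lemma maximal_norm gT (G M : {group gT}) :
  maximal M G -> ~~ (M <| G) -> 'N_G(M) = M.
Proof.
move=> maxM nnM; have [/andP[sMG _] max_M] := maxgroupP maxM.
apply: (max_M 'N_G(M)%G); last by rewrite subsetI sMG normG.
rewrite properE subsetIl subsetI subxx /=; apply: contra nnM => nMG.
by rewrite /normal sMG.
Qed.

Lemma all_maximal_normal_nil gT (G : {group gT}) :
  (forall M : {group gT}, maximal M G -> M <| G) -> nilpotent G.
Proof.
move=> nsM; suff -> : G :=: 'F(G) by apply: Fitting_nil.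
apply/eqP; rewrite eqEsubset Fitting_sub andbT -{1}(Sylow_gen G) gen_subG.
apply/bigcupsP=> P /SylowP[p p_pr sylP]; apply: Fitting_max; last first.
  exact: pgroup_nil (pHall_pgroup sylP).
rewrite /normal (pHall_sub sylP) /=; apply/setIidPl/eqP; rewrite eqEproper subsetIl /=.
apply/negP=> ltN; have [eqN|[M maxM sNM]] := maximal_exists (subsetIl G 'N(P)).
  by rewrite /= eqN properxx in ltN.
have sMG := proper_sub (maxgroupp maxM).
have sylPM : p.-Sylow(M) P.
  apply: (pHall_subl _ sMG sylP); apply: subset_trans sNM.
  by rewrite subsetI normG (pHall_sub sylP).
have := Frattini_arg (nsM M maxM) sylPM; rewrite mulGSid // => defG.
by have /andP[_] := maxgroupp maxM; rewrite -{1}defG subxx.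
Qed.

Lemma unique_maximal_cyclic gT (G : {group gT}) :
  (forall M N : {group gT}, maximal M G -> maximal N G -> M :=: N) -> cyclic G.
Proof.
move=> uniqM; have [->|ntG] := eqsVneq G 1; first exact: cyclic1.
have [G1 | [M maxM _]] := maximal_exists (sub1G G); first by rewrite -G1 eqxx in ntG.
have /andP[sMG nsGM] := maxgroupp maxM.
have [x Gx nMx] := subsetPn nsGM.
have sxG : <[x]> \subset G by rewrite cycle_subG.
have [<- | [N maxN sxN]] := maximal_exists sxG; first exact: cycle_cyclic.
by case/negP: nMx; rewrite (uniqM M N) // -cycle_subG.
Qed.

(** Two maximal subgroups of a Sylow [p]-subgroup, multiplied by the [p']-core, would give two
    maximal subgroups of [G] of index [p]. So each Sylow subgroup has at most one maximal subgroup
    and is cyclic. *)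
Lemma nil_distinct_index_cyclic gT (G : {group gT}) :
    nilpotent G ->
    (forall M N : {group gT}, maximal M G -> maximal N G ->
      #|G : M| = #|G : N| -> M :=: N) -> cyclic G.
Proof.
move=> nilG uniqM; apply: nil_Zgroup_cyclic => //.
apply/forall_inP=> P /SylowP[p p_pr sylP]; apply: unique_maximal_cyclic => M N maxM maxN.
have pP := pHall_pgroup sylP.
have defP : 'O_p(G) = P by apply/esym/(eq_Hall_pcore (nilpotent_pcore_Hall p nilG)).
have defG : P \x 'O_p^'(G) = G by rewrite -defP nilpotent_pcoreC.
have [_ mulG _ tiPQ] := dprodP defG.
have ext (X : {group gT}) : maximal X P ->
    [/\ maximal (X <*> 'O_p^'(G)) G, #|G : X <*> 'O_p^'(G)| = p & (X <*> 'O_p^'(G)) :&: P = X].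
  move=> maxX; have sXP := proper_sub (maxgroupp maxX).
  have cQX : 'O_p^'(G) \subset 'C(X) by case/dprodP: defG => _ _ cQ _;
    apply: subset_trans cQ (centS sXP).
  have defXQ : X <*> 'O_p^'(G) = X * 'O_p^'(G) by rewrite cent_joinEr.
  have sXQG : X <*> 'O_p^'(G) \subset G by rewrite join_subG pcore_sub (subset_trans sXP)
    ?(pHall_sub sylP).
  have iX : #|G : X <*> 'O_p^'(G)| = p.
    have cXQ : #|X <*> 'O_p^'(G)| = (#|X| * #|'O_p^'(G)|)%N.
      by rewrite /= defXQ TI_cardMg //; apply/trivgP; rewrite -tiPQ setSI.
    transitivity #|P : X|; last exact: p_maximal_index pP maxX.
    rewrite -(divgS sXP) -[LHS](divgS sXQG) /= cXQ.
    by rewrite -(dprod_card defG) divnMr.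
  split=> //; first by apply: p_index_maximal; rewrite ?iX.
  by rewrite defXQ -group_modl // setIC tiPQ mulg1.
have [maxM' iM dM] := ext M maxM; have [maxN' iN dN] := ext N maxN.
by rewrite -dM -dN /=; congr (_ :&: _); apply: uniqM; rewrite // iM iN.
Qed.

Lemma cent_Fitting_sol gT (G : {group gT}) :
  solvable G -> 'C_G('F(G)) \subset 'F(G).
Proof.
move=> solG; apply/idPn=> nCF; set C := 'C_G('F(G)) in nCF.
have nCG : G \subset 'N(C) by rewrite normsI ?normG // norms_cent // gFnorm.
have [N /mingroupP[/andP[nNF nNG] minN] sNC] :
    {N : {group gT} | [min N | ~~ (N \subset 'F(G)) && (G \subset 'N(N))] & N \subset C}.
  by apply: (@mingroup_exists _ (fun N => ~~ (N \subset 'F(G)) && (G \subset 'N(N)))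
    'C_G('F(G))%G); rewrite nCF.
have sNG : N \subset G := subset_trans sNC (subsetIl _ _).
have sN'F : N^`(1) \subset 'F(G).
  apply: contraT => nN'; have := minN N^`(1)%G; rewrite nN' der_sub.
  rewrite (char_norm_trans (der_char 1 N)) // => /(_ isT isT) eN'.
  have ntN : N :!=: 1 by apply: contraNneq nNF => ->; apply: sub1G.
  by have := sol_der1_proper solG sNG ntN; rewrite eN' properxx.
case/negP: nNF; apply: Fitting_max; first by rewrite /normal sNG.
apply: small_nil_class; apply: leq_trans (_ : 2 <= 5) => //.
rewrite nil_class2 subsetI der_sub /= centsC (subset_trans sNC) //.
by rewrite (subset_trans (subsetIr _ _)) // centS.
Qed.

Lemma nil_maximal_normal gT (G M : {group gT}) :
  nilpotent G -> maximal M G -> M <| G.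
Proof.
move=> nilG maxM; apply: contraT => /(maximal_norm maxM) defM.
by have := nilpotent_proper_norm nilG (maxgroupp maxM); rewrite defM properxx.
Qed.

Lemma quotient_Phi_nil gT (G : {group gT}) : nilpotent (G / 'Phi(G)) -> nilpotent G.
Proof.
move=> nilGP; apply: all_maximal_normal_nil => M maxM.
have nsPM : 'Phi(G) <| M.
  by apply: normalS (Phi_sub_max maxM) (proper_sub (maxgroupp maxM)) (Phi_normal G).
rewrite -[X in X <| _](quotientGK nsPM) -[X in _ <| X](quotientGK (Phi_normal G)) cosetpre_normal.
by apply: nil_maximal_normal; rewrite // quotient_maximal ?Phi_normal.
Qed.

(** The prime [r] matters later: ['O_r(G)] supplements [M], so the index of [M] is read off inside
    an [r]-group. In the Frattini quotient some [r]-core is not central, and a maximal subgroup that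
    misses its commutator with the whole group contains neither the [r]-core nor the derived
    subgroup. *)
Lemma nonnormal_maximal_pcore gT (G : {group gT}) :
    solvable G -> ~~ nilpotent G ->
  exists (M : {group gT}) (r : nat),
    [/\ maximal M G, ~~ (M <| G), prime r & ~~ ('O_r(G) \subset M)].
Proof.
move=> solG nnilG.
pose Gb := (G / 'Phi(G))%G.
have nFZ : ~~ ('F(Gb) \subset 'Z(Gb)).
  apply: contra nnilG => sFZ; apply: quotient_Phi_nil.
  have cGF : 'C_Gb('F(Gb)) = Gb.
    by apply/setIidPl; rewrite centsC (subset_trans sFZ) ?subsetIr.
  have := cent_Fitting_sol (quotient_sol 'Phi(G) solG); rewrite -/Gb cGF.
  move=> sGF; suff -> : G / 'Phi(G) = 'F(Gb) by apply: Fitting_nil.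
  by apply/eqP; rewrite eqEsubset sGF Fitting_sub.
have [r [r_pr nOZ]] : exists r, prime r /\ ~~ ('O_r(Gb) \subset 'Z(Gb)).
  move: nFZ; rewrite FittingEgen gen_subG => /bigcupsP nFZ.
  have [/existsP[r /andP[pi_r nOZ]] | ] :=
    boolP [exists r : 'I_(#|Gb|.+1), ((r : nat) \in \pi(Gb)) && ~~ ('O_r(Gb) \subset 'Z(Gb))].
    by exists r; split=> //; move: pi_r; rewrite mem_primes => /andP[].
  rewrite negb_exists => /forallP allr; case: nFZ => r pi_r.
  by have := allr r; rewrite pi_r negbK.
have nsOG : 'O_r(Gb) <| Gb := pcore_normal _ _.
have ntD : ~~ ([~: 'O_r(Gb), Gb] \subset 'Phi(Gb)).
  rewrite Phi_quotient_id subG1; apply: contra nOZ => /eqP/commG1P cOG.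
  by rewrite subsetI pcore_sub.
have [Xb maxXb nDXb] : exists2 Xb : {group coset_of 'Phi(G)}, maximal Xb Gb &
    ~~ ([~: 'O_r(Gb), Gb] \subset Xb).
  apply/exists_inP; apply: contraR ntD; rewrite negb_exists_in => /forall_inP allX.
  apply/bigcapsP=> Xb /predU1P[-> | maxXb]; last by have := allX Xb maxXb; rewrite negbK.
  by rewrite commg_subr; apply: subset_trans (pcore_sub _ _) (normG _).
have nOXb : ~~ ('O_r(Gb) \subset Xb).
  by apply: contra nDXb; apply: subset_trans; rewrite commg_subl normal_norm.
have nnXb : ~~ (Xb <| Gb).
  apply: contra nDXb => nsXb; apply: subset_trans (normal_maximal_der maxXb nsXb).
  by rewrite commSg ?pcore_sub.
pose X := (coset 'Phi(G) @*^-1 Xb)%G.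
have defG : coset 'Phi(G) @*^-1 Gb = G by rewrite quotientGK ?Phi_normal.
have maxX : maximal X G by rewrite -[X in maximal _ X]defG cosetpre_maximal.
exists X, r; split=> //; first by rewrite -[X in _ <| X]defG cosetpre_normal.
pose U := (coset 'Phi(G) @*^-1 'O_r(Gb))%G.
have nsUG : U <| G by rewrite -[X in _ <| X]defG cosetpre_normal.
have [P sylP] := Sylow_exists r U.
have sPU := pHall_sub sylP; have nPhiU : U \subset 'N('Phi(G)) := subsetIl _ _.
have nPhiP := subset_trans sPU nPhiU.
have quoP : P / 'Phi(G) = 'O_r(Gb).
  have := quotient_pHall nPhiP sylP; rewrite cosetpreK => /pHall_id; apply.
  exact: pcore_pgroup.
have defU : U :=: 'Phi(G) * P by rewrite -quotientK // quoP.
have nsPG : P <| G.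
  have frat := Frattini_arg nsUG sylP.
  rewrite /normal (subset_trans sPU) ?(normal_sub nsUG) //=.
  suff defN : <<'N_G(P)>> = G by apply/setIidPl; rewrite -[RHS]defN genGid.
  apply: Phi_nongen; apply/eqP; rewrite eqEsubset join_subG Phi_sub subsetIl /=.
  rewrite -{1}frat defU -mulgA mul_subG ?joing_subl // (subset_trans _ (joing_subr _ _)) //.
  by rewrite mul_subG // subsetI normG (subset_trans sPU) ?normal_sub.
apply: contra nOXb => sOX; rewrite -quoP -(cosetpreK Xb) quotientS //.
by apply: subset_trans sOX; apply: pcore_max nsPG; apply: pHall_pgroup sylP.
Qed.
End MaximalSubgroups.

(** * The covering number *)

Section Covers.
Local Open Scope group_scope.
Implicit Types (gT : finGroupType) (p r : nat).

Definition multimax gT (G M : {group gT}) : bool :=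
  maximal M G && (~~ (M <| G) ||
    [exists M' : {group gT},
      [&& maximal M' G, M' <| G, M' != M & #|G : M'| == #|G : M|]]).

Lemma card_bigcup_le (I T : finType) (A : {set I}) (F : I -> {set T}) n :
  (forall i, i \in A -> #|F i| <= n) -> #|\bigcup_(i in A) F i| <= #|A| * n.
Proof.
move=> leF; rewrite -sum_nat_const.
apply: (@leq_trans (\sum_(i in A) #|F i|)); last exact: leq_sum.
elim/big_rec2: _ => [|i m X _ leXm]; first by rewrite cards0.
by apply: leq_trans (leq_card_setU _ _) _; rewrite leq_add2l.
Qed.

Lemma proper_cover_maximal gT (G : {group gT}) (C : {set {group gT}}) :
    proper_cover G C ->
  exists D : {set {group gT}},
    [/\ #|D| <= #|C|, {in D, forall M : {group gT}, maximal M G}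
      & \bigcup_(M in D) (M : {set gT}) = G].
Proof.
case/andP=> /forall_inP properC /eqP covC.
(* The default [H] is never taken on [C], since a proper subgroup lies in a maximal one. *)
pose f (H : {group gT}) := odflt H [pick M : {group gT} | maximal M G && (H \subset M)].
have fP H : H \in C -> maximal (f H) G && (H \subset f H).
  move=> CH; rewrite /f; case: pickP => [M //| noM].
  have [defH | [M maxM sHM]] := maximal_exists (proper_sub (properC H CH)).
    by have := properC H CH; rewrite defH properxx.
  by have := noM M; rewrite maxM sHM.
exists (f @: C); split; first exact: leq_imset_card.
  by move=> _ /imsetP[H /fP/andP[maxM _] ->].
apply/eqP; rewrite eqEsubset; apply/andP; split.
  by apply/bigcupsP=> _ /imsetP[H /fP/andP[/maxgroupp/proper_sub sMG _] ->].
rewrite -covC; apply/bigcupsP=> H CH; have /andP[_ sHf] := fP H CH.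
by apply: subset_trans sHf _; apply: (bigcup_sup (f H)); rewrite ?imset_f.
Qed.

(* Take [N] minimal among the normal subgroups whose overgroups in the cover fail to
   cover [G], and a chief factor [N / L]. The members that contain [L] but not [N]
   meet each uncovered coset of [N] in at most a coset of [L]. *)
Lemma multimax_cover_bound gT (G : {group gT}) (C : {set {group gT}}) q :
    solvable G -> (forall M, multimax G M -> q <= #|G : M|) -> proper_cover G C ->
  q < #|C|.
Proof.
move=> solG leq_max /proper_cover_maximal[D [leDC maxD covD]].
apply: leq_trans leDC.
pose W (N : {set gT}) := \bigcup_(M in D | N \subset M) (M : {set gT}).
have sMG M : M \in D -> M \subset G by move/maxD/maxgroupp/proper_sub.
have sWG N : W N \subset G by apply/bigcupsP=> M /andP[/sMG].
have [N minN _] : {N : {group gT} | [min N | (N <| G) && ~~ (G \subset W N)] & N \subset G}.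
  apply: mingroup_exists; rewrite normal_refl /= /W big_pred0 => [|M].
    by apply/subsetPn; exists 1; rewrite ?inE.
  by apply: contraTF isT => /andP[/maxD/maxgroupp/andP[_ /negP]].
have [/andP[nsNG nWN] min_N] := mingroupP minN.
have [g Gg nWg] := subsetPn nWN.
have W1 : W 1%G = G.
  by rewrite -covD; apply: eq_bigl => M; rewrite sub1G andbT.
have ntN : N :!=: 1 by apply: contraNneq nWN => ->; rewrite W1.
have [L maxL _] : {L : {group gT} | maxnormal L N G & 1%G \subset L}.
  by apply: maxgroup_exists; rewrite proper1G ntN norms1.
have [/andP[ltLN nLG] max_L] := maxgroupP maxL.
have [sLN nsNL] := andP ltLN; have [sNG nNG] := andP nsNG.
have nsLG : L <| G by rewrite /normal (subset_trans sLN).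
have WL : G \subset W L.
  apply: contraT => nWL; have := min_N L; rewrite nsLG nWL => /(_ isT sLN) eLN.
  by rewrite eLN properxx in ltLN.
have sN'L : N^`(1) \subset L.
  have minNL : minnormal (N / L) (G / L).
    by apply: chief_factor_minnormal; rewrite /chief_factor maxL.
  have [_ _ abNL] := minnormal_solvable minNL (quotientS _ sNG) (quotient_sol _ solG).
  have nLN := subset_trans sNG nLG.
  apply: der1_min => //.
  by have /is_abelemP[p _ /abelem_abelian] := abNL.
pose V := [set M in D | (L \subset M) && ~~ (N \subset M)].
pose U := [set M in D | N \subset M].
have VP M : M \in V -> [/\ maximal M G, N :&: M = L & #|G : M| = #|N : L|].
  rewrite inE => /and3P[/maxD maxM sLM nNM].
  have sMG' := proper_sub (maxgroupp maxM).
  have defG : N * M = G by apply: maximal_mulg; rewrite // (subset_trans sMG').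
  have defL : N :&: M = L.
    apply: (max_L (N :&: M)%G); last by rewrite subsetI sLN.
    rewrite /proper subsetIl subsetI subxx nNM /= -defG mul_subG //.
      by rewrite sub_der1_norm ?subsetIl // subsetI (subset_trans sN'L) // (subset_trans sN'L).
    by rewrite normsI ?normG // (subset_trans sMG').
  by split=> //; rewrite (index_mulg_setI defG) -defL.
have leV : #|N : L| <= #|V|.
  rewrite -(leq_pmul2l (cardG_gt0 L)) Lagrange // mulnC.
  have -> : #|N| = #|\bigcup_(M in V) ((M : {set gT}) :&: g *: N)|.
    rewrite -(card_lcoset N g); apply: eq_card => x;
      apply/idP/bigcupP => [gNx | [M _ /setIP[]//]].
    have Gx : x \in G.
      by case/lcosetP: gNx => y Ny ->; rewrite groupM // (subsetP sNG).
    have /bigcupP[M /andP[DM sLM] Mx] := subsetP WL x Gx.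
    exists M; last by rewrite inE Mx.
    rewrite inE DM sLM; apply: contra nWg => sNM; apply/bigcupP; exists M; first by rewrite DM.
    case/lcosetP: gNx Mx => y Ny ->; rewrite groupMr //; exact: (subsetP sNM).
  apply: card_bigcup_le => M /VP[_ defL _].
  have [-> | [x /setIP[Mx gNx]]] := set_0Vmem ((M : {set gT}) :&: g *: N).
    by rewrite cards0.
  rewrite -defL -(card_lcoset (N :&: M) x) subset_leq_card //.
  apply/subsetP=> y /setIP[My gNy]; rewrite mem_lcoset inE; apply/andP; split.
    rewrite !mem_lcoset in gNx gNy.
    by have := groupM (groupVr gNx) gNy; rewrite invMg invgK mulgA mulgK.
  by rewrite groupM ?groupV.
have gt1 : 1 < #|V|.
  by apply: leq_trans leV; rewrite indexg_gt1.
have leqV : q <= #|V|.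
  apply: leq_trans leV.
  have [M VM] : exists M, M \in V by apply/set0Pn; rewrite -card_gt0 ltnW.
  (* A non-normal member is [multimax] by itself. If all members are normal, there are two of them
     with the same index [#|N : L|], and they are partners. *)
  have [/exists_inP[M1 VM1 nnM1] | ] := boolP [exists M1 in V, ~~ (M1 <| G)].
    have [maxM1 _ <-] := VP M1 VM1.
    by apply: leq_max; rewrite /multimax maxM1 nnM1.
  rewrite negb_exists_in => /forall_inP allN.
  have [maxM _ iM] := VP M VM; rewrite -iM; apply: leq_max.
  rewrite /multimax maxM; apply/orP; right.
  have [M' VM' neM'] : exists2 M', M' \in V & M' != M.
    apply/exists_inP; apply: contraLR gt1; rewrite negb_exists_in -leqNgt -(cards1 M).
    move/forall_inP=> allM; apply: subset_leq_card; apply/subsetP=> X /allM.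
    by rewrite negbK inE.
  have [maxM' _ iM'] := VP M' VM'.
  apply/existsP; exists M'; rewrite maxM' neM' iM iM' eqxx andbT /=.
  by have := allN M' VM'; rewrite negbK => ->.
(* Without a member above [N], all members above [L] would meet [N] in [L] and [N] would not be
   covered. This additional member makes the inequality strict. *)
have U0 : 0 < #|U|.
  rewrite card_gt0; apply: contra nsNL => /eqP U0.
  apply/subsetP=> x Nx; have /bigcupP[M /andP[DM sLM] Mx] := subsetP WL x (subsetP sNG x Nx).
  have VM : M \in V.
    rewrite inE DM sLM; apply/negP=> sNM.
    have : M \in U by rewrite inE DM.
    by rewrite U0 inE.
  by have [_ <- _] := VP M VM; rewrite inE Nx.
have disUV : V :&: U = set0.
  by apply/setP=> M; rewrite !inE; case: (N \subset M); rewrite /= !(andbF, andbT).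
have : #|V :|: U| <= #|D|.
  by apply: subset_leq_card; apply/subsetP=> M; rewrite !inE => /orP[]/andP[].
rewrite cardsU disUV cards0 subn0; apply: leq_trans.
by rewrite -addn1 leq_add.
Qed.
End Covers.

(** * Covers with one member more than the least index *)

Section UpperBound.
Local Open Scope group_scope.
Implicit Types (gT : finGroupType) (p r : nat).

Lemma normal_expg_index gT (G M : {group gT}) x :
  M <| G -> x \in G -> x ^+ #|G : M| \in M.
Proof.
move=> /andP[_ nMG] Gx; have nMx := subsetP nMG x Gx.
apply: coset_idr; first exact: groupX.
by rewrite morphX // -card_quotient // expg_cardG ?mem_quotient.
Qed.

Lemma normal_maximal_mulg gT (G M M' : {group gT}) :
  maximal M G -> M <| G -> maximal M' G -> M' != M -> M * M' = G.
Proof.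
move=> maxM /andP[sMG nMG] maxM' neMM'; have sM'G := proper_sub (maxgroupp maxM').
apply: maximal_mulg => //; first exact: subset_trans sM'G nMG.
apply: contra neMM' => sMM'; apply/eqP/val_inj/esym => /=.
have [_ max_M] := maxgroupP maxM.
by apply/esym/(max_M M') => //; apply: maxgroupp maxM'.
Qed.

(** Modulo [M :&: M'] the group is elementary abelian of rank two, and its lines, one more than the
    prime, cover it. That all members contain [M :&: M'] is recorded for the later computation of
    Frattini subgroups. *)
Lemma normal_pair_cover gT (G M M' : {group gT}) :
    maximal M G -> M <| G -> maximal M' G -> M' <| G -> M' != M ->
    #|G : M'| = #|G : M| ->
  exists C : {set {group gT}}, [/\ #|C| = #|G : M|.+1,
    {in C, forall X : {group gT}, [/\ maximal X G, X <| G, #|G : X| = #|G : M| & M :&: M'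
      \subset X]}
    & \bigcup_(X in C) (X : {set gT}) = G].
Proof.
move=> maxM nsMG maxM' nsM'G neMM' iM'.
have p_pr := normal_maximal_prime maxM nsMG; set p := #|G : M| in p_pr iM' *.
have [sMG sM'G] := (normal_sub nsMG, normal_sub nsM'G).
pose N := (M :&: M')%G; have nsNG : N <| G by apply: normalI.
have sG'N : G^`(1) \subset N by rewrite subsetI !normal_maximal_der.
have defG : M * M' = G by apply: normal_maximal_mulg.
have oGN : #|G / N| = (p ^ 2)%N.
  rewrite card_quotient ?normal_norm // -(Lagrange_index sMG (subsetIl M M')).
  by rewrite -(index_mulg_setI defG) iM' -/p mulnn.
have abGN : p.-abelem (G / N).
  apply/abelemP => //; split; first exact: sub_der1_abelian.
  move=> _ /morphimP[x nNx Gx ->]; rewrite -morphX //=; apply: coset_id.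
  by rewrite inE -{2}iM' !normal_expg_index.
pose E := 'E_p^1(G / N).
have cardE : #|E| = p.+1.
  by apply: (@card_p1Elem_p2Elem _ _ (G / N) (G / N)%G); apply/pnElemP; rewrite oGN pfactorK.
exists [set (coset N @*^-1 (X : {group coset_of N}))%G | X in E]; split.
- rewrite card_imset // => X Y /(congr1 val) /= eqXY; apply: val_inj => /=.
  by rewrite -(cosetpreK X) eqXY cosetpreK.
- move=> _ /imsetP[X /pnElemPcard[sXG _ oX] ->].
  have defGN : coset N @*^-1 (G / N) = G by rewrite quotientGK.
  have sYG : coset N @*^-1 X \subset G by rewrite sub_cosetpre_quo.
  have iY : #|G : coset N @*^-1 X| = p.
    transitivity #|G / N : X|; first by rewrite -index_cosetpre /= defGN.
    by rewrite -divgS // oGN oX -expnB ?prime_gt0.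
  split=> //; first by apply: p_index_maximal; rewrite ?iY.
    exact: sub_der1_normal (subset_trans sG'N (sub_cosetpre X)) sYG.
  exact: sub_cosetpre.
apply/eqP; rewrite eqEsubset; apply/andP; split.
  apply/bigcupsP=> _ /imsetP[X /pnElemPcard[sXG _ _] ->] /=.
  by rewrite sub_cosetpre_quo.
have covE y : y \in G / N -> exists2 X : {group coset_of N}, X \in E & y \in X.
  move=> Gy; have [-> | nty] := eqVneq y 1.
    have [X EX] : exists X, X \in E by apply/set0Pn; rewrite -card_gt0 cardE.
    by exists X.
  exists <[y]>%G; last exact: cycle_id.
  apply/pnElemP; rewrite cycle_subG Gy -orderE (abelem_order_p abGN Gy nty).
  by rewrite (pfactorK 1) //; split=> //; apply: abelemS abGN; rewrite cycle_subG.
apply/subsetP=> x Gx; have [X EX Xx] := covE _ (mem_quotient N Gx).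
apply/bigcupP; exists (coset N @*^-1 X)%G; first exact: imset_f.
by apply/morphpreP; split; first exact: (subsetP (normal_norm nsNG)).
Qed.

Lemma minnormal_compl gT (G V M : {group gT}) :
    minnormal V G -> abelian V -> V \subset G -> maximal M G -> ~~ (V \subset M) ->
  V ><| M = G.
Proof.
move=> minV cVV sVG maxM nVM; have sMG := proper_sub (maxgroupp maxM).
have /andP[ntV nVG] := mingroupp minV; have [_ min_V] := mingroupP minV.
have nVM' := subset_trans sMG nVG.
have defG : V * M = G by apply: maximal_mulg.
rewrite sdprodE //; apply: contraNeq nVM => ntI.
suff <- : V :&: M = V by apply: subsetIr.
apply: (min_V (V :&: M)%G); last exact: subsetIl.
rewrite ntI -defG mul_subG //; first by rewrite sub_abelian_norm ?subsetIl.
by rewrite normsI ?normG.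
Qed.

Lemma primitive_sol gT (G M : {group gT}) :
    solvable G -> maximal M G -> gcore M G = 1 ->
  exists V : {group gT}, exists2 p, prime p & [/\ p.-abelem V, minnormal V G,
    V ><| M = G, 'C_M(V) = 1 & #|V| = #|G : M|].
Proof.
move=> solG maxM coreM; have /andP[sMG nsGM] := maxgroupp maxM.
have ntG : G :!=: 1 by apply: contraNneq nsGM => ->; apply: sub1G.
have [V minV sVG] := minnormal_exists ntG (normG G).
have [nVG ntV /is_abelemP[p p_pr abV]] := minnormal_solvable minV sVG solG.
have nVM : ~~ (V \subset M).
  by apply: contra ntV => sVM; rewrite -subG1 -coreM gcore_max.
have cVV := abelem_abelian abV.
have defG := minnormal_compl minV cVV sVG maxM nVM.
exists V, p => //; split=> //.
  apply/trivgP; rewrite -coreM gcore_max ?subsetIl //.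
  have [_ <- nVM' _] := sdprodP defG; rewrite mul_subG //.
    apply: (subset_trans _ (cent_sub _)); rewrite centsC; exact: subsetIr.
  by rewrite normsI ?normG // norms_cent.
by rewrite -(divgS sMG) -(sdprod_card defG) mulnK.
Qed.

Section Complement.
Variables (gT : finGroupType) (G V M : {group gT}).
Hypothesis defG : V ><| M = G.

Lemma sdprod_mulY (X : {group gT}) : X \subset M -> V <*> X = V * X.
Proof.
by move=> sXM; have [_ _ nVM _] := sdprodP defG; rewrite norm_joinEr ?(subset_trans sXM).
Qed.

Lemma sdprod_index (X : {group gT}) : X \subset M -> #|G : V <*> X| = #|M : X|.
Proof.
move=> sXM; have [_ mulG nVM tiVM] := sdprodP defG.
have sYG : V <*> X \subset G by rewrite -mulG sdprod_mulY // mulgS.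
have oY : #|V <*> X| = (#|V| * #|X|)%N.
  by rewrite /= sdprod_mulY // TI_cardMg //; apply/trivgP; rewrite -tiVM setIS.
rewrite -[LHS](divgS sYG) /= oY -(divgS sXM) -(sdprod_card defG).
by rewrite divnMl.
Qed.

Lemma sdprodY_setI (X : {group gT}) : X \subset M -> (V <*> X) :&: M = X.
Proof.
move=> sXM; have [_ _ _ tiVM] := sdprodP defG.
by rewrite sdprod_mulY // setIC -group_modr // setIC tiVM mul1g.
Qed.

Lemma sdprod_setIY (Z : {group gT}) : V \subset Z -> Z \subset G -> V <*> (Z :&: M) = Z.
Proof.
move=> sVZ sZG; have [_ mulG _ _] := sdprodP defG.
by rewrite (@sdprod_mulY (Z :&: M)%G) ?subsetIr //= setIC group_modl // mulG (setIidPr sZG).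
Qed.

(** [X] to [V <*> X] and [Z] to [Z :&: M] are inverse bijections between the subgroups of [M] and
    those of [G] above [V]. *)
Lemma sdprod_maximal (X : {group gT}) : maximal X M -> maximal (V <*> X) G.
Proof.
move=> maxX; have [/andP[sXM nsMX] max_X] := maxgroupP maxX.
have [_ mulG nVM tiVM] := sdprodP defG.
have sYG : V <*> X \subset G by rewrite -mulG sdprod_mulY // mulgS.
apply/maxgroupP; split=> [|Z ltZ sYZ].
  rewrite properE sYG; apply: contra nsMX => sGY.
  suff : M \subset (V <*> X) :&: M by rewrite sdprodY_setI.
  by rewrite subsetI subxx (subset_trans _ sGY) // -mulG mulG_subr.
have [sZG nsGZ] := andP ltZ; have sVZ := subset_trans (joing_subl V X) sYZ.
rewrite -(sdprod_setIY sVZ sZG); congr (_ <*> _).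
apply: (max_X (Z :&: M)%G).
  rewrite properE subsetIr subsetI subxx andbT; apply: contra nsGZ => sMZ.
  by rewrite -mulG mul_subG.
by rewrite subsetI sXM (subset_trans _ sYZ) ?joing_subr.
Qed.

Lemma sdprod_maximalI (Z : {group gT}) :
  V \subset Z -> maximal Z G -> maximal (Z :&: M) M.
Proof.
move=> sVZ maxZ; have [/andP[sZG nsGZ] max_Z] := maxgroupP maxZ.
have [_ mulG nVM tiVM] := sdprodP defG.
apply/maxgroupP; split=> [|X ltX sZX].
  rewrite properE subsetIr subsetI subxx andbT; apply: contra nsGZ => sMZ.
  by rewrite -mulG mul_subG.
have [sXM nsMX] := andP ltX.
rewrite -(sdprodY_setI sXM); congr (_ :&: _); apply: (max_Z (V <*> X)%G).
  have sYG : V <*> X \subset G by rewrite -mulG sdprod_mulY // mulgS.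
  rewrite properE sYG /=.
  apply: contra nsMX => sGY.
  suff : M \subset (V <*> X) :&: M by rewrite sdprodY_setI.
  by rewrite subsetI subxx (subset_trans _ sGY) // -mulG mulG_subr.
by rewrite -(sdprod_setIY sVZ sZG) join_subG joing_subl (subset_trans sZX) ?joing_subr.
Qed.

Lemma sdprodY_normal (X : {group gT}) : X \subset M -> (V <*> X <| G) = (X <| M).
Proof.
move=> sXM; have [_ mulG nVM tiVM] := sdprodP defG.
have sMG : M \subset G by rewrite -mulG mulG_subr.
apply/idP/idP=> [/andP[_ nYG] | /andP[_ nXM]].
  by rewrite /normal sXM -(sdprodY_setI sXM) normsI ?normG // (subset_trans sMG).
have sYG : V <*> X \subset G by rewrite -mulG sdprod_mulY // mulgS.
rewrite /normal sYG -mulG mul_subG //=.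
  exact: subset_trans (joing_subl V X) (normG _).
by rewrite normsY.
Qed.

End Complement.

Lemma pgroup_fixpoint gT p (P V : {group gT}) :
  p.-group P -> p.-group V -> P \subset 'N(V) -> V :!=: 1 -> 'C_V(P) != 1.
Proof.
move=> pP pV nVP ntV.
have pVP : p.-group (V <*> P) by rewrite norm_joinEr // pgroupM pV.
have nsV : V <| V <*> P by rewrite /normal joing_subl join_subG normG.
have := meet_center_nil (pgroup_nil pVP) nsV ntV.
apply: contraNneq => CVP; rewrite -subG1 -CVP setIS //.
by rewrite (subset_trans (subsetIr _ _)) // centS ?joing_subr.
Qed.

(** An element of order [r] moves some vector, whose orbit consists of [r] vectors different from
    [1]. *)
Lemma faithful_prime_lt gT r (M V : {group gT}) :
    prime r -> r %| #|M| -> M \subset 'N(V) -> 'C_M(V) = 1 -> r < #|V|.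
Proof.
move=> r_pr rM nVM CMV; have [x Mx ox] := Cauchy r_pr rM.
have ntx : x != 1 by rewrite -order_gt1 ox prime_gt1.
have [v Vv ncv] : exists2 v, v \in V & v \notin 'C[x].
  apply/subsetPn; apply: contra ntx; rewrite sub_cent1 => cVx.
  by rewrite -in_set1 -[[set 1]]CMV inE Mx.
have ntv : v != 1 by apply: contraNneq ncv => ->; apply: group1.
have -> : r = #|v ^: <[x]>|.
  rewrite -index_cent1 -{1}ox orderE.
  suff -> : 'C_<[x]>[v] = 1 by rewrite indexg1.
  apply: prime_TIg; first by rewrite -orderE ox.
  by rewrite cycle_subG cent1C.
rewrite (cardsD1 1 V) group1 ltnS subset_leq_card //.
apply/subsetP=> _ /imsetP[y Xy ->]; rewrite !inE conjg_eq1 ntv memJ_norm //.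
by apply: subsetP Xy; rewrite cycle_subG (subsetP nVM).
Qed.

Lemma pcore_nonnormal_index gT p r (V M X : {group gT}) :
    p.-abelem V -> minnormal V M -> 'C_M(V) = 1 ->
    prime r -> maximal X M -> ~~ ('O_r(M) \subset X) ->
  #|M : X| < #|V|.
Proof.
move=> abV minV CMV r_pr maxX nRX; have /andP[ntV nVM] := mingroupp minV.
have [_ min_V] := mingroupP minV.
set R := 'O_r(M)%G; have rR : r.-group R := pcore_pgroup _ _.
have sRM : R \subset M := pcore_sub _ _; have nRM : M \subset 'N(R) := gFnorm _ _.
have sXM := proper_sub (maxgroupp maxX).
have nrp : r != p.
  apply: contraNneq nRX => eqrp.
  have pR : p.-group R by rewrite -eqrp.
  have CVR := pgroup_fixpoint pR (abelem_pgroup abV) (subset_trans sRM nVM) ntV.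
  have cVR : R \subset 'C(V).
    rewrite centsC; apply/setIidPl; apply: (min_V 'C_V(R)%G); last exact: subsetIl.
    by rewrite CVR normsI // norms_cent.
  rewrite -/R; have /trivgP-> : R \subset [1] by rewrite -CMV subsetI sRM.
  exact: sub1G.
have defM : R * X = M by apply: maximal_mulg; rewrite // (subset_trans sXM).
rewrite (index_mulg_setI defM).
have ltLR : R :&: X \proper R by rewrite properE subsetIl subsetI subxx.
(* [X] normalises [R :&: X], and so does some element of the nilpotent [R] outside [X]; as [X] is
   maximal, all of [M] does. The maximality of [X] also makes the quotient a chief factor. *)
have nLM : M \subset 'N(R :&: X).
  have sXN : X \subset 'N_M(R :&: X) by rewrite subsetI sXM normsI ?normG ?(subset_trans sXM).
  have [_ max_X] := maxgroupP maxX.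
  apply/setIidPl/eqP; rewrite eqEproper subsetIl /=; apply/negP=> ltN.
  have defN := max_X 'N_M(R :&: X)%G ltN sXN.
  have /proper_subn/negP := nilpotent_proper_norm (pgroup_nil rR) ltLR; apply.
  rewrite subsetI subsetIl /=; have : 'N_M(R :&: X) \subset X by rewrite defN.
  by apply: subset_trans; rewrite setSI.
apply: (@chief_pgroup_bound _ p r V M R (R :&: X)%G) => //.
- exact: subset_trans nVM.
- by apply/trivgP; rewrite -CMV setSI.
- by rewrite /normal sRM.
move=> Y sLY sYR nYM; have [sYX | nYX] := boolP (Y \subset X).
  by left; apply/eqP; rewrite eqEsubset sLY subsetI sYR sYX.
right; have sYM := subset_trans sYR sRM.
have defM' : Y * X = M by apply: maximal_mulg; rewrite // (subset_trans sXM).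
apply/eqP; rewrite eqEsubset sYR -{1}(setIidPr sRM) -defM' -group_modl //.
by rewrite mul_subG // setIC.
Qed.

Lemma faithful_noncyclic_multimax gT p (V M : {group gT}) :
    p.-abelem V -> minnormal V M -> solvable M -> 'C_M(V) = 1 -> ~~ cyclic M ->
  exists2 X : {group gT}, multimax M X & #|M : X| < #|V|.
Proof.
move=> abV minV solM CMV ncM; have /andP[ntV nVM] := mingroupp minV.
have [/existsP[X /andP[mX nsX]] | ] := boolP [exists X, multimax M X && (X <| M)].
  exists X => //; have /andP[maxX _] := mX.
  apply: (faithful_prime_lt (normal_maximal_prime maxX nsX) _ nVM CMV).
  exact: dvdn_indexg.
rewrite negb_exists => /forallP no_pair.
(* In a non-cyclic nilpotent group two maximal subgroups share an index and both are normal; that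
   case is already settled. *)
have nnilM : ~~ nilpotent M.
  apply: contra ncM => nilM; apply: nil_distinct_index_cyclic => // X Y maxX maxY iXY.
  have := no_pair Y; rewrite (nil_maximal_normal nilM maxY) andbT /multimax maxY negb_or.
  case/andP=> _ /existsPn/(_ X); rewrite maxX (nil_maximal_normal nilM maxX) iXY eqxx andbT /=.
  by rewrite negbK => /eqP->.
have [X [r [maxX nnX r_pr nRX]]] := nonnormal_maximal_pcore solM nnilM.
exists X; first by rewrite /multimax maxX nnX.
exact: (pcore_nonnormal_index abV minV CMV r_pr maxX nRX).
Qed.

Lemma cosetpre_multimax gT (G K : {group gT}) (X : {group coset_of K}) :
  K <| G -> multimax (G / K)%G X -> multimax G (coset K @*^-1 X)%G.
Proof.
move=> nsKG; have defG : coset K @*^-1 (G / K) = G by rewrite quotientGK.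
have maxE (Y : {group coset_of K}) : maximal (coset K @*^-1 Y)%G G = maximal Y (G / K).
  by rewrite -[RHS]cosetpre_maximal /= defG.
have nsE (Y : {group coset_of K}) : (coset K @*^-1 Y <| G) = (Y <| G / K).
  by rewrite -[RHS]cosetpre_normal /= defG.
have iE (Y : {group coset_of K}) : #|G : coset K @*^-1 Y| = #|G / K : Y|.
  by rewrite -[RHS]index_cosetpre /= defG.
case/andP=> maxX mX; rewrite /multimax maxE maxX nsE /=.
case/orP: mX => [-> // | /existsP[Y /and4P[maxY nsY neYX /eqP iY]]].
apply/orP; right; apply/existsP; exists (coset K @*^-1 Y)%G.
rewrite maxE maxY nsE nsY !iE iY eqxx andbT /=; apply: contra neYX => /eqP/(congr1 val) /= eqYX.
by apply/eqP/val_inj; rewrite /= -(cosetpreK Y) eqYX cosetpreK.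
Qed.

Lemma sdprod_multimax gT (G V M X : {group gT}) :
  V ><| M = G -> multimax M X -> multimax G (V <*> X)%G.
Proof.
move=> defG /andP[maxX mX]; have sXM := proper_sub (maxgroupp maxX).
rewrite /multimax (sdprod_maximal defG maxX) (sdprodY_normal defG sXM) /=.
case/orP: mX => [-> // | /existsP[Y /and4P[maxY nsY neYX /eqP iY]]].
have sYM := proper_sub (maxgroupp maxY).
apply/orP; right; apply/existsP; exists (V <*> Y)%G.
rewrite (sdprod_maximal defG maxY) (sdprodY_normal defG sYM) nsY /=.
rewrite !(sdprod_index defG) // iY eqxx andbT; apply: contra neYX => /eqP/(congr1 val) /= eqYX.
by apply/eqP/val_inj; rewrite /= -(sdprodY_setI defG sYM) eqYX (sdprodY_setI defG).
Qed.

Lemma quotient_proper_cover gT (G K : {group gT}) (C : {set {group coset_of K}}) :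
    K <| G -> proper_cover (G / K) C ->
  exists2 D : {set {group gT}}, proper_cover G D & #|D| <= #|C|.
Proof.
move=> nsKG /andP[/forall_inP properC /eqP covC].
have defG : coset K @*^-1 (G / K) = G by rewrite quotientGK.
exists [set (coset K @*^-1 (X : {group coset_of K}))%G | X in C]; last exact: leq_imset_card.
apply/andP; split.
  apply/forall_inP=> _ /imsetP[X /properC ltX ->].
  have : coset K @*^-1 X \proper coset K @*^-1 (G / K) by rewrite cosetpre_proper.
  by rewrite defG.
rewrite eqEsubset; apply/andP; split.
  apply/bigcupsP=> _ /imsetP[X /properC/proper_sub sX ->].
  by rewrite sub_cosetpre_quo.
apply/subsetP=> x Gx; have := mem_quotient K Gx; rewrite -covC => /bigcupP[X CX Xx].
apply/bigcupP; exists (coset K @*^-1 X)%G; first exact: imset_f.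
by apply/morphpreP; split=> //; apply: (subsetP (normal_norm nsKG)).
Qed.

(** ['C_V[h]] is normal for [h] in the abelian [M], so nontrivial elements of [M] act without fixed
    points and the coset [V :* h] is the [V]-class of [h]. The cover is the Frobenius partition into
    [V] and the conjugates of [M]. *)
Lemma cyclic_complement_cover gT p (G V M : {group gT}) :
    p.-abelem V -> minnormal V G -> V ><| M = G -> 'C_M(V) = 1 -> cyclic M -> M :!=: 1 ->
  exists2 C : {set {group gT}}, proper_cover G C & #|C| <= #|V|.+1.
Proof.
move=> abV minV defG CMV cycM ntM; have /andP[ntV nVG] := mingroupp minV.
have [_ min_V] := mingroupP minV; have [_ mulG nVM tiVM] := sdprodP defG.
have cVV := abelem_abelian abV.
have sVG : V \subset G by rewrite -mulG mulG_subl.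
have sMG : M \subset G by rewrite -mulG mulG_subr.
exists (V |: [set (M :^ v)%G | v in V]); last first.
  rewrite cardsU1 -add1n leq_add ?leq_imset_card //; by case: (_ \notin _).
have ltMG : M \proper G.
  rewrite properEcard sMG -(sdprod_card defG) -{1}(mul1n #|M|) ltn_pmul2r //.
  by rewrite cardG_gt1.
have ltVG : V \proper G.
  rewrite properEcard sVG -(sdprod_card defG) -{1}(muln1 #|V|) ltn_pmul2l //.
  by rewrite cardG_gt1.
have JG v : v \in V -> G :^ v = G by move=> Vv; rewrite conjGid // (subsetP sVG).
apply/andP; split.
  apply/forall_inP=> X /setU1P[-> // | /imsetP[v Vv ->]].
  by rewrite /= -(JG v Vv) properJ.
rewrite eqEsubset; apply/andP; split.
  apply/bigcupsP=> X /setU1P[-> // | /imsetP[v Vv ->]].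
  by rewrite /= -(JG v Vv) conjSg.
rewrite -mulG; apply/subsetP=> _ /mulsgP[v h Vv Mh ->].
have [-> | nth] := eqVneq h 1.
  by apply/bigcupP; exists V; rewrite ?setU11 ?mulg1.
have CVh : 'C_V[h] = 1.
  apply: contraNeq nth => ntC.
  have nC : G \subset 'N('C_V[h]).
    rewrite -mulG mul_subG //.
      by rewrite sub_abelian_norm ?subsetIl.
    apply: normsI => //; apply: subset_trans (normG _).
    by rewrite sub_cent1 (subsetP (cyclic_abelian cycM)).
  have := min_V 'C_V[h]%G; rewrite ntC nC subsetIl => /(_ isT isT) /setIidPl.
  by rewrite sub_cent1 => cVh; rewrite -in_set1 -[[set 1]]CMV inE Mh.
have defVh : h ^: V = V :* h.
  apply/eqP; rewrite eqEcard card_rcoset -index_cent1 CVh indexg1 leqnn andbT.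
  apply/subsetP=> _ /imsetP[w Vw ->]; rewrite mem_rcoset.
  have -> : h ^ w * h^-1 = w^-1 * w ^ h^-1 by rewrite !conjgE invgK !mulgA.
  by rewrite groupM ?groupV // memJ_norm // groupV (subsetP nVM).
have : v * h \in h ^: V by rewrite defVh mem_rcoset mulgK.
case/imsetP=> w Vw ->; apply/bigcupP; exists (M :^ w)%G.
  by rewrite inE imset_f ?orbT.
by rewrite /= memJ_conjg.
Qed.

Lemma multimax_min_cover gT (G M : {group gT}) :
    solvable G -> multimax G M -> (forall X, multimax G X -> #|G : M| <= #|G : X|) ->
  exists2 C : {set {group gT}}, proper_cover G C & #|C| <= #|G : M|.+1.
Proof.
move=> solG mM minM; have /andP[maxM _] := mM.
have [nsMG | nnM] := boolP (M <| G).
  case/andP: mM; rewrite nsMG => _ /existsP[M' /and4P[maxM' nsM' neM' /eqP iM']].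
  have [C [cardC maxC covC]] := normal_pair_cover maxM nsMG maxM' nsM' neM' iM'.
  exists C; last by rewrite cardC.
  rewrite /proper_cover covC eqxx andbT.
  by apply/forall_inP=> X /maxC[/maxgroupp].
pose K := gcore M G; have sMG := proper_sub (maxgroupp maxM).
have nsKG : K <| G by apply: gcore_normal.
have sKM : K \subset M := gcore_sub M G.
have nsKM : K <| M := normalS sKM sMG nsKG.
have maxMb : maximal (M / K) (G / K) by rewrite quotient_maximal.
have coreMb : gcore (M / K) (G / K) = 1.
  pose D := gcore_group (M / K)%G (G / K)%G.
  have nsD : D <| G / K by apply: gcore_normal; apply: quotientS.
  have sDM : D \subset M / K := gcore_sub _ _.
  have nsDG : coset K @*^-1 D <| G.
    by move: nsD; rewrite -cosetpre_normal /= quotientGK.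
  suff : D :=: 1 by [].
  apply/trivgP; rewrite -(cosetpreK D) -(trivg_quotient K) quotientS //.
  by rewrite gcore_max ?normal_norm // sub_cosetpre_quo.
have solGb := quotient_sol K solG.
have [V [p p_pr [abV minV defG CMV oV]]] := primitive_sol solGb maxMb coreMb.
have iM : #|G / K : M / K| = #|G : M|.
  by rewrite index_quotient_eq // ?(subset_trans _ sKM) ?normal_norm //; apply: subsetIr.
rewrite -iM -oV; have [cycM | ncM] := boolP (cyclic (M / K)).
  have [| C covC leC] := cyclic_complement_cover abV minV defG CMV cycM.
    apply: contra nnM; rewrite -subG1 quotient_sub1 ?normal_norm // => sMK.
    suff -> : M :=: K by [].
    by apply/eqP; rewrite eqEsubset sMK.
  have [D covD leD] := quotient_proper_cover nsKG covC.
  by exists D => //; apply: leq_trans leD _.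
have minVM : minnormal V (M / K).
  have [/andP[ntV nVG] min_V] := mingroupP minV; have [_ mulG nVM _] := sdprodP defG.
  apply/mingroupP; split=> [|X /andP[ntX nXM] sXV]; first by rewrite ntV.
  apply: min_V => //; rewrite ntX -mulG mul_subG //.
  exact: sub_abelian_norm (abelem_abelian abV) sXV.
have solMb := solvableS (quotientS K sMG) solGb.
have [X mX ltX] := faithful_noncyclic_multimax abV minVM solMb CMV ncM.
have := minM _ (cosetpre_multimax nsKG (sdprod_multimax defG mX)).
have -> : #|G : coset K @*^-1 (V <*> X)| = #|G / K : V <*> X|.
  by rewrite -[RHS]index_cosetpre /= quotientGK.
have sXM : X \subset M / K by case/andP: mX => /maxgroupp/proper_sub.
by rewrite (sdprod_index defG sXM) leqNgt -iM -oV ltX.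
Qed.

End UpperBound.

(** * Counting the non-normal maximal subgroups *)

Section ConjugacyClasses.
Local Open Scope group_scope.
Implicit Types (gT : finGroupType) (p r : nat).

Lemma covering_number_multimax gT (G M : {group gT}) :
    solvable G -> ~~ cyclic G -> multimax G M ->
    (forall X, multimax G X -> #|G : M| <= #|G : X|) ->
  covering_number G = #|G : M|.+1.
Proof.
move=> solG ncG mM minM; have [_ [C covC oC] minC] := covering_numberP ncG.
apply/eqP; rewrite eqn_leq -{2}oC (multimax_cover_bound solG minM covC) andbT.
have [D covD leD] := multimax_min_cover solG mM minM.
exact: leq_trans (minC D covD) leD.
Qed.

Definition conj_class gT (G M : {group gT}) := orbit 'JG%act G M.

Definition nonnormal_maximals gT (G : {group gT}) :=
  [set M : {group gT} | maximal M G && ~~ (M <| G)].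

Definition normal_maximals gT (G : {group gT}) :=
  [set M : {group gT} | maximal M G && (M <| G)].

Lemma num_maximal_split gT (G : {group gT}) :
  num_maximal G = (#|nonnormal_maximals G| + #|normal_maximals G|)%N.
Proof.
rewrite /num_maximal -(cardsID (normal_maximals G)) addnC; congr (_ + _)%N.
  by apply: eq_card => M; rewrite !inE; case: (maximal M G); case: (M <| G).
by apply: eq_card => M; rewrite !inE; case: (maximal M G); case: (M <| G).
Qed.

Lemma conj_classP gT (G M X : {group gT}) :
  reflect (exists2 x, x \in G & X = (M :^ x)%G) (X \in conj_class G M).
Proof. exact: imsetP. Qed.

Lemma conj_class_nonnormal gT (G M X : {group gT}) :
    M \in nonnormal_maximals G -> X \in conj_class G M ->
  X \in nonnormal_maximals G.
Proof.
rewrite !inE => /andP[maxM nnM] /conj_classP[x Gx ->] /=.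
have defG : G :^ x = G := conjGid Gx.
by rewrite -{1}defG maximalJ maxM /= -{1}defG normalJ.
Qed.

Lemma card_conj_class gT (G M : {group gT}) :
  M \in nonnormal_maximals G -> #|conj_class G M| = #|G : M|.
Proof.
rewrite inE => /andP[maxM nnM].
by rewrite card_orbit astab1JG maximal_norm.
Qed.

Lemma conj_class_disjoint gT (G M N : {group gT}) :
  N \notin conj_class G M -> conj_class G M :&: conj_class G N = set0.
Proof.
move=> nN; apply/setP=> X; rewrite inE [RHS]inE; apply: contraNF nN => /andP[XM XN].
case/conj_classP: XM => x Gx defX; case/conj_classP: XN => y Gy defX'.
apply/conj_classP; exists (x * y^-1); first by rewrite groupM ?groupV.
by apply: val_inj; rewrite /= conjsgM; move/(congr1 val): defX => /= <-; rewrite defX' /= conjsgK.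
Qed.

Lemma nonnormal_index_gt2 gT (G M : {group gT}) :
  M \in nonnormal_maximals G -> 2 < #|G : M|.
Proof.
rewrite inE => /andP[maxM]; have /andP[sMG nsGM] := maxgroupp maxM.
rewrite ltnNge; apply: contra => le2; apply: index2_normal => //.
by apply/eqP; rewrite eqn_leq le2 indexg_gt1.
Qed.

Lemma sol_normal_maximal gT (G : {group gT}) :
  solvable G -> G :!=: 1 -> 0 < #|normal_maximals G|.
Proof.
move=> solG ntG; have [eG | [M maxM sGM]] := maximal_exists (der_sub 1 G).
  by have := sol_der1_proper solG (subxx G) ntG; rewrite eG properxx.
by rewrite card_gt0; apply/set0Pn; exists M; rewrite inE maxM (maximal_der_normal maxM).
Qed.

Lemma few_nonnormal_classes gT (G : {group gT}) q :
    solvable G -> ~~ nilpotent G ->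
    {in nonnormal_maximals G, forall M : {group gT}, q <= #|G : M|} ->
    num_maximal G = (2 * q.+1)%N ->
  (exists2 M, nonnormal_maximals G = conj_class G M & M \in nonnormal_maximals G)
  \/ (exists M N, [/\ M \in nonnormal_maximals G, N \in nonnormal_maximals G,
        N \notin conj_class G M
      & nonnormal_maximals G = conj_class G M :|: conj_class G N]).
Proof.
move=> solG nnilG leq_q; rewrite num_maximal_split => oG.
have ntG : G :!=: 1 by apply: contraNneq nnilG => ->; apply: nilpotent1.
have gt0N := sol_normal_maximal solG ntG.
have subC M : M \in nonnormal_maximals G -> conj_class G M \subset nonnormal_maximals G.
  by move=> nM; apply/subsetP=> X; apply: conj_class_nonnormal.
have [M nM] : exists M, M \in nonnormal_maximals G.
  apply/set0Pn; apply: contra nnilG => /eqP no_nn.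
  apply: all_maximal_normal_nil => M maxM; apply: contraT => nnM.
  have : M \in nonnormal_maximals G by rewrite inE maxM.
  by rewrite no_nn inE.
have [sM | /subsetPn[N nN nNM]] := boolP (nonnormal_maximals G \subset conj_class G M).
  by left; exists M => //; apply/eqP; rewrite eqEsubset sM subC.
have [sN | /subsetPn[L nL nLMN]] :=
    boolP (nonnormal_maximals G \subset conj_class G M :|: conj_class G N).
  by right; exists M, N; split=> //; apply/eqP; rewrite eqEsubset sN subUset !subC.
case/norP: (contraNN (fun h => introT setUP (elimT orP h)) nLMN) => nLM nLN.
have : #|conj_class G M :|: conj_class G N :|: conj_class G L| <= #|nonnormal_maximals G|.
  by rewrite subset_leq_card // !subUset !subC.
rewrite !cardsU setIUl !conj_class_disjoint // setU0 cards0 !subn0 !card_conj_class //.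
have := (leq_q _ nM, leq_q _ nN, leq_q _ nL).
have := (nonnormal_index_gt2 nM, nonnormal_index_gt2 nN, nonnormal_index_gt2 nL).
move: gt0N oG; move: #|nonnormal_maximals G| #|normal_maximals G|.
move: #|G : M| #|G : N| #|G : L| => a b c d e ? ? [[? ?] ?] [[? ?] ?] ?; lia.
Qed.

(** [J] will be the derived subgroup, or its intersection with the core of another maximal subgroup.
    As [J] meets the core of [M] trivially, a minimal normal subgroup inside it is not contained in
    [M]. *)
Lemma core_split gT (G M J : {group gT}) :
    solvable G -> maximal M G -> J <| G -> J :&: gcore M G = 1 -> J :!=: 1 ->
  exists V : {group gT}, exists2 p, prime p & [/\ p.-abelem V, minnormal V G, V \subset J,
    V ><| M = G & 'C_M(V) = gcore M G /\ #|V| = #|G : M|].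
Proof.
move=> solG maxM /andP[sJG nJG] tiJK ntJ; have sMG := proper_sub (maxgroupp maxM).
have [V minV sVJ] := minnormal_exists ntJ nJG.
have [nVG ntV /is_abelemP[p p_pr abV]] := minnormal_solvable minV (subset_trans sVJ sJG) solG.
have nVM : ~~ (V \subset M).
  by apply: contra ntV => sVM; rewrite -subG1 -tiJK subsetI sVJ gcore_max.
have cVV := abelem_abelian abV; have sVG := subset_trans sVJ sJG.
have defG := minnormal_compl minV cVV sVG maxM nVM.
exists V, p => //; split=> //; split.
  apply/eqP; rewrite eqEsubset; apply/andP; split.
    rewrite gcore_max ?subsetIl //; have [_ <- nVM' _] := sdprodP defG.
    rewrite mul_subG //.
      by apply: (subset_trans _ (cent_sub _)); rewrite centsC; apply: subsetIr.
    by rewrite normsI ?normG // norms_cent.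
  rewrite subsetI gcore_sub; apply/commG1P/trivgP; rewrite -tiJK subsetI.
  rewrite (subset_trans _ sVJ); last by rewrite commg_subr (subset_trans (gcore_sub _ _)) //
    (subset_trans sMG).
  by rewrite commg_subl (subset_trans sVG) // gcore_norm.
by rewrite -(divgS sMG) -(sdprod_card defG) mulnK.
Qed.

End ConjugacyClasses.

(** * Passing to the Frattini quotient *)

Section FrattiniQuotient.
Local Open Scope group_scope.
Implicit Types (gT : finGroupType) (p r : nat).

Lemma sub_maximal_Phi gT (G X : {group gT}) :
    X \subset G -> (forall M : {group gT}, maximal M G -> X \subset M) ->
  X \subset 'Phi(G).
Proof.
move=> sXG sXM; apply/bigcapsP=> M; rewrite /maximal_eq => /orP[/eqP-> // | ].
exact: sXM.
Qed.

Lemma num_maximal_Phi gT (G : {group gT}) : num_maximal (G / 'Phi(G)) = num_maximal G.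
Proof.
have nsPhi := Phi_normal G; have sPhi := normal_sub nsPhi.
have defG : coset 'Phi(G) @*^-1 (G / 'Phi(G)) = G by rewrite quotientGK.
have maxE (Y : {group coset_of 'Phi(G)}) :
  maximal (coset 'Phi(G) @*^-1 Y)%G G = maximal Y (G / 'Phi(G)).
  by rewrite -[RHS]cosetpre_maximal /= defG.
pose f (Y : {group coset_of 'Phi(G)}) := (coset 'Phi(G) @*^-1 Y)%G.
have injf : injective f.
  move=> Y1 Y2 /(congr1 (fun Z : {group gT} => Z / 'Phi(G))) /=.
  by rewrite !cosetpreK; apply: val_inj.
rewrite /num_maximal -(card_imset _ injf); apply: eq_card => M.
apply/imsetP/idP=> [[Y] | ]; rewrite !inE; first by rewrite -maxE => maxY ->.
move=> maxM; have sPM := Phi_sub_max maxM.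
have nsPM := normalS sPM (proper_sub (maxgroupp maxM)) nsPhi; exists (M / 'Phi(G))%G.
  by rewrite inE quotient_maximal.
by apply: val_inj; rewrite /= quotientGK.
Qed.

Lemma cyclic_quotient_Phi gT (G : {group gT}) : cyclic (G / 'Phi(G)) -> cyclic G.
Proof.
move/cyclicP=> [y defy]; have /morphimP[x Nx Gx defx] : y \in G / 'Phi(G) by rewrite defy
  cycle_id.
apply/cyclicP; exists x.
have sxG : <[x]> \subset G by rewrite cycle_subG.
rewrite -[<[x]>]genGid; symmetry; apply: Phi_nongen; apply/eqP;
  rewrite eqEsubset join_subG Phi_sub sxG /=.
rewrite norm_joinEr ?(subset_trans sxG) ?gFnorm //.
by rewrite -quotientSK ?gFnorm // defy defx quotient_cycle.
Qed.

(** An optimal cover may be taken to consist of maximal subgroups; these contain the Frattini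
    subgroup, so their images stay proper. Neither group is cyclic, so both numbers are genuine
    minima over covers. *)
Lemma covering_number_Phi gT (G : {group gT}) :
  ~~ cyclic G -> covering_number (G / 'Phi(G)) = covering_number G.
Proof.
move=> ncG; have ncQ : ~~ cyclic (G / 'Phi(G)) by apply: contra ncG; apply: cyclic_quotient_Phi.
have [_ [C covC oC] minC] := covering_numberP ncG.
have [_ [D covD oD] minD] := covering_numberP ncQ.
apply/eqP; rewrite eqn_leq; apply/andP; split; last first.
  have [B covB leB] := quotient_proper_cover (Phi_normal G) covD.
  by rewrite -oD (leq_trans (minC B covB)).
have [B [leB maxB covB]] := proper_cover_maximal covC.
rewrite -oC; apply: leq_trans leB.
apply: leq_trans (leq_imset_card (fun M : {group gT} => (M / 'Phi(G))%G) _).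
apply: minD; apply/andP; split.
  apply/forall_inP=> _ /imsetP[M BM ->].
  have maxM := maxB M BM.
  have nsPM := normalS (Phi_sub_max maxM) (proper_sub (maxgroupp maxM)) (Phi_normal G).
  by move: maxM; rewrite -(quotient_maximal nsPM (Phi_normal G)) => /maxgroupp.
rewrite eqEsubset; apply/andP; split.
  apply/bigcupsP=> _ /imsetP[M BM ->].
  by rewrite quotientS // proper_sub // (maxgroupp (maxB M BM)).
apply/subsetP=> _ /morphimP[x Nx Gx ->]; rewrite -covB in Gx.
have /bigcupP[M BM Mx] := Gx; apply/bigcupP; exists (M / 'Phi(G))%G; first exact: imset_f.
exact: mem_quotient.
Qed.

End FrattiniQuotient.

(** * The nonabelian group of order six *)

Section SixElements.
Local Open Scope group_scope.
Implicit Types (gT : finGroupType).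

Lemma nonabelian_order6_dihedral gT (G : {group gT}) :
  #|G| = 6 -> ~~ abelian G -> G \isog [set: 'D_6].
Proof.
move=> oG ncG.
have [x Gx ox] : {x | x \in G & #[x] = 3%N} by apply: Cauchy; rewrite ?oG.
have [y Gy oy] : {y | y \in G & #[y] = 2} by apply: Cauchy; rewrite ?oG.
have sxG : <[x]> \subset G by rewrite cycle_subG.
have nsx : <[x]> <| G.
  by apply: index2_normal => //; rewrite -divgS // oG -orderE ox.
have nxy : y \notin <[x]>.
  by apply/negP => /order_dvdG; rewrite oy -orderE ox.
have genG : <[x]> <*> <[y]> = G.
  apply/eqP; rewrite eqEcard join_subG !cycle_subG Gx Gy oG /=.
  have d2 : #[y] %| #|<[x]> <*> <[y]>| by rewrite order_dvdG // -cycle_subG joing_subr.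
  have d3 : #[x] %| #|<[x]> <*> <[y]>| by rewrite order_dvdG // -cycle_subG joing_subl.
  by apply: dvdn_leq => //; rewrite (@Gauss_dvd 2 3) // -{1}oy -ox d2 d3.
have xy : x ^ y = x^-1.
  have : x ^ y \in <[x]> by rewrite memJ_norm ?cycle_id // (subsetP (normal_norm nsx)).
  case/cyclePmin => [[|[|[|i]]]]; rewrite ox // => _ eqx.
  - by have := orderJ x y; rewrite eqx expg0 order1 ox.
  - case/negP: ncG; rewrite -genG abelianY !cycle_abelian /= cycle_subG /=.
    have cxy : commute x y by apply/commgP/conjg_fixP; rewrite eqx expg1.
    by rewrite cent_cycle; apply/cent1P; first [exact: cxy | exact: commute_sym].
  - by rewrite eqx; apply/eqP; rewrite eq_sym eq_invg_mul -expgS -ox expg_order.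
rewrite isogEcard oG (card_dihedral (isT : 1 < 3)) leqnn andbT.
rewrite (Grp_dihedral (isT : 1 < 3)); apply/existsP; exists (x, y) => /=.
by rewrite genG -{1}ox expg_order -{1}oy expg_order xy !eqxx.
Qed.

Lemma nonabelian_order6_sym3 gT (G : {group gT}) :
  #|G| = 6 -> ~~ abelian G -> G \isog [set: 'S_3].
Proof.
move=> oG ncG; apply: isog_trans (nonabelian_order6_dihedral oG ncG) _.
rewrite isog_sym; apply: nonabelian_order6_dihedral; first by rewrite cardsT card_Sn.
pose a : 'I_3 := ord0; pose b : 'I_3 := inord 1; pose c : 'I_3 := inord 2.
apply/negP=> /centsP/(_ _ (in_setT (tperm a b)) _ (in_setT (tperm a c))).
move/(congr1 (fun s : 'S_3 => val (s a))).
by rewrite !permM !tpermL !tpermD -?val_eqE /= ?inordK.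
Qed.

End SixElements.

(** * Prime powers next to a power of two *)

Section PrimePowerNeighbours.
Local Open Scope nat_scope.

Lemma expn_odd_mod d x n : odd n -> x ^ 2 = 1 %[mod d] -> x ^ n = x %[mod d].
Proof.
move=> odd_n x2; rewrite -(odd_double_half n) odd_n expnD expn1 -mul2n expnM.
by rewrite -modnMmr -modnXm x2 modnXm exp1n modnMmr muln1.
Qed.

Lemma odd_square_mod k x : odd x -> (2 ^ k %| x + 1) || (2 ^ k %| x - 1) ->
  x ^ 2 = 1 %[mod 2 ^ k.+1].
Proof.
move=> odd_x dv; have x_gt0 := odd_gt0 odd_x.
have e2 : x ^ 2 - 1 = (x - 1) * (x + 1) by rewrite -[1]/(1 ^ 2) subn_sqr.
apply/eqP; rewrite eqn_mod_dvd ?expn_gt0 ?x_gt0 // e2.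
have h1 : 2 %| x + 1 by rewrite dvdn2 oddD odd_x.
have h2 : 2 %| x - 1 by rewrite dvdn2 oddB // odd_x.
by rewrite expnS; case/orP: dv => dv; [rewrite dvdn_mul | rewrite mulnC dvdn_mul].
Qed.

(** If [2 ^ k] divides [x + 1], then [x ^ 2] is [1] modulo [2 ^ k.+1], because [x - 1] is even.
    Modulo this next power [x ^ n] is therefore [x], and the induction moves on. *)
Lemma pow2_dvd_expnD1 k x n : odd x -> odd n -> 2 ^ k %| x ^ n + 1 -> 2 ^ k %| x + 1.
Proof.
move=> odd_x odd_n; elim: k => [|k IHk] dv; first by rewrite dvd1n.
have dvk : 2 ^ k %| x + 1 by apply: IHk; apply: dvdn_trans dv; rewrite expnS dvdn_mull.
have e := expn_odd_mod odd_n (odd_square_mod odd_x (introT orP (or_introl dvk))).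
by move: dv; rewrite /dvdn -modnDml e modnDml.
Qed.

Lemma pow2_dvd_expnB1 k x n : odd x -> odd n -> 2 ^ k %| x ^ n - 1 -> 2 ^ k %| x - 1.
Proof.
move=> odd_x odd_n; have x_gt0 := odd_gt0 odd_x.
elim: k => [|k IHk] dv; first by rewrite dvd1n.
have dvk : 2 ^ k %| x - 1 by apply: IHk; apply: dvdn_trans dv; rewrite expnS dvdn_mull.
have e := expn_odd_mod odd_n (odd_square_mod odd_x (introT orP (or_intror dvk))).
by move: dv; rewrite -!eqn_mod_dvd ?expn_gt0 ?x_gt0 // e.
Qed.

(** An even [n] makes the left side [2] modulo [4]. For odd [n] all of [2 ^ k] divides [x + 1],
    which is too small unless [n = 1]. *)
Lemma expnD1_pow2 x n k : 1 < x -> 0 < n -> 1 < k -> x ^ n + 1 = 2 ^ k -> n = 1.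
Proof.
move=> x_gt1 n_gt0 k_gt1 e.
have odd_x : odd x.
  have : ~~ odd (x ^ n + 1) by rewrite e oddX; case: k k_gt1 {e}.
  by rewrite oddD addbT negbK oddX; case: n n_gt0 {e}.
have odd_n : odd n.
  apply: contraT => even_n.
  have odd_y : odd (x ^ n./2) by rewrite oddX odd_x orbT.
  have e4 : (x ^ n./2) ^ 2 = 1 %[mod 4].
    by apply: (@odd_square_mod 1) => //; rewrite expn1 dvdn2 oddD odd_y.
  have : 4 %| x ^ n + 1.
    by rewrite e -(subnKC k_gt1) expnD dvdn_mulr.
  by rewrite -(even_halfK even_n) -muln2 expnM /dvdn -modnDml e4.
have : 2 ^ k %| x + 1 by apply: (pow2_dvd_expnD1 odd_x odd_n); rewrite e.
move/dvdn_leq; rewrite addn1 -e addn1 => /(_ isT); rewrite ltnS -{2}(expn1 x) leq_exp2l //.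
by move=> n_le1; apply/eqP; rewrite eqn_leq n_le1.
Qed.

(** For odd [n], [2 ^ k] divides [x - 1], which forces [n = 1]. For even [n] the factors [y - 1] and
    [y + 1] of [2 ^ k] are powers of two at distance two, so [2] and [4]; hence the exception
    [9 = 8 + 1]. *)
Lemma expnB1_pow2 x n k : 2 < x -> odd x -> 0 < n -> x ^ n = 2 ^ k + 1 ->
  n = 1 \/ x ^ n = 9.
Proof.
move=> x_gt2 odd_x n_gt0 e; have [odd_n | even_n] := boolP (odd n).
  left; have : 2 ^ k %| x - 1 by apply: (pow2_dvd_expnB1 odd_x odd_n); rewrite e addnK.
  move/dvdn_leq; rewrite subn_gt0 (ltn_trans _ x_gt2) // => /(_ isT).
  have x_gt0 := odd_gt0 odd_x.
  rewrite leq_subRL // addnC -e -{2}(expn1 x) leq_exp2l ?(ltn_trans _ x_gt2) //.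
  by move=> n_le1; apply/eqP; rewrite eqn_leq n_le1.
right; have en : n = n./2 * 2 by rewrite muln2 even_halfK.
set y := x ^ n./2.
have y_gt2 : 2 < y.
  have m_gt0 : 0 < n./2 by case: n./2 en n_gt0 => // ->.
  by apply: (leq_trans x_gt2); rewrite -{1}(expn1 x) leq_exp2l // (ltn_trans _ x_gt2).
have e2 : (y - 1) * (y + 1) = 2 ^ k.
  by rewrite -subn_sqr exp1n -expnM -en e addnK.
have [i _ ei] : exists2 i, i <= k & y - 1 = 2 ^ i.
  by apply/(dvdn_pfactor _ _ (isT : prime 2)); rewrite -e2 dvdn_mulr.
have [l _ el] : exists2 l, l <= k & y + 1 = 2 ^ l.
  by apply/(dvdn_pfactor _ _ (isT : prime 2)); rewrite -e2 dvdn_mull.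
have y3 : y = 3.
  have e3 : 2 ^ l = 2 ^ i + 2 by lia.
  case: i ei e3 => [|[|i]] ei; rewrite ?expn0 ?expn1 in ei; try lia.
  case: l el => [|[|l]] el; rewrite ?expn0 ?expn1 in el; try lia.
  by rewrite !expnS; lia.
by rewrite en expnM -/y y3.
Qed.

End PrimePowerNeighbours.

(** * Fixed points and transitivity on a minimal normal subgroup *)

Section MinimalComplement.
Local Open Scope group_scope.
Implicit Types (gT : finGroupType) (p r : nat).

Lemma cent_normal_complement gT (G V M P : {group gT}) :
    minnormal V G -> abelian V -> V ><| M = G -> P <| M ->
  'C_V(P) = 1 \/ P \subset 'C(V).
Proof.
move=> minV cVV defG /andP[sPM nPM]; have [_ mulG nVM _] := sdprodP defG.
have [_ min_V] := mingroupP minV.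
have [CP1 | ntC] := eqVneq 'C_V(P) 1; [by left | right].
rewrite centsC; apply/setIidPl; apply: min_V; last exact: subsetIl.
rewrite ntC -mulG mul_subG //; last by rewrite normsI // norms_cent.
by apply: subset_trans (cent_sub _); rewrite (subset_trans cVV) // centS ?subsetIl.
Qed.

Lemma pcore_cent_complement gT p (G V M P : {group gT}) :
    minnormal V G -> p.-abelem V -> V ><| M = G -> P <| M -> p.-group P ->
  P \subset 'C(V).
Proof.
move=> minV abV defG nsPM pP; have [_ _ nVM _] := sdprodP defG.
case: (cent_normal_complement minV (abelem_abelian abV) defG nsPM) => // CP1.
have [/andP[ntV _] _] := (mingroupP minV).
have := pgroup_fixpoint pP (abelem_pgroup abV) (subset_trans (normal_sub nsPM) nVM) ntV.
by rewrite CP1 eqxx.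
Qed.

Lemma nonnormal_complement_noncent gT (G V M : {group gT}) :
  V ><| M = G -> ~~ (M <| G) -> ~~ (M \subset 'C(V)).
Proof.
move=> defG; have [_ mulG _ _] := sdprodP defG; apply: contra => cVM.
rewrite /normal -mulG mulG_subr mul_subG ?normG //.
by apply: subset_trans (cent_sub _); rewrite centsC.
Qed.

Lemma fixfree_pgroup_dvd gT r (P V : {group gT}) :
  r.-group P -> P \subset 'N(V) -> 'C_V(P) = 1 -> r %| #|V| - 1.
Proof.
move=> rP nVP CV1; have actsP : [acts P, on V | 'J] by rewrite astabsJ.
have := pgroup_fix_mod rP actsP; rewrite afixJ CV1 cards1 => /eqP.
by rewrite eqn_mod_dvd // cardG_gt0.
Qed.

Lemma pgroup_class_card gT r (P : {group gT}) v :
  r.-group P -> v \notin 'C(P) -> r <= #|v ^: P|.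
Proof.
move=> rP ncv; have : r.-nat #|P : 'C_P[v]| := pnat_dvd (dvdn_indexg _ _) rP.
rewrite -index_cent1; case/p_natP => -[|k] ek; last first.
  have := indexg_gt0 P 'C_P[v]%G; rewrite ek expnS muln_gt0 => /andP[_].
  exact: leq_pmulr.
case/negP: ncv; apply/centP=> x Px; suff : x \in 'C_P[v] by case/setIP=> _ /cent1P.
by rewrite (index1g (subsetIl _ _) ek).
Qed.

(** A vector that is not fixed has at least [r] conjugates, and [1] is not among them. *)
Lemma small_pgroup_central gT r (P V : {group gT}) :
  r.-group P -> P \subset 'N(V) -> #|V| <= r -> P \subset 'C(V).
Proof.
move=> rP nVP leV; rewrite centsC; apply/subsetP=> v Vv; apply: contraLR leV => ncv.
rewrite -ltnNge; apply: leq_ltn_trans (pgroup_class_card rP ncv) _.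
apply: proper_card; rewrite properEneq class_sub_norm // Vv andbT.
apply: contraNneq ncv => classV; have : 1 \in v ^: P by rewrite classV group1.
case/imsetP=> x _ /eqP; rewrite eq_sym conjg_eq1 => /eqP ->; exact: group1.
Qed.

Lemma prime_class_transitive gT r (P V : {group gT}) :
    prime r -> r.-group P -> P \subset 'N(V) -> #|V| = r.+1 -> ~~ (P \subset 'C(V)) ->
  exists2 v, v \in V & v ^: P = V^#.
Proof.
move=> r_pr rP nVP oV; rewrite centsC => /subsetPn[v Vv ncv]; exists v => //.
have ntv : v != 1 by apply: contraNneq ncv => ->; apply: group1.
have oV1 : #|V^#| = r by have := cardsD1 1 V; rewrite oV group1 => -[].
apply/eqP; rewrite eqEcard class_sub_norm ?normD1 // 2!inE ntv Vv oV1 /=.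
exact: pgroup_class_card.
Qed.

Section TransitiveClass.
Variables (gT : finGroupType) (V P : {group gT}) (v : gT).
Hypothesis classV : v ^: P = V^#.

Lemma transitive_class_cent (C : {group gT}) :
  P \subset 'C(C) -> C \subset 'N(V) -> 'C_C[v] = 'C_C(V).
Proof.
move=> cPC nVC; apply/eqP; rewrite eqEsubset; apply/andP; split.
  rewrite subsetI subsetIl /=; apply/subsetP=> x /setIP[Cx /cent1P cvx].
  apply/centP=> w Vw; have [-> | ntw] := eqVneq w 1; first exact: commute1.
  have : w \in V^# by rewrite !inE ntw.
  rewrite -classV => /imsetP[y Py ->].
  have cxy : commute x y by apply/commute_sym/(centsP cPC).
  by rewrite /conjg; apply: commuteM; [apply: commuteV | apply: commuteM].
have /setD1P[_ sv] : v \in V^# by rewrite -classV class_refl.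
by apply: setIS; rewrite -cent_set1 centS ?sub1set.
Qed.

(** The stabiliser of [v] has prime index in an [r]-group, so it is normal, and a normal point
    stabiliser in a transitive group is the kernel. *)
Lemma transitive_class_index r :
    prime r -> #|V| = r.+1 -> r.-group P -> P \subset 'N(V) -> #|P : 'C_P(V)| = r.
Proof.
move=> r_pr oV rP nVP.
have oV1 : #|V^#| = r by have := cardsD1 1 V; rewrite oV group1 => -[].
have iP : #|P : 'C_P[v]| = r by rewrite index_cent1 classV.
have maxC : maximal 'C_P[v] P by apply: p_index_maximal; rewrite ?subsetIl ?iP.
have nC : P \subset 'N('C_P[v]) := normal_norm (nil_maximal_normal (pgroup_nil rP) maxC).
suff -> : 'C_P(V) = 'C_P[v] by [].
apply/eqP; rewrite eqEsubset; apply/andP; split.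
  have /setD1P[_ sv] : v \in V^# by rewrite -classV class_refl.
  by apply: setIS; rewrite -cent_set1 centS ?sub1set.
rewrite subsetI subsetIl /=; apply/subsetP=> x Cx.
apply/centP=> w Vw; have [-> | ntw] := eqVneq w 1; first exact: commute1.
have : w \in V^# by rewrite !inE ntw.
rewrite -classV => /imsetP[y Py ->].
have : x ^ y^-1 \in 'C_P[v] by rewrite memJ_norm // groupV (subsetP nC).
case/setIP=> _; rewrite -(memJ_conjg _ y) conjgKV -cent1J => /cent1P.
exact.
Qed.
End TransitiveClass.

End MinimalComplement.

(** * One class of non-normal maximal subgroups *)

Section NormalOvergroups.
Local Open Scope group_scope.
Implicit Types (gT : finGroupType) (p r : nat).

Lemma conj_class_normal_sub gT (G M X V : {group gT}) :
  X \in conj_class G M -> G \subset 'N(V) -> V \subset X -> V \subset M.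
Proof.
case/conj_classP=> x Gx -> nVG /=.
by rewrite -[in X in X -> _](normP (subsetP nVG x Gx)) conjSg.
Qed.

Lemma mem_normal_maximals gT (G Z : {group gT}) :
  (Z \in normal_maximals G) = maximal Z G && (Z <| G).
Proof. by rewrite inE. Qed.

Lemma normal_pair_count gT (G Z1 Z2 : {group gT}) :
    Z1 \in normal_maximals G -> Z2 \in normal_maximals G -> Z2 != Z1 ->
    #|G : Z2| = #|G : Z1| ->
  #|G : Z1| < #|normal_maximals G|.
Proof.
rewrite !mem_normal_maximals => /andP[max1 ns1] /andP[max2 ns2] ne eqi.
have [C [oC maxC _]] := normal_pair_cover max1 ns1 max2 ns2 ne eqi.
rewrite -oC; apply: subset_leq_card; apply/subsetP=> X /maxC[maxX nsX _ _].
by rewrite mem_normal_maximals maxX.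
Qed.

Section Complement.
Variables (gT : finGroupType) (G V M : {group gT}).
Hypothesis defG : V ><| M = G.
Hypothesis normal_over : forall Z : {group gT}, maximal Z G -> V \subset Z -> Z <| G.

Lemma complement_nil : nilpotent M.
Proof.
apply: all_maximal_normal_nil => X maxX; have sXM := proper_sub (maxgroupp maxX).
rewrite -(sdprodY_normal defG sXM).
exact: (normal_over (sdprod_maximal defG maxX) (joing_subl V X)).
Qed.

Lemma complement_cyclic :
    {in normal_maximals G &, forall Z1 Z2 : {group gT}, #|G : Z1| = #|G : Z2| -> Z1 = Z2} ->
  cyclic M.
Proof.
move=> eqN; apply: nil_distinct_index_cyclic complement_nil _ => X1 X2 max1 max2 eqi.
have s1 := proper_sub (maxgroupp max1); have s2 := proper_sub (maxgroupp max2).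
have N (X : {group gT}) : maximal X M -> (V <*> X)%G \in normal_maximals G.
  move=> maxX; have maxVX := sdprod_maximal defG maxX.
  by rewrite mem_normal_maximals maxVX normal_over ?joing_subl.
have /(congr1 val) /= eqY : (V <*> X1)%G = (V <*> X2)%G.
  by apply: eqN; rewrite ?N //= !(sdprod_index defG).
by rewrite -(sdprodY_setI defG s1) eqY (sdprodY_setI defG).
Qed.

Lemma complement_num_maximal :
  V \subset G^`(1) -> num_maximal M = #|normal_maximals G|.
Proof.
move=> sVG'; pose f (X : {group gT}) := (V <*> X)%G.
have injf : {in [set X : {group gT} | maximal X M] &, injective f}.
  move=> X1 X2; rewrite !inE => max1 max2 /(congr1 val) /= eqY; apply: val_inj => /=.
  have s1 := proper_sub (maxgroupp max1); have s2 := proper_sub (maxgroupp max2).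
  by rewrite -(sdprodY_setI defG s1) eqY (sdprodY_setI defG).
rewrite /num_maximal -(card_in_imset injf); apply: eq_card => Z.
rewrite mem_normal_maximals; apply/imsetP/andP=> [[X] | [maxZ nsZ]].
  rewrite !inE => maxX ->; have maxVX := sdprod_maximal defG maxX.
  by rewrite maxVX normal_over ?joing_subl.
have sVZ := subset_trans sVG' (normal_maximal_der maxZ nsZ).
exists (Z :&: M)%G; first by rewrite inE (sdprod_maximalI defG).
by apply: val_inj; rewrite /= (sdprod_setIY defG) // normal_sub.
Qed.

End Complement.

(** Every non-normal maximal subgroup is conjugate to [M] and contains its core, every normal one
    contains the derived subgroup. So the core and the derived subgroup meet inside the Frattini
    subgroup, that is trivially, and the core is central. *)
Lemma one_class_split gT (G M : {group gT}) :
    solvable G -> 'Phi(G) = 1 -> M \in nonnormal_maximals G ->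
    nonnormal_maximals G = conj_class G M ->
  exists V : {group gT}, exists2 p, prime p &
    [/\ p.-abelem V, minnormal V G, V \subset G^`(1), V ><| M = G & #|V| = #|G : M|]
    /\ [/\ 'C_M(V) \subset 'C(G), 'C_M(V) :&: 'Phi(M) = 1
         & forall Z : {group gT}, maximal Z G -> V \subset Z -> Z <| G].
Proof.
move=> solG Phi1 nM classM; have := nM; rewrite inE => /andP[maxM nnM].
have ntG' : G^`(1) != 1.
  by apply: contraNneq nnM => G'1; apply: maximal_der_normal maxM _; rewrite G'1 sub1G.
have sMG := proper_sub (maxgroupp maxM).
have sKmax (Z : {group gT}) : maximal Z G -> ~~ (Z <| G) -> gcore M G \subset Z.
  move=> maxZ nnZ; have : Z \in conj_class G M by rewrite -classM inE maxZ.
  case/conj_classP=> x Gx -> /=; exact: bigcap_inf.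
have tiKG' : G^`(1) :&: gcore M G = 1.
  apply/trivgP; rewrite -Phi1; apply: sub_maximal_Phi => [|Z maxZ].
    by rewrite subIset // der_sub.
  have [nsZ | nnZ] := boolP (Z <| G); last by rewrite subIset ?sKmax ?orbT.
  by rewrite subIset ?(normal_maximal_der maxZ).
have [V [p p_pr [abV minV sVG' defG [CMV oV]]]] :=
  core_split solG maxM (der_normal 1 G) tiKG' ntG'.
have /andP[ntV nVG] := mingroupp minV.
have cKG : gcore M G \subset 'C(G).
  apply/commG1P/trivgP; rewrite -tiKG' subsetI commSg ?(subset_trans (gcore_sub M G)) //.
  by rewrite commg_subl gcore_norm.
have overV (Z : {group gT}) : maximal Z G -> V \subset Z -> Z <| G.
  move=> maxZ sVZ; apply: contraR ntV => nnZ.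
  have clZ : Z \in conj_class G M by rewrite -classM inE maxZ.
  have sVM := conj_class_normal_sub clZ nVG sVZ; have [_ _ _ tiVM] := sdprodP defG.
  by rewrite -subG1 -tiVM subsetI subxx.
exists V, p => //; split=> //; rewrite CMV; split=> //.
apply/trivgP; rewrite -Phi1; apply: sub_maximal_Phi => [|Z maxZ].
  by rewrite subIset // (subset_trans (gcore_sub M G)).
have [nsZ | nnZ] := boolP (Z <| G); last by rewrite subIset ?sKmax.
have sVZ := subset_trans sVG' (normal_maximal_der maxZ nsZ).
have maxZM := sdprod_maximalI defG sVZ maxZ.
by rewrite subIset // (subset_trans (Phi_sub_max maxZM)) ?subsetIl ?orbT.
Qed.

End NormalOvergroups.

(** * Cyclic factors and their maximal subgroups *)

Section CyclicFactors.
Local Open Scope group_scope.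
Implicit Types (gT : finGroupType) (p r : nat).

Lemma cyclic_isog_Zp gT (A : {group gT}) n : cyclic A -> #|A| = n -> A \isog Zp n.
Proof. by case/cyclicP=> a -> <-; rewrite isog_sym; apply: Zp_isog. Qed.

Lemma prime_isog_Zp gT (A : {group gT}) r : prime r -> #|A| = r -> A \isog Zp r.
Proof. by move=> r_pr oA; rewrite cyclic_isog_Zp // prime_cyclic ?oA. Qed.

Lemma num_maximal_isog gT rT (A : {group gT}) (B : {group rT}) :
  A \isog B -> num_maximal A = num_maximal B.
Proof.
case/isogP=> f injf <-; rewrite /num_maximal.
pose g (X : {group gT}) := (f @* X)%G.
have injg : {in [set X : {group gT} | maximal X A] &, injective g}.
  move=> X Y; rewrite !inE => /maxgroupp/proper_sub sXA /maxgroupp/proper_sub sYA.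
  by move/(congr1 val)=> /= /(injm_morphim_inj injf sXA sYA)/val_inj.
rewrite -(card_in_imset injg); apply: eq_card => Z.
rewrite inE; apply/imsetP/idP=> [[X] | maxZ].
  rewrite inE => maxX ->; have sXA := proper_sub (maxgroupp maxX).
  by rewrite /= injm_maximal.
have sZ := proper_sub (maxgroupp maxZ).
have defZ : f @* (f @*^-1 Z) = Z by rewrite morphpreK.
exists (f @*^-1 Z)%G; last by apply: val_inj.
by rewrite inE -(injm_maximal injf) ?subsetIl //= defZ.
Qed.

Lemma num_maximal_Zp gT (A : {group gT}) :
  cyclic A -> num_maximal (Zp #|A|) = num_maximal A.
Proof. by move=> cycA; apply/esym/num_maximal_isog/cyclic_isog_Zp. Qed.

Lemma sdprod_central_dprod gT (G V M R P : {group gT}) :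
  V ><| M = G -> R \x P = M -> P \subset 'C(V) -> (V ><| R) \x P = G.
Proof.
move=> defG defM cVP; have [_ mulG nVM tiVM] := sdprodP defG.
have [_ mulM cRP tiRP] := dprodP defM.
have sRM : R \subset M by rewrite -mulM mulG_subl.
have sPM : P \subset M by rewrite -mulM mulG_subr.
have tiVR : V :&: R = 1 by apply/trivgP; rewrite -tiVM setIS.
rewrite (sdprodEY (subset_trans sRM nVM) tiVR) dprodE /=.
- by rewrite (sdprod_mulY defG sRM) -mulgA mulM.
- by rewrite /= centY subsetI cVP.
apply/trivgP; rewrite -tiRP subsetI subsetIr andbT.
by rewrite -{2}(sdprodY_setI defG sRM) setIS.
Qed.

Lemma nil_maximals_pgroup gT r (M : {group gT}) :
    nilpotent M -> (forall X : {group gT}, maximal X M -> #|M : X| = r) -> prime r ->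
  r.-group M.
Proof.
move=> nilM maxr r_pr; have /and3P[_ _ r'R] := nilpotent_pcore_Hall r nilM.
have [eqM | [X maxX sRX]] := maximal_exists (pcore_sub r M).
  by rewrite -eqM pcore_pgroup.
have := pnat_dvd (indexgS M sRX) r'R.
by rewrite (maxr X maxX) p'natE // dvdnn.
Qed.

End CyclicFactors.

Section OneClass.
Local Open Scope group_scope.
Implicit Types (gT : finGroupType) (p r : nat).

Lemma normal_pigroup_sub_maximal gT (pi : nat_pred) (G M N : {group gT}) :
    maximal M G -> N <| G -> pi.-group N -> ~~ pi.-nat #|G : M| -> N \subset M.
Proof.
move=> maxM /andP[sNG nNG] piN; apply: contraR => nNM.
have defG : N * M = G.
  by apply: maximal_mulg; rewrite // (subset_trans (proper_sub (maxgroupp maxM))).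
by rewrite (index_mulg_setI defG) (pnat_dvd (dvdn_indexg _ _)).
Qed.

Lemma unique_num_maximal gT (G : {group gT}) :
    G :!=: 1 -> (forall M N : {group gT}, maximal M G -> maximal N G -> M :=: N) ->
  num_maximal G = 1%N.
Proof.
move=> ntG uniq; have [e1 | [M maxM _]] := maximal_exists (sub1G G).
  by rewrite -e1 eqxx in ntG.
apply/eqP/cards1P; exists M; apply/setP=> N; rewrite !inE.
by apply/idP/eqP=> [maxN | ->//]; apply/val_inj/uniq.
Qed.

(** The [r.+1] maximal subgroups above [X1 :&: X2] are already all of them. *)
Lemma nil_pair_Phi gT r (M X1 X2 : {group gT}) :
    nilpotent M -> maximal X1 M -> maximal X2 M -> X2 != X1 ->
    #|M : X1| = r -> #|M : X2| = r -> num_maximal M = r.+1 ->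
  [/\ r.-group M, X1 :&: X2 = 'Phi(M) & forall X : {group gT}, maximal X M -> #|M : X| = r].
Proof.
move=> nilM max1 max2 ne i1 i2 nM.
have ns1 := nil_maximal_normal nilM max1; have ns2 := nil_maximal_normal nilM max2.
have r_pr : prime r by rewrite -i1; apply: normal_maximal_prime.
have eqi : #|M : X2| = #|M : X1| by rewrite i1.
have [C [oC maxC _]] := normal_pair_cover max1 ns1 max2 ns2 ne eqi.
have defC : C = [set X : {group gT} | maximal X M].
  apply/eqP; rewrite eqEcard -/(num_maximal M) nM oC i1 leqnn andbT.
  by apply/subsetP=> X /maxC[maxX _ _ _]; rewrite inE.
have inC (X : {group gT}) : maximal X M -> X \in C by move=> maxX; rewrite defC inE.
have ir (X : {group gT}) : maximal X M -> #|M : X| = r.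
  by case/inC/maxC=> _ _ ->.
split=> //; first exact: nil_maximals_pgroup nilM ir r_pr.
apply/eqP; rewrite eqEsubset subsetI !Phi_sub_max // andbT sub_maximal_Phi //.
  by rewrite subIset // proper_sub ?(maxgroupp max1).
by move=> X /inC/maxC[].
Qed.

(** [M] is transitive on the [r] nontrivial elements of [V], so the kernel [K] has index [r], is
    maximal and contains ['Phi(M)], which is therefore trivial. Then [#|M| = r ^ 2], and any maximal
    subgroup other than [K] can serve as [T]. *)
Lemma affine_prime_split gT r (G V M X1 X2 : {group gT}) :
    V ><| M = G -> ~~ (M <| G) -> 'C_M(V) \subset 'C(G) -> 'C_M(V) :&: 'Phi(M) = 1 ->
    #|V| = r.+1 -> r.-group M -> maximal X1 M -> maximal X2 M -> X2 != X1 ->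
    #|M : X1| = r -> #|M : X2| = r -> X1 :&: X2 = 'Phi(M) ->
  exists T : {group gT}, [/\ #|T| = r, #|'C_M(V)| = r & (V ><| T) \x 'C_M(V) = G].
Proof.
move=> defG nnM cKG tiKPhi oV rM max1 max2 ne i1 i2 ePhi.
have [_ mulG nVM tiVM] := sdprodP defG.
have nilM := pgroup_nil rM; have ns1 := nil_maximal_normal nilM max1.
have r_pr : prime r by rewrite -i1; apply: normal_maximal_prime.
have ncMV := nonnormal_complement_noncent defG nnM.
have [v Vv classv] := prime_class_transitive r_pr rM nVM oV ncMV.
have iK := transitive_class_index classv r_pr oV rM nVM.
set K := ('C_M(V))%G; have sKM : K \subset M := subsetIl _ _.
have nsKM : K <| M by rewrite /normal sKM normsI ?normG ?norms_cent.
have sMG : M \subset G by rewrite -mulG mulG_subr.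
have cKM : K \subset 'C(M) := subset_trans cKG (centS sMG).
have maxK : maximal K M by apply: p_index_maximal => //; rewrite [#|_ : _|]iK.
have Phi1 : 'Phi(M) = 1 by apply/trivgP; rewrite -tiKPhi subsetI subxx Phi_sub_max.
have sX (X : {group gT}) : maximal X M -> X \subset M by move/maxgroupp/proper_sub.
have def12 : X1 * X2 = M := normal_maximal_mulg max1 ns1 max2 ne.
have oX1 : #|X1| = r.
  by rewrite -[LHS]indexg1 -Phi1 -ePhi -(index_mulg_setI def12).
have oM : #|M| = (r * r)%N by rewrite -(Lagrange (sX _ max1)) oX1 i1.
have oX (X : {group gT}) : maximal X M -> #|M : X| = r -> #|X| = r.
  move=> maxX iX; apply/eqP; rewrite -(eqn_pmul2r (prime_gt0 r_pr)) -{1}iX Lagrange ?sX //.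
  by rewrite oM.
have [T [maxT iT neTK]] : exists T : {group gT}, [/\ maximal T M, #|M : T| = r & T != K].
  have [eqK | neK] := eqVneq X1 K; last by exists X1.
  by exists X2; rewrite -eqK.
have oT := oX _ maxT iT; have oK := oX _ maxK iK.
exists T; split=> //.
have tiTK : T :&: K = 1.
  apply: prime_TIg; first by rewrite oT.
  by apply: contra neTK => sTK; apply/eqP/val_inj/eqP; rewrite /= eqEcard sTK oT oK /=.
apply: sdprod_central_dprod defG _ _; last exact: subsetIr.
rewrite dprodE //; last by rewrite (subset_trans cKM) // centS ?sX.
by apply: (normal_maximal_mulg maxT (nil_maximal_normal nilM maxT) maxK); rewrite eq_sym.
Qed.

(** [P] centralises [V]. Of the [r.+2] maximal subgroups, [r.+1] contain [X1 :&: X2] and the last,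
    [Z0], is the only one above [P]. So [P :&: (X1 :&: X2)] lies in the Frattini subgroup of [M] and
    in the kernel, hence is trivial, and [P] has order [r ^ 2]. [R] has a single maximal subgroup,
    coming from [Z0], which makes it cyclic. *)
Lemma plane_prime_split gT r (G V M X1 X2 : {group gT}) :
    minnormal V G -> V ><| M = G -> ~~ (M <| G) ->
    'C_M(V) \subset 'C(G) -> 'C_M(V) :&: 'Phi(M) = 1 ->
    #|V| = r -> nilpotent M -> maximal X1 M -> maximal X2 M -> X2 != X1 ->
    #|M : X1| = r -> #|M : X2| = r -> num_maximal M = r.+2 ->
  exists T B C : {group gT},
    [/\ #|B| = r, #|C| = r, cyclic T, num_maximal T = 1%N & (V ><| T) \x B \x C = G].
Proof.
move=> minV defG nnM cKG tiKPhi oV nilM max1 max2 ne i1 i2 nM.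
have [_ mulG nVM tiVM] := sdprodP defG.
have ns1 := nil_maximal_normal nilM max1; have ns2 := nil_maximal_normal nilM max2.
have r_pr : prime r by rewrite -i1; apply: normal_maximal_prime.
have abV : r.-abelem V by rewrite prime_abelem // oV.
have ncMV := nonnormal_complement_noncent defG nnM.
have eqi : #|M : X2| = #|M : X1| by rewrite i1.
have [C [oC maxC _]] := normal_pair_cover max1 ns1 max2 ns2 ne eqi.
rewrite i1 in oC maxC.
set P := 'O_r(M)%G; have nsPM : P <| M := pcore_normal _ _.
have rP : r.-group P := pcore_pgroup _ _.
have cPV : P \subset 'C(V) := pcore_cent_complement minV abV defG nsPM rP.
have sPM := normal_sub nsPM; have sPK : P \subset 'C_M(V) by rewrite subsetI sPM.
set R := 'O_r^'(M)%G; have defM : P \x R = M := nilpotent_pcoreC r nilM.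
have defM' : R \x P = M by rewrite dprodC.
have defMs : P ><| R = M by case/dprodP: defM => _ mulM cPR tiPR; rewrite sdprodE // cents_norm.
have [_ mulM cRP tiRP] := dprodP defM'.
have nsRM : R <| M := pcore_normal _ _; have r'R : r^'.-group R := pcore_pgroup _ _.
have sRM := normal_sub nsRM.
have [Z0 maxE] : exists Z0 : {group gT}, forall X : {group gT}, maximal X M ->
    (R \subset X /\ X1 :&: X2 \subset X) \/ X = Z0.
  have sCM : C \subset [set X : {group gT} | maximal X M].
    by apply/subsetP=> X /maxC[maxX _ _ _]; rewrite inE.
  have : #|[set X : {group gT} | maximal X M] :\: C| == 1%N.
    by rewrite cardsD (setIidPr sCM) -/(num_maximal M) nM oC subSnn.
  case/cards1P=> Z0 eZ; exists Z0 => X maxX; have [CX | nCX] := boolP (X \in C).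
    have [_ _ iX sWX] := maxC X CX; left; split=> //.
    apply: normal_pigroup_sub_maximal maxX nsRM r'R _.
    by rewrite iX p'natE // dvdnn.
  by right; apply/set1P; rewrite -eZ in_setD nCX inE.
have nPM : P :!=: M.
  by apply: contraNneq ncMV => <-.
have noPR (X : {group gT}) : maximal X M -> P \subset X -> ~~ (R \subset X).
  move=> maxX sPX; apply: contraL (maxgroupp maxX) => sRX.
  by rewrite properE negb_and negbK -mulM mul_subG ?orbT.
have maxP (X : {group gT}) : maximal X M -> P \subset X -> X = Z0.
  by move=> maxX sPX; case: (maxE X maxX) => // -[sRX _]; case/negP: (noPR X maxX sPX).
have sPZ (X : {group gT}) : maximal X M -> P \subset X \/ X1 :&: X2 \subset X.
  move=> maxX; case: (maxE X maxX) => [[_ ->] | eX]; [by right | left].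
  have [eP | [Y maxY sPY]] := maximal_exists sPM; first by rewrite eP eqxx in nPM.
  by rewrite eX -(maxP Y).
have tiPW : P :&: (X1 :&: X2) = 1.
  apply/trivgP; rewrite -tiKPhi subsetI (subset_trans (subsetIl _ _) sPK).
  apply: sub_maximal_Phi => [|X maxX]; first by rewrite subIset ?sPM.
  by case: (sPZ X maxX) => sX; rewrite subIset ?sX ?orbT.
have sRX (X : {group gT}) : maximal X M -> #|M : X| = r -> R \subset X.
  move=> maxX iX; apply: normal_pigroup_sub_maximal maxX nsRM r'R _.
  by rewrite iX p'natE // dvdnn.
have sX (X : {group gT}) : maximal X M -> X \subset M by move/maxgroupp/proper_sub.
have sX' (Y : {group gT}) : maximal Y R -> Y \subset R by move/maxgroupp/proper_sub.
have def12 : X1 * X2 = M := normal_maximal_mulg max1 ns1 max2 ne.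
have mulP (X : {group gT}) : X \subset M -> R \subset X -> #|M : X| = #|P : P :&: X|.
  move=> sXM sRX'; apply: index_mulg_setI; apply/eqP.
  rewrite eqEsubset; apply/andP; split; first by rewrite mul_subG.
  by have [_ mulPR _ _] := dprodP defM; rewrite -mulPR mulgS.
have oP2 : #|P| = (r * r)%N.
  have sRW : R \subset X1 :&: X2 by rewrite subsetI !sRX.
  rewrite -[LHS]indexg1 -tiPW -(mulP (X1 :&: X2)%G) //=; last by rewrite subIset ?sX.
  by rewrite -(Lagrange_index (sX _ max1) (subsetIl _ _)) i1 -(index_mulg_setI def12) i2.
have r_gt0 := prime_gt0 r_pr.
have oPX (X : {group gT}) : maximal X M -> #|M : X| = r -> #|P :&: X| = r.
  move=> maxX iX; have := mulP X (sX _ maxX) (sRX _ maxX iX); rewrite iX => iP.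
  by have := Lagrange (subsetIl P X); rewrite /= -iP oP2 => /eqP; rewrite eqn_pmul2r // => /eqP.
have oB := oPX _ max1 i1; have oD := oPX _ max2 i2.
have cPP : abelian P by apply: subset_trans (subset_trans sPK cKG) (centS _);
  rewrite (subset_trans sPM) // -mulG mulG_subr.
have tiBD : (P :&: X1) :&: (P :&: X2) = 1.
  by rewrite -setIIr.
have defP : (P :&: X1) \x (P :&: X2) = P.
  rewrite dprodE //; last by rewrite (sub_abelian_cent2 cPP) ?subsetIl.
  by apply/eqP; rewrite eqEcard mul_subG ?subsetIl //= TI_cardMg // oB oD oP2.
have uniqR (Y1 Y2 : {group gT}) : maximal Y1 R -> maximal Y2 R -> Y1 :=: Y2.
  move=> maxY1 maxY2; have s1 := sX' _ maxY1; have s2 := sX' _ maxY2.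
  have eY (Y : {group gT}) : maximal Y R -> (P <*> Y)%G = Z0.
    by move=> maxY; apply: (maxP _ (sdprod_maximal defMs maxY) (joing_subl _ _)).
  have /(congr1 val) /= e12 : (P <*> Y1)%G = (P <*> Y2)%G by rewrite !eY.
  by rewrite -(sdprodY_setI defMs s1) e12 (sdprodY_setI defMs).
have ntR : R :!=: 1.
  by apply: contraNneq nPM => R1; rewrite -mulM R1 mul1g.
exists R, (P :&: X1)%G, (P :&: X2)%G; split=> //.
- exact: unique_maximal_cyclic uniqR.
- exact: unique_num_maximal ntR uniqR.
by rewrite -dprodA defP; apply: sdprod_central_dprod defG defM' cPV.
Qed.

End OneClass.

Section ClassifiedTypes.
Local Open Scope nat_scope.

(* Types (i)-(iv), (vi) and (viii), in this order, with [q] the covering number minus one. *)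
Definition Phi_free_type (gT : finGroupType) (q : nat) (G : {group gT}) : Prop :=
  G \isog setX (Zp 2) [set: 'S_3]
  \/ (exists E A B : {group gT},
      [/\ mersenne_prime q, elementary_abelian_of_order q.+1 E,
          #|A| = q, #|B| = q & (E ><| A) \x B = G])
  \/ (exists E T : {group gT},
      [/\ 2 < q, num_maximal T = q.+2, cyclic T, elementary_abelian_of_order q E
        & E ><| T = G])
  \/ (exists A T B C : {group gT},
      [/\ prime q /\ odd q, cyclic T /\ num_maximal T = 1,
          [/\ #|A| = q, #|B| = q & #|C| = q] & (A ><| T) \x B \x C = G])
  \/ (exists E1 E2 T : {group gT},
      [/\ cyclic T /\ num_maximal T = 2, 2 < q,
          elementary_abelian_of_order q E1, elementary_abelian_of_order q E2
        & (E1 \x E2) ><| T = G])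
  \/ (exists E A T : {group gT},
      [/\ mersenne_prime q, [/\ cyclic T, num_maximal T = 1 & #|T| %| q.-1],
          elementary_abelian_of_order q.+1 E, #|A| = q & E ><| (A ><| T) = G]).

End ClassifiedTypes.

Section OneClassTypes.

Local Open Scope nat_scope.

Lemma cyclic_complement_count q n : q + n = 2 * q.+1 -> n = q.+2.
Proof. lia. Qed.

(** Here [v] is the order of [V], [n] the number of maximal subgroups of its complement, and [r] an
    index shared by two of these. *)
Lemma rank_two_class_size q r v n :
  v + n = 2 * q.+1 -> r < n -> q <= r -> q <= v -> n = r.+1 -> v = r.+1 \/ v < r.
Proof. lia. Qed.

Lemma rank_two_min_index q r : r.+1 + r.+1 = 2 * q.+1 -> r = q.
Proof. lia. Qed.

Lemma rank_two_tight_counts q r v n :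
  v + n = 2 * q.+1 -> r < n -> q <= r -> q <= v -> n != r.+1 ->
  [/\ v = q, r = q & n = r.+2].
Proof. by move=> ? ? ? ? /eqP ?; split; lia. Qed.

Local Open Scope group_scope.
Implicit Types (gT : finGroupType) (p r : nat).

Lemma conj_class_index gT (G M X : {group gT}) :
  X \in conj_class G M -> #|G : X| = #|G : M|.
Proof. by case/conj_classP=> x Gx ->; rewrite /= -{1}(conjGid Gx) indexJg. Qed.

Lemma nonnormal_multimax gT (G X : {group gT}) :
  X \in nonnormal_maximals G -> multimax G X.
Proof. by rewrite inE /multimax => /andP[-> ->]. Qed.

(** [r = 2] leaves a nonabelian factor of order six. For odd [r] the prime power [r.+1] is even, so
    it is a power of two and [r] is a Mersenne prime. *)
Lemma affine_prime_type gT r (G V T K : {group gT}) p :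
    prime p -> p.-abelem V -> #|V| = r.+1 -> prime r -> #|T| = r -> #|K| = r ->
    (V ><| T) \x K = G -> ~~ abelian G ->
  Phi_free_type r G.
Proof.
move=> p_pr abV oV r_pr oT oK defG ncG.
have [[VT _ defVT _] _ _ _] := dprodP defG; have [_ mulVT nVT tiVT] := sdprodP defVT.
have [r2 | r_odd] := even_prime r_pr; [left | right; left].
  have oVT : #|VT| = 6 by rewrite -(sdprod_card defVT) oV oT r2.
  have ncVT : ~~ abelian VT.
    apply: contra ncG => cVT; have [_ <- cVTK _] := dprodP defG.
    by rewrite defVT abelianM cVT cyclic_abelian ?prime_cyclic ?oK //= -defVT.
  rewrite defVT in defG; rewrite dprodC in defG.
  apply: isog_dprod defG (setX_dprod _ _) _ _.
    by apply: isog_trans (isog_setX1 _ _); apply: prime_isog_Zp; rewrite ?oK ?r2.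
  by apply: isog_trans (isog_set1X _ _); apply: nonabelian_order6_sym3.
exists V, T, K; split=> //; last by exists p.
split=> //.
have [e _ oVe] : exists2 e, 0 < e & #|V| = (p ^ e)%N.
  have ntV : V :!=: 1 by rewrite -cardG_gt1 oV ltnS prime_gt0.
  by have [_ _ [e ->]] := pgroup_pdiv (abelem_pgroup abV) ntV; exists e.+1.
have p2 : p = 2.
  have : 2 %| #|V| by rewrite oV dvdn2 /= r_odd.
  by rewrite oVe Euclid_dvdX // => /andP[]; rewrite dvdn_prime2 // => /eqP.
by exists e; rewrite -p2 -oVe oV subn1.
Qed.

Lemma one_class_type gT (G M X0 : {group gT}) q :
    solvable G -> 'Phi(G) = 1 -> M \in nonnormal_maximals G ->
    nonnormal_maximals G = conj_class G M ->
    (forall X : {group gT}, multimax G X -> q <= #|G : X|) -> multimax G X0 -> #|G : X0| = q ->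
    num_maximal G = (2 * q.+1)%N ->
  Phi_free_type q G.
Proof.
move=> solG Phi1 nM classM leq_q mX0 iX0 nG.
have [V [p p_pr [[abV minV sVG' defG oV] [cKG tiKPhi overV]]]] :=
  one_class_split solG Phi1 nM classM.
have := nM; rewrite inE => /andP[maxM nnM].
have nilM := complement_nil defG overV.
have nmM := complement_num_maximal defG overV sVG'.
have oG : (#|V| + num_maximal M = 2 * q.+1)%N.
  by rewrite -nG (num_maximal_split G) classM card_conj_class // oV nmM.
have leqV : q <= #|V| by rewrite oV leq_q ?nonnormal_multimax.
have V_gt2 : 2 < #|V| by rewrite oV nonnormal_index_gt2.
pose pair := [exists Z1 : {group gT}, [exists Z2 : {group gT}, [&& Z1 \in normal_maximals G,
  Z2 \in normal_maximals G, Z2 != Z1 & #|G : Z2| == #|G : Z1|]]].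
have [/existsP[Z1 /existsP[Z2 /and4P[nZ1 nZ2 neZ /eqP eqi]]] | nopair] := boolP pair; last first.
  have cycM : cyclic M.
    apply: (complement_cyclic defG overV) => Z1 Z2 nZ1 nZ2 eqi; apply/eqP.
    apply: contraR nopair => ne; apply/existsP; exists Z2; apply/existsP; exists Z1.
    by rewrite nZ1 nZ2 ne eqi eqxx.
  (* No two normal maximal subgroups share an index, so the [multimax] subgroup [X0] of least index
     is not normal and belongs to the only class. *)
  have eq_q : #|V| = q.
    rewrite -iX0 oV; apply/esym/conj_class_index; rewrite -classM.
    case/andP: mX0 => maxX0 /orP[nnX0 | /existsP[Y /and4P[maxY nsY neY eqi]]].
      by rewrite inE maxX0.
    rewrite inE maxX0; apply: contra nopair => nsX0.
    by apply/existsP; exists X0; apply/existsP; exists Y;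
      rewrite !mem_normal_maximals maxX0 nsX0 maxY nsY neY.
  right; right; left; exists V, M; rewrite -{1}eq_q; split=> //; last by exists p.
  by apply: cyclic_complement_count; rewrite -{1}eq_q.
have mV (Z : {group gT}) : Z \in normal_maximals G -> [/\ V \subset Z, maximal (Z :&: M) M &
  #|G : Z| = #|M : Z :&: M|].
  rewrite mem_normal_maximals => /andP[maxZ nsZ].
  have sVZ := subset_trans sVG' (normal_maximal_der maxZ nsZ).
  have maxZM := sdprod_maximalI defG sVZ maxZ; split=> //.
  rewrite -(sdprod_index defG) ?subsetIr //=; congr #|_ : _|.
  by rewrite (sdprod_setIY defG) // normal_sub.
have [sV1 max1 i1] := mV _ nZ1; have [sV2 max2 i2] := mV _ nZ2.
have sZG (Z : {group gT}) : Z \in normal_maximals G -> Z \subset G.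
  by rewrite mem_normal_maximals => /andP[_ /normal_sub].
have neX : (Z2 :&: M)%G != (Z1 :&: M)%G.
  apply: contra neZ => /eqP/(congr1 val) /= eqX; apply/eqP/val_inj => /=.
  by rewrite -(sdprod_setIY defG sV2) ?sZG // eqX (sdprod_setIY defG) ?sZG.
have lt_n := normal_pair_count nZ1 nZ2 neZ eqi; rewrite -nmM in lt_n.
have leqr : q <= #|G : Z1|.
  apply: leq_q; move: nZ1 nZ2; rewrite !mem_normal_maximals /multimax => /andP[-> _]
    /andP[maxZ2 nsZ2].
  by apply/orP; right; apply/existsP; exists Z2; rewrite maxZ2 nsZ2 neZ eqi eqxx.
have r_pr : prime #|G : Z1|.
  by move: nZ1; rewrite mem_normal_maximals => /andP[maxZ1]; apply: normal_maximal_prime.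
have ncMV := nonnormal_complement_noncent defG nnM.
have [_ mulG nVM tiVM] := sdprodP defG.
rewrite eqi in i2; move: (#|G : Z1|) i1 i2 lt_n leqr r_pr {eqi} => r i1 i2 lt_n leqr r_pr.
have [nMr | neM] := eqVneq (num_maximal M) r.+1.
  have [rM ePhi _] := nil_pair_Phi nilM max1 max2 neX (esym i1) (esym i2) nMr.
  have [oVr | oVr] : #|V| = r.+1 \/ #|V| < r by apply: rank_two_class_size oG lt_n leqr leqV nMr.
    have rq : r = q by apply: rank_two_min_index; rewrite -oG oVr nMr.
    have [T [oT oK defTK]] := affine_prime_split defG nnM cKG tiKPhi oVr rM max1 max2 neX
      (esym i1) (esym i2) ePhi.
    rewrite -rq; apply: (affine_prime_type p_pr abV oVr r_pr oT oK defTK).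
    by apply: contra nnM => cGG; rewrite -sub_abelian_normal // proper_sub ?(maxgroupp maxM).
  (* Here [#|V| < r]: too few elements for the [r]-group [M] to act nontrivially. *)
  by case/negP: ncMV; apply: small_pgroup_central rM nVM (ltnW oVr).
have [oVq rq nMr] : [/\ #|V| = q, r = q & num_maximal M = r.+2].
  exact: rank_two_tight_counts oG lt_n leqr leqV neM.
rewrite rq in i1 i2 nMr r_pr.
have [T [B [C [oB oC cycT nT defBC]]]] := plane_prime_split minV defG nnM cKG tiKPhi oVq nilM
  max1 max2 neX (esym i1) (esym i2) nMr.
right; right; right; left; exists V, T, B, C; split=> //; split=> //.
by case: (even_prime r_pr) V_gt2 => // q2; rewrite oVq q2.
Qed.

End OneClassTypes.

(** * Two classes of non-normal maximal subgroups *)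

Section TwoClasses.
Local Open Scope group_scope.
Implicit Types (gT : finGroupType) (p r : nat).

Lemma conj_class_sym gT (G M N : {group gT}) :
  (M \in conj_class G N) = (N \in conj_class G M).
Proof. exact: orbit_sym. Qed.

Lemma two_minnormal_split gT (G M1 M2 V1 V2 : {group gT}) :
    V1 ><| M1 = G -> V2 ><| M2 = G -> V1 \subset M2 -> V2 \subset M1 ->
    G \subset 'N(V1) -> G \subset 'N(V2) -> V1 :&: V2 = 1 ->
  [/\ V2 ><| (M1 :&: M2) = M1, V1 ><| (M1 :&: M2) = M2, V2 \subset 'C(V1)
    & (V1 \x V2) ><| (M1 :&: M2) = G].
Proof.
move=> def1 def2 s12 s21 nV1 nV2 ti12.
have [_ mul1 _ ti1] := sdprodP def1; have [_ mul2 _ ti2] := sdprodP def2.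
have sM1 : M1 \subset G by rewrite -mul1 mulG_subr.
have sM2 : M2 \subset G by rewrite -mul2 mulG_subr.
have sV1 : V1 \subset G := subset_trans s12 sM2.
have sV2 : V2 \subset G := subset_trans s21 sM1.
have defM1 : V2 ><| (M1 :&: M2) = M1.
  rewrite sdprodE.
  - by rewrite /= setIC group_modl // mul2 (setIidPr sM1).
  - by rewrite subIset // (subset_trans sM1 nV2).
  by rewrite setIA setIAC ti2; apply/setIidPl/sub1G.
have defM2 : V1 ><| (M1 :&: M2) = M2.
  rewrite sdprodE.
  - by rewrite /= group_modl // mul1 (setIidPr sM2).
  - by rewrite subIset // (subset_trans sM1 nV1).
  by rewrite setIA ti1; apply/setIidPl/sub1G.
have c21 : V2 \subset 'C(V1).
  apply/commG1P/trivgP; rewrite -ti12 subsetI.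
  by rewrite commg_subr (subset_trans sV2) //= commg_subl (subset_trans sV1).
have [_ mulM1 _ tiM1] := sdprodP defM1.
have defY : V1 <*> V2 = V1 * V2 by rewrite norm_joinEr ?(subset_trans sV2).
split=> //; rewrite dprodEY // sdprodE /=.
- by rewrite defY -mulgA mulM1.
- rewrite normsY //; last by rewrite subIset // (subset_trans sM1).
  by rewrite subIset // (subset_trans sM1).
apply/trivgP/subsetP=> x; rewrite /= defY.
case/setIP=> /mulsgP[a b V1a V2b ->] /setIP[M1ab M2ab].
have a1 : a = 1.
  by apply/set1gP; rewrite -ti1 in_setI V1a -(groupMr a (subsetP s21 b V2b)).
rewrite a1 mul1g in M2ab *.
by rewrite -ti2 in_setI V2b.
Qed.

(** With a single maximal subgroup, [M1 :&: M2] would be an [r]-group, and it has no nontrivial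
    fixed points on [V1] or [V2]. Then [r] divides [#|V1| - 1 = #|V2|], so it acts on a group of its
    own characteristic, where fixed points exist. *)
Lemma two_minnormal_coprime gT p1 p2 q (G M1 M2 V1 V2 : {group gT}) :
    V1 ><| M1 = G -> V2 ><| M2 = G -> V2 ><| (M1 :&: M2) = M1 -> V1 ><| (M1 :&: M2) = M2 ->
    V2 \subset 'C(V1) -> minnormal V1 G -> minnormal V2 G -> p1.-abelem V1 -> p2.-abelem V2 ->
    prime p2 -> ~~ (M1 <| G) -> ~~ (M2 <| G) -> #|V1| = q.+1 -> #|V2| = q ->
    nilpotent (M1 :&: M2) ->
  num_maximal (M1 :&: M2) != 1%N.
Proof.
move=> def1 def2 defM1 defM2 c21 min1 min2 ab1 ab2 p2_pr nn1 nn2 oV1 oV2 nilX.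
apply/negP=> /cards1P[Y eqY].
have maxY : maximal Y (M1 :&: M2) by have := set11 Y; rewrite -eqY inE.
have r_pr := normal_maximal_prime maxY (nil_maximal_normal nilX maxY).
set r := #|_ : _| in r_pr.
have rX : r.-group (M1 :&: M2).
  apply: nil_maximals_pgroup => // Z maxZ.
  by suff /set1P -> : Z \in [set Y] by []; rewrite -eqY inE.
have fix1 : 'C_V1(M1 :&: M2) = 1.
  case: (cent_normal_complement min1 (abelem_abelian ab1) def1 (normal_refl M1)) => [|cM1];
    last first.
    by case/negP: (nonnormal_complement_noncent def1 nn1).
  have [_ mulM _ _] := sdprodP defM1.
  by rewrite -{1}mulM centM setIA; move: c21; rewrite centsC => /setIidPl ->.
have fix2 : 'C_V2(M1 :&: M2) = 1.
  case: (cent_normal_complement min2 (abelem_abelian ab2) def2 (normal_refl M2)) => [|cM2];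
    last first.
    by case/negP: (nonnormal_complement_noncent def2 nn2).
  have [_ mulM _ _] := sdprodP defM2.
  by rewrite -{1}mulM centM setIA (setIidPl c21).
have nX (V M : {group gT}) : V ><| M = G -> M1 :&: M2 \subset M -> M1 :&: M2 \subset 'N(V).
  by case/sdprodP=> _ _ nVM _ sX; apply: subset_trans nVM.
have := fixfree_pgroup_dvd rX (nX _ _ def1 (subsetIl _ _)) fix1.
rewrite oV1 subn1 /= -oV2 => rV2.
have [/andP[ntV2 _] _] := mingroupP min2.
have [_ pV2 [e oVe]] := pgroup_pdiv (abelem_pgroup ab2) ntV2.
have er : r = p2.
  by move: rV2; rewrite oVe Euclid_dvdX // dvdn_prime2 // => /andP[/eqP].
rewrite er in rX.
have := pgroup_fixpoint rX (abelem_pgroup ab2) (nX _ _ def2 (subsetIr _ _)) ntV2.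
by rewrite fix2 eqxx.
Qed.

End TwoClasses.

(** * Conjugacy of nilpotent complements, and the centre *)

Section CentralClass.
Local Open Scope group_scope.
Implicit Types (gT : finGroupType) (p r : nat).

(** ['O_p(M)] centralises [V]. If the Hall subgroup were normal in [G], it would centralise [V] as
    well and [M] would be normal; so its normaliser is [M] by maximality. *)
Lemma nil_complement_norm_Hall gT p (G V M : {group gT}) :
    p.-abelem V -> minnormal V G -> V ><| M = G -> maximal M G -> ~~ (M <| G) ->
    nilpotent M ->
  p^'.-Hall(G) 'O_p^'(M) /\ 'N_G('O_p^'(M)) = M.
Proof.
move=> abV minV defG maxM nnM nilM; have [_ mulG nVM tiVM] := sdprodP defG.
have sMG := proper_sub (maxgroupp maxM).
have /and3P[sHM p'H iH] := nilpotent_pcore_Hall p^' nilM.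
split.
  rewrite /pHall (subset_trans sHM) // p'H -(Lagrange_index sMG sHM) pnatM iH /=.
  rewrite -(divgS sMG) -(sdprod_card defG) mulnK // pnatNK.
  by rewrite andbT; apply: abelem_pgroup abV.
have [_ max_M] := maxgroupP maxM.
have [eqG | neG] := eqVneq 'N_G('O_p^'(M)) G; last first.
  apply: (max_M 'N_G('O_p^'(M))%G); last by rewrite subsetI sMG gFnorm.
  by rewrite properEneq neG subsetIl.
case/negP: (nonnormal_complement_noncent defG nnM).
have [_ <- _ _] := dprodP (nilpotent_pcoreC p nilM).
rewrite mul_subG //.
  exact: (pcore_cent_complement minV abV defG (pcore_normal p M) (pcore_pgroup p M)).
have tiHV : 'O_p^'(M) :&: V = 1.
  by apply/trivgP; rewrite -tiVM subsetI subsetIr subIset ?sHM.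
have sVG : V \subset G by rewrite -mulG mulG_subl.
apply/commG1P/trivgP; rewrite -tiHV subsetI commg_subr (subset_trans sHM nVM) andbT.
by rewrite commg_subl (subset_trans sVG) // -{1}eqG subsetIr.
Qed.

(* Both complements are normalisers of Hall [p']-subgroups. *)
Lemma nil_complements_conj gT p (G V M1 M2 : {group gT}) :
    solvable G -> p.-abelem V -> minnormal V G -> V ><| M1 = G -> V ><| M2 = G ->
    maximal M1 G -> maximal M2 G -> ~~ (M1 <| G) -> ~~ (M2 <| G) ->
    nilpotent M1 -> nilpotent M2 ->
  M2 \in conj_class G M1.
Proof.
move=> solG abV minV def1 def2 max1 max2 nn1 nn2 nil1 nil2.
have [hall1 N1] := nil_complement_norm_Hall abV minV def1 max1 nn1 nil1.
have [hall2 N2] := nil_complement_norm_Hall abV minV def2 max2 nn2 nil2.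
have [x Gx eqH] := Hall_trans solG hall2 hall1.
apply/conj_classP; exists x => //; apply: val_inj => /=.
by rewrite -N2 -N1 conjIg conjGid // -normJ -eqH.
Qed.

(* A central subgroup of prime order would be complemented by a normal maximal
   subgroup, and it would also lie in another one. *)
Lemma single_normal_center gT (G : {group gT}) :
    solvable G -> 'Phi(G) = 1 -> ~~ abelian G -> #|normal_maximals G| = 1%N -> 'Z(G) = 1.
Proof.
move=> solG Phi1 ncG n1; apply/eqP; apply: contraT => ntZ.
have u_pr : prime (pdiv #|'Z(G)|) by rewrite pdiv_prime // cardG_gt1.
have [z /setIP[Gz cGz] oz] := Cauchy u_pr (pdiv_dvd _).
have prZ : prime #|<[z]>| by rewrite -orderE oz.
have szG : <[z]> \subset G by rewrite cycle_subG.
have czG : <[z]> \subset 'C(G) by rewrite cycle_subG.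
have [Y /andP[maxY nzY]] : exists Y : {group gT}, maximal Y G && ~~ (<[z]> \subset Y).
  apply/existsP; apply: contraT => /existsPn noY.
  have : <[z]> \subset 'Phi(G).
    by apply: sub_maximal_Phi => // Y maxY; have := noY Y; rewrite maxY /= negbK.
  by rewrite Phi1 => /trivgP z1; rewrite z1 cards1 in prZ.
have sYG := proper_sub (maxgroupp maxY).
have defZY : <[z]> ><| Y = G.
  rewrite sdprodE; first by apply: maximal_mulg => //;
    rewrite cents_norm // centsC (subset_trans czG) ?centS.
    by rewrite cents_norm // centsC (subset_trans czG) ?centS.
  exact: prime_TIg.
have nsY : Y <| G.
  have [_ <- _ _] := sdprodP defZY; rewrite /normal mulG_subr mul_subG ?normG //.
  by rewrite cents_norm // (subset_trans czG) ?centS.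
have ntY : Y :!=: 1.
  apply: contraNneq ncG => Y1; have [_ <- _ _] := sdprodP defZY.
  by rewrite Y1 mulg1 cycle_abelian.
have := sol_normal_maximal (solvableS sYG solG) ntY.
rewrite card_gt0 => /set0Pn[W]; rewrite mem_normal_maximals => /andP[maxW nsW].
have maxZW := sdprod_maximal defZY maxW.
have nsZW : <[z]> <*> W <| G by rewrite (sdprodY_normal defZY) ?normal_sub.
have /cards1P[X eqX] := introT eqP n1.
have nX (Z : {group gT}) : maximal Z G -> Z <| G -> Z = X.
  by move=> maxZ nsZ; apply/set1P; rewrite -eqX mem_normal_maximals maxZ.
have eY : Y = X := nX Y maxY nsY.
case/negP: nzY; rewrite eY -(nX (<[z]> <*> W)%G) //; exact: joing_subl.
Qed.

End CentralClass.

(** * Two classes, the core of [M1] being central *)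

Section CentralClassSetup.
Local Open Scope group_scope.
Implicit Types (gT : finGroupType) (p r : nat).

(** Non-normal maximal subgroups above [V] are conjugate to [M2]. [V] lies in [M2]: otherwise there
    are none of them, and [M1] and [M2] are nilpotent complements of [V], hence conjugate. It
    follows that [M1] is not nilpotent and has an [X] with [V <*> X] conjugate to [M2], which makes
    [#|G : M2|] a power of [r]. *)
Lemma central_class_split gT (G M1 M2 : {group gT}) :
    solvable G -> M1 \in nonnormal_maximals G -> M2 \in nonnormal_maximals G ->
    M2 \notin conj_class G M1 ->
    nonnormal_maximals G = conj_class G M1 :|: conj_class G M2 ->
    G^`(1) :&: gcore M1 G = 1 ->
  exists V X : {group gT}, exists p r : nat,
    [/\ [/\ p.-abelem V, minnormal V G, V \subset G^`(1), V ><| M1 = G & #|V| = #|G : M1|],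
        [/\ prime p, 'C_M1(V) \subset 'C(G), prime r & r != p],
        [/\ maximal X M1, ~~ (X <| M1), ~~ ('O_r(M1) \subset X), #|M1 : X| = #|G : M2|
          & r.-nat #|M1 : X|]
      & forall Z : {group gT}, maximal Z G -> V \subset Z -> 'O_r(M1) \subset Z -> Z <| G].
Proof.
move=> solG n1 n2 n12 classes tiKG'.
have := n1; rewrite inE => /andP[max1 nn1]; have := n2; rewrite inE => /andP[max2 nn2].
have ntG' : G^`(1) != 1.
  by apply: contraNneq nn1 => G'1; apply: maximal_der_normal max1 _; rewrite G'1 sub1G.
have [V [p p_pr [abV minV sVG' defG [CMV oV]]]] :=
  core_split solG max1 (der_normal 1 G) tiKG' ntG'.
have /andP[ntV nVG] := mingroupp minV.
have [_ mulG nVM tiVM] := sdprodP defG.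
have sMG : M1 \subset G by rewrite -mulG mulG_subr.
have sVG : V \subset G by rewrite -mulG mulG_subl.
have cKG : 'C_M1(V) \subset 'C(G).
  rewrite CMV; apply/commG1P/trivgP; rewrite -tiKG' subsetI commSg ?(subset_trans (gcore_sub _
    _)) //.
  by rewrite commg_subl gcore_norm.
have nV1 : ~~ (V \subset M1).
  by apply: contra ntV => sVM; rewrite -subG1 -tiVM subsetI subxx.
have class2 (Z : {group gT}) : maximal Z G -> ~~ (Z <| G) -> V \subset Z -> Z \in conj_class G M2.
  move=> maxZ nnZ sVZ; have : Z \in nonnormal_maximals G by rewrite inE maxZ.
  rewrite classes => /setUP[Z1 | //]; case/negP: nV1.
  exact: conj_class_normal_sub Z1 nVG sVZ.
have sV2 : V \subset M2.
  apply: contraR n12 => nV2; have cVV := abelem_abelian abV.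
  have defG2 := minnormal_compl minV cVV sVG max2 nV2.
  have overV (Z : {group gT}) : maximal Z G -> V \subset Z -> Z <| G.
    move=> maxZ sVZ; apply: contraR nV2 => nnZ.
    exact: conj_class_normal_sub (class2 Z maxZ nnZ sVZ) nVG sVZ.
  have [nil1 nil2] := (complement_nil defG overV, complement_nil defG2 overV).
  exact: nil_complements_conj solG abV minV defG defG2 max1 max2 nn1 nn2 nil1 nil2.
have nnil1 : ~~ nilpotent M1.
  apply: contra nn2 => nil1; have maxX0 := sdprod_maximalI defG sV2 max2.
  have sM2G := proper_sub (maxgroupp max2).
  have := nil_maximal_normal nil1 maxX0; rewrite -(sdprodY_normal defG) ?subsetIr //=.
  by rewrite (sdprod_setIY defG).
have [X [r [maxX nnX r_pr nRX]]] := nonnormal_maximal_pcore (solvableS sMG solG) nnil1.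
have sXM := proper_sub (maxgroupp maxX).
have VX2 : (V <*> X)%G \in conj_class G M2.
  by apply: (class2 _ (sdprod_maximal defG maxX) _ (joing_subl V X));
    rewrite /= (sdprodY_normal defG sXM).
have iX : #|M1 : X| = #|G : M2|.
  by rewrite -(sdprod_index defG) // (conj_class_index VX2).
have defM : 'O_r(M1) * X = M1.
  by apply: maximal_mulg; rewrite ?pcore_sub // (subset_trans sXM) ?gFnorm.
have rX : r.-nat #|M1 : X|.
  by rewrite (index_mulg_setI defM); apply: (pnat_dvd (dvdn_indexg _ _) (pcore_pgroup r M1)).
exists V, X, p, r; split; [by split | split=> // | by split | ].
  apply: contra nnX => /eqP r_p; rewrite /normal sXM -{1}defM mul_subG ?normG //.
  have cRV : 'O_r(M1) \subset 'C(V).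
    rewrite r_p; exact: (pcore_cent_complement minV abV defG (pcore_normal p M1) (pcore_pgroup
      p M1)).
  have cRG : 'O_r(M1) \subset 'C(G) by rewrite (subset_trans _ cKG) // subsetI pcore_sub.
  by rewrite cents_norm // (subset_trans cRG) // centS // (subset_trans sXM).
(* A non-normal [Z] above the normal subgroup [V <*> 'O_r(M1)] would be conjugate to [V <*> X], and
   [X] would contain the [r]-core. *)
move=> Z maxZ sVZ sRZ; apply: contraR nRX => nnZ.
have Z2 := class2 Z maxZ nnZ sVZ.
have nVR : G \subset 'N(V <*> 'O_r(M1)).
  by apply: normal_norm; rewrite (sdprodY_normal defG) ?pcore_sub ?pcore_normal.
have sVR2 : V <*> 'O_r(M1) \subset M2.
  by apply: (conj_class_normal_sub Z2 nVR); rewrite join_subG sVZ.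
rewrite conj_class_sym in VX2.
have sVRX := conj_class_normal_sub VX2 nVR sVR2.
rewrite -(sdprodY_setI defG sXM) subsetI pcore_sub andbT.
exact: subset_trans (joing_subr _ _) sVRX.
Qed.

End CentralClassSetup.

(** * Complements with one maximal subgroup above the [r]-core *)

Section SingleOverPcore.
Local Open Scope group_scope.
Implicit Types (gT : finGroupType) (p r : nat).

(** The quotient by the [r]-core has one maximal subgroup, so it is a cyclic [u]-group. Its own
    [r]-core is trivial, so [u != r] and the Schur-Zassenhaus theorem provides [U]. *)
Lemma unique_maximal_over_pcore gT r (M : {group gT}) :
    'O_r(M) != M ->
    (forall Z1 Z2 : {group gT}, maximal Z1 M -> maximal Z2 M ->
      'O_r(M) \subset Z1 -> 'O_r(M) \subset Z2 -> Z1 :=: Z2) ->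
  exists U : {group gT}, exists2 u, prime u &
    [/\ 'O_r(M) ><| U = M, u != r, u.-group U, cyclic U & num_maximal U = 1%N].
Proof.
move=> neP uniq; set P := 'O_r(M)%G; have nsPM : P <| M := pcore_normal r M.
have defM : coset P @*^-1 (M / P) = M by rewrite quotientGK.
have uniqQ (Y1 Y2 : {group coset_of P}) : maximal Y1 (M / P) -> maximal Y2 (M / P) -> Y1 :=: Y2.
  rewrite -!cosetpre_maximal !defM => max1 max2.
  have eY := uniq _ _ max1 max2 (sub_cosetpre Y1) (sub_cosetpre Y2).
  by rewrite -(cosetpreK Y1) eY cosetpreK.
have cycQ : cyclic (M / P) := unique_maximal_cyclic uniqQ.
have ntQ : (M / P)%G :!=: 1.
  by rewrite /= -subG1 quotient_sub1 ?normal_norm //; apply: contra neP => sMP;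
    rewrite eqEsubset pcore_sub.
have [e1 | [Y maxY _]] := maximal_exists (sub1G (M / P)%G).
  by rewrite -e1 eqxx in ntQ.
have nilQ : nilpotent (M / P) by rewrite abelian_nil ?cyclic_abelian.
have u_pr := normal_maximal_prime maxY (nil_maximal_normal nilQ maxY).
set u := #|_ : _| in u_pr.
have uQ : u.-group (M / P).
  apply: nil_maximals_pgroup => // Z maxZ; congr #|_ : _|; exact: uniqQ.
have u_r : u != r.
  apply: contraNneq ntQ => ur; rewrite ur in uQ.
  by rewrite /= -(pcore_pgroup_id uQ) trivg_pcore_quotient.
have hallP : Hall M P.
  rewrite /Hall pcore_sub -card_quotient ?normal_norm //.
  apply: (@pnat_coprime r); first exact: pcore_pgroup.
  by apply: (pi_pgroup uQ); rewrite !inE.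
have /splitsP[U /complP[tiPU mulPU]] := SchurZassenhaus_split hallP nsPM.
have sUM : U \subset M by rewrite -mulPU mulG_subr.
have defPU : P ><| U = M by rewrite sdprodE // (subset_trans sUM) ?normal_norm.
have isoU : U \isog (M / P)%G := sdprod_isog defPU.
exists U, u => //; split=> //.
- by rewrite (isog_pgroup u isoU).
- by rewrite (isog_cyclic isoU).
rewrite (num_maximal_isog isoU); exact: unique_num_maximal ntQ uniqQ.
Qed.

(** [P] is faithful and transitive on the [r] nontrivial elements of [V], so [#|P| = r]. ['C_M(P)]
    commutes with a transitive group, hence acts semiregularly and has order at most [r]. It equals
    [P], so [U] acts faithfully on a group of prime order, where a nontrivial automorphism has no
    fixed points. *)
Lemma affine_Mersenne_complement gT r (G V M P U : {group gT}) :
    V ><| M = G -> 'C_M(V) = 1 -> prime r -> #|V| = r.+1 -> r.-group P -> P :!=: 1 ->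
    P ><| U = M ->
  #|P| = r /\ #|U| %| r.-1.
Proof.
move=> defG CMV r_pr oV rP ntP defM; have [_ _ nVM _] := sdprodP defG.
have [nsPM sUM mulPU nPU tiPU] := sdprod_context defM; have sPM := normal_sub nsPM.
have CPV : 'C_P(V) = 1 by apply/trivgP; rewrite -CMV setSI.
have nVP := subset_trans sPM nVM.
have ncPV : ~~ (P \subset 'C(V)).
  by apply: contra ntP => cPV; rewrite -CPV (setIidPl cPV).
have [v Vv classv] := prime_class_transitive r_pr rP nVP oV ncPV.
have oP : #|P| = r.
  by rewrite -(transitive_class_index classv r_pr oV rP nVP) CPV indexg1.
have cPP : abelian P by rewrite cyclic_abelian ?prime_cyclic ?oP.
have sPC : P \subset 'C_M(P) by rewrite subsetI sPM.
have nVC : 'C_M(P) \subset 'N(V) := subset_trans (subsetIl _ _) nVM.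
have cPC : P \subset 'C('C_M(P)) by rewrite centsC subsetIr.
have oC : #|'C_M(P)| <= r.
  rewrite -[#|_|]indexg1 -(_ : 'C_('C_M(P))[v] = 1); last first.
    rewrite (transitive_class_cent classv cPC nVC); apply/trivgP.
    by rewrite -CMV setSI ?subsetIl.
  rewrite index_cent1; have oV1 : #|V^#| = r by have := cardsD1 1 V; rewrite oV group1 => -[].
  rewrite -oV1 subset_leq_card // class_sub_norm ?normD1 //.
  by rewrite -classv class_refl.
have defC : P :=: 'C_M(P) by apply/eqP; rewrite eqEcard sPC oP.
split=> //; rewrite -oP; apply: regular_norm_dvd_pred => // x /setD1P[ntx Ux].
have prP : prime #|P| by rewrite oP.
apply: contraNeq ntx => ntC; rewrite -in_set1 -[[set 1]]tiPU in_setI Ux andbT.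
rewrite defC in_setI (subsetP sUM) //= -sub_cent1.
by apply: contraR ntC => /(prime_TIg prP)/eqP.
Qed.

(* The quotient [X / L] would act irreducibly on a group of order 8, which forces
   [u = 7], but no element of order 7 acts on a group of order 9. *)
Lemma no_affine_nine gT u (V M X P : {group gT}) :
    solvable M -> M \subset 'N(V) -> 'C_M(V) = 1 -> #|V| = 9 -> prime u ->
    maximal X M -> ~~ (X <| M) -> P <| M -> ~~ (P \subset X) -> #|M : X| = 8 ->
    2.-group P -> u.-nat #|M : P| -> False.
Proof.
move=> solM nVM CMV oV u_pr maxX nnX nsPM nPX iX p2P uMP.
have [sPM nPM] := andP nsPM; have sXM := proper_sub (maxgroupp maxX).
have defM : P * X = M by apply: maximal_mulg; rewrite // (subset_trans sXM).
pose L := (P :&: X)%G; have sLP : L \subset P := subsetIl P X.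
have nsLX : L <| X.
  by rewrite /normal subsetIr normsI ?normG // (subset_trans sXM).
have sLM := subset_trans sLP sPM.
have nsLM : L <| M.
  have [_ max_X] := maxgroupP maxX.
  have [eN | neN] := eqVneq 'N_M(L) M; first by rewrite /normal sLM -{1}eN subsetIr.
  have eqX : 'N_M(L) = X.
    apply: (max_X 'N_M(L)%G); last by rewrite subsetI sXM normal_norm.
    by rewrite properEneq neN subsetIl.
  have : L \proper 'N_P(L).
    apply: nilpotent_proper_norm (pgroup_nil p2P) _.
    by rewrite properE sLP; apply: contra nPX => sPL; rewrite (subset_trans sPL) ?subsetIr.
  rewrite properE => /andP[_ /negP[]].
  apply/subsetIP; split; first exact: subsetIl.
  by rewrite -eqX setSI.
have sPXL : L \subset X := subsetIr P X.
have nsLP := normalS sLP sPM nsLM.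
have nLM := normal_norm nsLM.
have maxXb : maximal (X / L) (M / L) by rewrite quotient_maximal.
have tiPX : (P / L) :&: (X / L) = 1.
  by rewrite -quotientGI ?trivg_quotient.
have ntPb : (P / L)%G :!=: 1.
  rewrite /= -subG1 quotient_sub1 ?normal_norm //.
  by apply: contra nPX => sPL; rewrite (subset_trans sPL) ?subsetIr.
have tiJ : (P / L)%G :&: gcore (X / L) (M / L) = 1.
  by apply/trivgP; rewrite -tiPX setIS ?gcore_sub.
have [W [p p_pr [abW minW sWP defMb [_ oW]]]] :=
  core_split (quotient_sol _ solM) maxXb (quotient_normal L nsPM) tiJ ntPb.
have iXb : #|M / L : X / L| = 8.
  by rewrite index_quotient_eq // subIset ?sPXL ?orbT.
have defXP : X * P = M by rewrite (normC (subset_trans sXM nPM)).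
have oXb : #|X / L| = #|M : P|.
  by rewrite card_quotient ?(subset_trans sXM) // (index_mulg_setI defXP) setIC.
have oPb : #|P / L| = 8.
  by rewrite card_quotient ?(subset_trans sPM) // -(index_mulg_setI defM).
have defW : W :=: P / L by apply/eqP; rewrite eqEcard sWP oPb oW iXb.
have nnXb : ~~ (X / L <| M / L).
  apply: contra nnX => nsXb; have := cosetpre_normal (X / L)%G (M / L)%G.
  by rewrite nsXb /= !quotientGK.
have ncW := nonnormal_complement_noncent defMb nnXb.
have uXb : u.-group (X / L) by rewrite /pgroup oXb.
have ntXb : (X / L)%G :!=: 1.
  by apply: contraNneq ncW => ->; apply: sub1G.
have [_ uX _] := pgroup_pdiv uXb ntXb.
have [_ _ nWX _] := sdprodP defMb.
have CW1 : 'C_W(X / L) = 1.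
  case: (cent_normal_complement minW (abelem_abelian abW) defMb (normal_refl _)) => // cX.
  by rewrite cX in ncW.
have := fixfree_pgroup_dvd uXb nWX CW1; rewrite defW oPb dvdn_prime2 // => /eqP u7'.
have u7 : u = 7 := u7'.
have /Cauchy[//|x Mx ox] : 7 %| #|M|.
  by rewrite -{1}u7 (dvdn_trans uX) //= oXb dvdn_indexg.
have nVx : <[x]> \subset 'N(V) by rewrite cycle_subG (subsetP nVM).
have p7x : 7.-group <[x]> by rewrite /pgroup -orderE ox pnat_id.
have actsx : [acts <[x]>, on V | 'J] by rewrite astabsJ.
have := pgroup_fix_mod p7x actsx; rewrite afixJ oV => oC.
have dC : #|'C_V(<[x]>)| %| 9 by rewrite -oV cardSg ?subsetIl.
(* The order is a divisor of [9] congruent to [9] modulo [7]. *)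
have C9 : #|'C_V(<[x]>)| = 9.
  by move: oC dC; case: #|_| => [|[|[|[|[|[|[|[|[|[|n]]]]]]]]]] //=; move=> _ /dvdn_leq;
    rewrite ltnNge.
have cVx : V \subset 'C(<[x]>).
  by apply/setIidPl/eqP; rewrite eqEcard subsetIl oV C9.
have : x \in 'C_M(V) by rewrite inE Mx -cycle_subG centsC.
by rewrite CMV => /set1P x1; rewrite x1 order1 in ox.
Qed.

End SingleOverPcore.

(** * Two indices that differ by one *)

Section TwoClassTypes.
Local Open Scope nat_scope.

Lemma two_class_counts q a b n :
  q <= a -> q <= b -> 0 < n -> a + b + n = 2 * q.+1 ->
  [\/ [/\ a = q, b = q & n = 2], [/\ a = q, b = q.+1 & n = 1] | [/\ a = q.+1, b = q & n = 1]].
Proof.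
move=> ha hb hn e.
have [h|h] : n = 2 \/ n = 1 by lia.
  by constructor 1; split=> //; lia.
have [h'|h'] : a = q \/ a = q.+1 by lia.
  by constructor 2; split=> //; lia.
by constructor 3; split=> //; lia.
Qed.

Lemma two_class_counts_neighbours q a b n :
  q <= a -> q <= b -> 0 < n -> a + b + n = 2 * q.+1 ->
  a = b \/ [/\ n = 1, (b == a.+1) || (a == b.+1) & a = b.+1 -> b = q].
Proof.
move=> ha hb hn e; have := two_class_counts ha hb hn e.
by case=> -[-> -> ->]; [left | right | right]; split; rewrite ?eqxx ?orbT //; lia.
Qed.

(** [a] is the order of [V] and [b] the index of the other class; [r] divides both [b] and [a - 1].
    For [b = a.+1] this gives [r = 2], and [a + 1] being a power of two makes [a] a prime. For
    [a = b.+1] one of the two is a power of two: either [b] is a prime, or [a] is [9]. *)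
Lemma prime_power_neighbours p r i k a b :
    prime p -> prime r -> 0 < i -> 0 < k -> a = p ^ i -> b = r ^ k -> 2 < a ->
    ~~ prime a -> r %| a - 1 -> (b == a.+1) || (a == b.+1) ->
  [/\ b = 8, a = 9 & r = 2] \/ [/\ prime b, b = r, a = b.+1 & p = 2].
Proof.
move=> p_pr r_pr i_gt0 k_gt0 ea eb a_gt2 npr ra.
have i_ne1 : i <> 1 by move=> i1; move: npr; rewrite ea i1 expn1 p_pr.
have rb : r %| b by rewrite eb -{1}(expn1 r) dvdn_exp2l.
have p_gt1 := prime_gt1 p_pr; have r_gt1 := prime_gt1 r_pr.
case/orP=> /eqP e.
  have r2 : r = 2.
    have : r %| b - (a - 1) by rewrite dvdn_sub.
    have -> : b - (a - 1) = 2 by rewrite e; lia.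
    by rewrite dvdn_prime2 // => /eqP.
  case: i_ne1; apply: (@expnD1_pow2 p i k) => //.
    case: k k_gt0 {rb} eb => [|[|k]] // _ eb; move: e a_gt2; rewrite eb r2 expn1; lia.
  by rewrite -ea addn1 -e eb r2.
have [p2 | p_odd] := even_prime p_pr.
  have k1 : k = 1.
    apply: (@expnD1_pow2 r k i) => //; last by rewrite -eb addn1 -e ea p2.
    by case: i i_gt0 i_ne1 {ea} => [|[|i]].
  by right; split=> //; rewrite eb k1 expn1.
have r2 : r = 2.
  have [//|r_odd] := even_prime r_pr.
  have : odd a by rewrite ea oddX p_odd orbT.
  by rewrite e /= eb oddX r_odd orbT.
have p_gt2 : 2 < p by rewrite ltn_neqAle p_gt1 andbT; apply: contraTneq p_odd => <-.
have [//|e9] : i = 1 \/ p ^ i = 9.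
  by apply: (@expnB1_pow2 p i k); rewrite // -ea e eb r2 addn1.
by left; split=> //; move: e; rewrite ea e9; case.
Qed.

Local Open Scope group_scope.
Implicit Types (gT : finGroupType) (p r : nat).

Lemma prime_faithful_abelian gT (V M : {group gT}) :
  prime #|V| -> M \subset 'N(V) -> 'C_M(V) = 1 -> abelian M.
Proof.
move=> V_pr nVM CMV; have sR : [~: M, M] \subset M := der_sub 1 M.
apply/commG1P/trivgP; rewrite -CMV subsetI sR -ker_conj_aut kerE /=.
have sD : [~: M, M] \subset 'N(V) := subset_trans sR nVM.
rewrite -sub_morphim_pre // morphimR // (commG1P _) //.
by apply: abelianS (Aut_conj_aut V M) (Aut_cyclic_abelian (prime_cyclic V_pr)).
Qed.

Lemma central_class_type gT (G M1 M2 : {group gT}) q :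
    solvable G -> 'Phi(G) = 1 -> M1 \in nonnormal_maximals G -> M2 \in nonnormal_maximals G ->
    M2 \notin conj_class G M1 ->
    nonnormal_maximals G = conj_class G M1 :|: conj_class G M2 ->
    G^`(1) :&: gcore M1 G = 1 -> q <= #|G : M1| -> q <= #|G : M2| ->
    (#|G : M1| + #|G : M2| + #|normal_maximals G| = 2 * q.+1)%N ->
  Phi_free_type q G.
Proof.
move=> solG Phi1 n1 n2 n12 classes tiKG' leq1 leq2 eqs.
have [V [X [p [r [[abV minV sVG' defG oV] [p_pr cKG r_pr r_p] [maxX nnX nRX iX rX] overP]]]]] :=
  central_class_split solG n1 n2 n12 classes tiKG'.
have := n1; rewrite inE => /andP[max1 nn1].
have ncG : ~~ abelian G.
  by apply: contra nn1 => cGG; rewrite -sub_abelian_normal // proper_sub ?(maxgroupp max1).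
have ntG : G :!=: 1 by apply: contraNneq ncG => ->; apply: abelian1.
have /andP[ntV nVG] := mingroupp minV.
have [_ _ [i oVi]] := pgroup_pdiv (abelem_pgroup abV) ntV.
have sXM := proper_sub (maxgroupp maxX).
have [k oXk] := p_natP rX.
have k_gt0 : 0 < k.
  rewrite lt0n; apply: contraNneq nRX => k0.
  by move/eqP: oXk; rewrite k0 indexg_eq1 => sMX; rewrite (subset_trans (pcore_sub _ _)).
(* Equal indices would make a power of [p] equal to a power of [r]. So the indices differ by one and
   there is a single normal maximal subgroup. *)
have [eqV | [en neib ebq]] : #|G : M1| = #|G : M2| \/
  [/\ #|normal_maximals G| = 1%N, (#|G : M2| == #|G : M1|.+1) || (#|G : M1| == #|G : M2|.+1)
    & #|G : M1| = #|G : M2|.+1 -> #|G : M2| = q].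
- exact: two_class_counts_neighbours leq1 leq2 (sol_normal_maximal solG ntG) eqs.
- case/eqP: r_p; have : p %| r ^ k by rewrite -oXk iX -eqV -oV oVi expnS dvdn_mulr.
  by rewrite Euclid_dvdX // dvdn_prime2 // => /andP[/eqP].
have sMG := proper_sub (maxgroupp max1).
have CMV : 'C_M1(V) = 1.
  apply/trivgP; rewrite -(single_normal_center solG Phi1 ncG en) subsetI cKG.
  by rewrite subIset ?sMG.
have [_ mulG nVM tiVM] := sdprodP defG; have sVG : V \subset G by rewrite -mulG mulG_subl.
set P := 'O_r(M1)%G; have nsPM : P <| M1 := pcore_normal r M1.
have rP : r.-group P := pcore_pgroup r M1.
have CVP : 'C_V(P) = 1.
  case: (cent_normal_complement minV (abelem_abelian abV) defG nsPM) => // cPV.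
  case/negP: nRX; suff : 'O_r(M1) \subset 'C_M1(V) by rewrite CMV => /subset_trans->;
    rewrite ?sub1G.
  by rewrite subsetI pcore_sub.
have rV := fixfree_pgroup_dvd rP (subset_trans (normal_sub nsPM) nVM) CVP.
have npV : ~~ prime #|V|.
  apply: contra nnX => V_pr; rewrite -sub_abelian_normal //.
  exact: prime_faithful_abelian V_pr nVM CMV.
have neP : 'O_r(M1) != M1.
  apply: contraNneq nnX => eP; apply: nil_maximal_normal maxX.
  by rewrite -eP (pgroup_nil rP).
have /cards1P[Y eqY] := introT eqP en.
have uniqP (Z1 Z2 : {group gT}) : maximal Z1 M1 -> maximal Z2 M1 ->
    'O_r(M1) \subset Z1 -> 'O_r(M1) \subset Z2 -> Z1 :=: Z2.
  have inY (Z : {group gT}) : maximal Z M1 -> 'O_r(M1) \subset Z -> (V <*> Z)%G = Y.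
    move=> maxZ sPZ; apply/set1P; rewrite -eqY mem_normal_maximals.
    have maxVZ := sdprod_maximal defG maxZ; rewrite maxVZ overP ?joing_subl //=.
    exact: subset_trans sPZ (joing_subr V Z).
  move=> maxZ1 maxZ2 sP1 sP2; have /(congr1 val) /= e : (V <*> Z1)%G = (V <*> Z2)%G by rewrite
    !inY.
  have s1 := proper_sub (maxgroupp maxZ1); have s2 := proper_sub (maxgroupp maxZ2).
  by rewrite -(sdprodY_setI defG s1) e (sdprodY_setI defG s2).
have [U [u u_pr [defM u_r uU cycU nU]]] := unique_maximal_over_pcore neP uniqP.
rewrite oV in rV npV; rewrite iX in oXk.
have V_gt2 := nonnormal_index_gt2 n1.
have oV' := oV; rewrite oVi in oV'.
have [[e8 e9 r2] | [b_pr b_r ea p2]] := prime_power_neighbours p_pr r_pr (ltn0Sn i) k_gt0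
  (esym oV') oXk V_gt2 npV rV neib.
  have oMP : #|M1 : P| = #|U| by rewrite -(divgS (normal_sub nsPM)) -(sdprod_card defM) mulKn.
  case: (@no_affine_nine _ u V M1 X P) => //; rewrite ?iX ?oV ?e9 //.
  - exact: solvableS sMG solG.
  - by rewrite -r2.
  by rewrite oMP.
have bq := ebq ea; have rq : r = q by rewrite -b_r.
have ntP : P :!=: 1.
  by apply: contraNneq nRX => P1; rewrite [_ \subset _](_ : P \subset X) // P1 sub1G.
have oVr : #|V| = r.+1 by rewrite oV ea -b_r.
have [oP dU] := affine_Mersenne_complement defG CMV r_pr oVr rP ntP defM.
do 5 right; exists V, P, U; rewrite -rq; split=> //.
- by split=> //; exists i.+1; rewrite -p2 -oVi oVr subn1.
- by exists p.
by rewrite defM.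
Qed.

End TwoClassTypes.

(** * Classification for a trivial Frattini subgroup *)

Section PhiFree.
Local Open Scope group_scope.
Implicit Types (gT : finGroupType) (p r : nat).

Lemma gcore_conj_class_sub gT (G M Z : {group gT}) :
  Z \in conj_class G M -> gcore M G \subset Z.
Proof. by case/conj_classP=> x Gx -> /=; apply: bigcap_inf. Qed.

Lemma two_class_type gT (G M1 M2 : {group gT}) q :
    solvable G -> 'Phi(G) = 1 -> M1 \in nonnormal_maximals G -> M2 \in nonnormal_maximals G ->
    M2 \notin conj_class G M1 ->
    nonnormal_maximals G = conj_class G M1 :|: conj_class G M2 ->
    q <= #|G : M1| -> q <= #|G : M2| ->
    (#|G : M1| + #|G : M2| + #|normal_maximals G| = 2 * q.+1)%N ->
  Phi_free_type q G.
Proof.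
move=> solG Phi1 n1 n2 n12 classes leq1 leq2 eqs.
have := n1; rewrite inE => /andP[max1 nn1]; have := n2; rewrite inE => /andP[max2 nn2].
have [sM1 sM2] := (proper_sub (maxgroupp max1), proper_sub (maxgroupp max2)).
have tiK : G^`(1) :&: (gcore M1 G :&: gcore M2 G) = 1.
  apply/trivgP; rewrite -Phi1; apply: sub_maximal_Phi => [|Z maxZ].
    by rewrite subIset // der_sub.
  have [nsZ | nnZ] := boolP (Z <| G); first by rewrite subIset ?(normal_maximal_der maxZ).
  have : Z \in nonnormal_maximals G by rewrite inE maxZ.
  rewrite classes => /setUP[] /gcore_conj_class_sub; apply: subset_trans.
    exact: subset_trans (subsetIr _ _) (subsetIl _ _).
  exact: subset_trans (subsetIr _ _) (subsetIr _ _).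
(* A core that meets the derived subgroup trivially is central. Otherwise each intersection contains
   a minimal normal subgroup, which lies in one of [M1] and [M2] and is complemented by the
   other. *)
have [K1 | ntJ2] := eqVneq (G^`(1) :&: gcore M1 G) 1.
  exact: central_class_type solG Phi1 n1 n2 n12 classes K1 leq1 leq2 eqs.
have [K2 | ntJ1] := eqVneq (G^`(1) :&: gcore M2 G) 1.
  rewrite setUC in classes; rewrite conj_class_sym in n12; rewrite (addnC #|G : M1|) in eqs.
  exact: central_class_type solG Phi1 n2 n1 n12 classes K2 leq2 leq1 eqs.
have nsJ (M : {group gT}) : M \subset G -> G^`(1) :&: gcore M G <| G.
  by move=> sM; rewrite normalI ?der_normal ?gcore_normal.
have tiJ1 : (G^`(1) :&: gcore M2 G) :&: gcore M1 G = 1 by rewrite -setIA (setIC (gcore M2 G)).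
have tiJ2 : (G^`(1) :&: gcore M1 G) :&: gcore M2 G = 1 by rewrite -setIA.
have [V1 [p1 p1_pr [ab1 min1 sVJ1 def1 [_ oV1]]]] := core_split solG max1 (nsJ M2 sM2) tiJ1 ntJ1.
have [V2 [p2 p2_pr [ab2 min2 sVJ2 def2 [_ oV2]]]] := core_split solG max2 (nsJ M1 sM1) tiJ2 ntJ2.
have [sV1G' sV1K] := subsetIP sVJ1; have [sV2G' sV2K] := subsetIP sVJ2.
have sV1 := subset_trans sV1K (gcore_sub M2 G); have sV2 := subset_trans sV2K (gcore_sub M1 G).
have /andP[nt1 nV1] := mingroupp min1; have /andP[nt2 nV2] := mingroupp min2.
have ti12 : V1 :&: V2 = 1.
  by apply/trivgP; rewrite -tiJ1 setISS.
have [defM1 defM2 c21 defG] := two_minnormal_split def1 def2 sV1 sV2 nV1 nV2 ti12.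
have ntsub (V M : {group gT}) : V ><| M = G -> V :!=: 1 -> ~~ (V \subset M).
  by case/sdprodP=> _ _ _ tiVM; apply: contra => sVM; rewrite -subG1 -tiVM subsetI subxx.
have defG' : (V1 <*> V2)%G ><| (M1 :&: M2)%G = G by rewrite /= -dprodEY.
have over (Z : {group gT}) : maximal Z G -> (V1 <*> V2)%G \subset Z -> Z <| G.
  rewrite join_subG => maxZ /andP[sV1Z sV2Z]; apply: contraT => nnZ.
  have : Z \in nonnormal_maximals G by rewrite inE maxZ.
  rewrite classes => /setUP[] clZ.
    by case/negP: (ntsub _ _ def1 nt1); apply: conj_class_normal_sub clZ nV1 sV1Z.
  by case/negP: (ntsub _ _ def2 nt2); apply: conj_class_normal_sub clZ nV2 sV2Z.
have sVG' : (V1 <*> V2)%G \subset G^`(1) by rewrite join_subG sV1G'.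
have nilX := complement_nil defG' over.
have nX := complement_num_maximal defG' over sVG'.
have ntG : G :!=: 1 by apply: contraNneq nt1 => G1; rewrite -subG1 -G1 (subset_trans sV1).
case: (two_class_counts leq1 leq2 (sol_normal_maximal solG ntG) eqs) => -[e1 e2 en].
(* Two normal maximal subgroups with the same prime index would bring a third one, and there are
   only two. *)
- have cycX : cyclic (M1 :&: M2).
    apply: (complement_cyclic defG' over) => Z1 Z2 nZ1 nZ2 eqi; apply/eqP.
    apply: contraT => neZ; have := normal_pair_count nZ2 nZ1 neZ eqi.
    move: nZ2; rewrite en mem_normal_maximals => /andP[maxZ2 nsZ2].
    by rewrite ltnNge (prime_gt1 (normal_maximal_prime maxZ2 nsZ2)).
  do 4 right; left; exists V1, V2, (M1 :&: M2)%G; split=> //.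
  + by rewrite nX en.
  + by rewrite -e1 nonnormal_index_gt2.
  + by exists p1; rewrite // -e1 -oV1.
  by exists p2; rewrite // -e2 -oV2.
- rewrite e1 in oV1; rewrite e2 in oV2; rewrite centsC in c21.
  rewrite setIC in defM1 defM2.
  have nilX' : nilpotent (M2 :&: M1) by rewrite setIC.
  case/negP: (two_minnormal_coprime def2 def1 defM2 defM1 c21 min2 min1 ab2 ab1 p1_pr nn2 nn1
    oV2 oV1 nilX').
  by rewrite setIC; apply/eqP/(etrans nX en).
rewrite e1 in oV1; rewrite e2 in oV2.
case/negP: (two_minnormal_coprime def1 def2 defM1 defM2 c21 min1 min2 ab1 ab2 p2_pr nn1 nn2 oV1
  oV2 nilX).
by rewrite nX en.
Qed.

Lemma Phi_free_classification gT (G : {group gT}) :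
    solvable G -> ~~ nilpotent G -> 'Phi(G) = 1 ->
    num_maximal G = (2 * covering_number G)%N ->
  exists2 q, covering_number G = q.+1 & Phi_free_type q G.
Proof.
move=> solG nnilG Phi1 nG.
have ncG : ~~ cyclic G by apply: contra nnilG => cycG; rewrite abelian_nil ?cyclic_abelian.
have [M0 nM0] : exists M, M \in nonnormal_maximals G.
  have [M [r [maxM nnM _ _]]] := nonnormal_maximal_pcore solG nnilG.
  by exists M; rewrite inE maxM.
have mM0 := nonnormal_multimax nM0.
case: (arg_minnP (fun X : {group gT} => #|G : X|) mM0) => X mX minX.
have eqs := covering_number_multimax solG ncG mX minX.
exists #|G : X|; rewrite // eqs in nG *.
have leq_nn : {in nonnormal_maximals G, forall M : {group gT}, #|G : X| <= #|G : M|}.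
  by move=> M /nonnormal_multimax; apply: minX.
case: (few_nonnormal_classes solG nnilG leq_nn nG) => [[M classM nM] | [M [N [nM nN nMN
  classes]]]].
  exact: one_class_type solG Phi1 nM classM minX mX (erefl _) nG.
apply: (two_class_type solG Phi1 nM nN nMN classes); rewrite ?leq_nn //.
rewrite -nG num_maximal_split classes cardsU conj_class_disjoint // cards0 subn0.
by rewrite !card_conj_class.
Qed.

End PhiFree.

Local Open Scope nat_scope.

Theorem theorem2p13 (gT : finGroupType) (G : {group gT})
    (nnilG : ~~ nilpotent G) (solG : solvable G)
    (mG : num_maximal G = 2 * covering_number G) :
  let s := covering_number G in
  let Q := (G / 'Phi(G))%g in
  (* (i) *)
  Q \isog setX (Zp 2) [set: 'S_3]
  (* (ii) *)
  \/ (exists q : nat, exists E A B : {group coset_of 'Phi(G)},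
      [/\ s - 1 = q, mersenne_prime q, elementary_abelian_of_order s E,
          A \isog Zp q /\ B \isog Zp q
        & (E ><| A) \x B = Q])
  (* (iii) *)
  \/ (exists (t : nat) (ps : seq nat), exists E T P : {group coset_of 'Phi(G)},
      [/\ 0 < t,
          [/\ uniq ps, all prime ps & all (coprime t) ps],
          s <> 3 /\ size ps + num_maximal (Zp t) = s + 1,
          [/\ elementary_abelian_of_order (s - 1) E, T \isog Zp t
            & P \isog Zp (\prod_(p <- ps) p)]
        & (E ><| T) \x P = Q])
  (* (iv) *)
  \/ (exists t : nat, exists A T B C : {group coset_of 'Phi(G)},
      [/\ prime (s - 1) /\ odd (s - 1),
          0 < t /\ num_maximal (Zp t) = 1,
          [/\ A \isog Zp (s - 1), B \isog Zp (s - 1) & C \isog Zp (s - 1)],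
          T \isog Zp t
        & (A ><| T) \x B \x C = Q])
  (* (v) *)
  \/ (exists t1 t2 : nat, exists E1 T1 E2 T2 : {group coset_of 'Phi(G)},
      [/\ [/\ 0 < t1, 0 < t2 & coprime t1 t2],
          num_maximal (Zp t1) = 1 /\ num_maximal (Zp t2) = 1,
          ~ fermat_prime (s - 1),
          [/\ elementary_abelian_of_order (s - 1) E1, T1 \isog Zp t1,
              elementary_abelian_of_order (s - 1) E2 & T2 \isog Zp t2]
        & (E1 ><| T1) \x (E2 ><| T2) = Q])
  (* (vi) *)
  \/ (exists t : nat, exists E1 E2 T : {group coset_of 'Phi(G)},
      [/\ 0 < t /\ num_maximal (Zp t) = 2, s <> 3,
          elementary_abelian_of_order (s - 1) E1 /\
          elementary_abelian_of_order (s - 1) E2,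
          T \isog Zp t
        & (E1 \x E2) ><| T = Q])
  (* (vii) *)
  \/ (exists t p : nat, exists E1 E2 T P : {group coset_of 'Phi(G)},
      [/\ [/\ prime p, num_maximal (Zp t) = 1, gcdn p t = 1, 2 < t & s <> 3],
          elementary_abelian_of_order (s - 1) E1,
          elementary_abelian_of_order (s - 1) E2,
          T \isog Zp t /\ P \isog Zp p
        & ((E1 \x E2) ><| T) \x P = Q])
  (* (viii) *)
  \/ (exists q t : nat, exists E A T : {group coset_of 'Phi(G)},
      [/\ s - 1 = q /\ mersenne_prime q,
          [/\ 0 < t, num_maximal (Zp t) = 1 & t %| s - 2],
          elementary_abelian_of_order s E,
          A \isog Zp q /\ T \isog Zp t
        & E ><| (A ><| T) = Q]).
Proof.
have ncG : ~~ cyclic G by apply: contra nnilG => cycG; rewrite abelian_nil ?cyclic_abelian.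
have nG : num_maximal (G / 'Phi(G))%g = 2 * covering_number (G / 'Phi(G))%g.
  by rewrite num_maximal_Phi covering_number_Phi.
have solQ : solvable (G / 'Phi(G))%g := quotient_sol _ solG.
have nnilQ : ~~ nilpotent (G / 'Phi(G))%g by apply: contra nnilG; apply: quotient_Phi_nil.
have [q eqs] := Phi_free_classification (G := (G / 'Phi(G))%G) solQ nnilQ (Phi_quotient_id G) nG.
rewrite covering_number_Phi // in eqs; cbv zeta; rewrite eqs subSS subn0 subSS subn1.
case=> [typeQ | [[E [A [B [mq abE oA oB defQ]]]] | [[E [T [q2 nT cycT abE defQ]]] | ]]].
- by left.
- right; left; exists q, E, A, B; have [q_pr _] := mq.
  by split=> //; split; apply: prime_isog_Zp.
(* The whole cyclic complement is taken as [T]: the list of primes is empty, the last factor is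
   trivial, and the count is that of [T] alone. *)
- right; right; left; exists #|T|, [::], E, T, 1%G; rewrite num_maximal_Zp //.
  split=> //; last by rewrite dprodg1.
    split; last by rewrite nT addn1.
    by case: q q2 {eqs nT abE} => [|[|[|]]].
  split=> //; first exact: cyclic_isog_Zp.
  by apply: cyclic_isog_Zp; rewrite ?cyclic1 // big_nil cards1.
case=> [[A [T [B [C [[q_pr oddq] [cycT nT] [oA oB oC] defQ]]]]] | ].
- do 3 right; left; exists #|T|, A, T, B, C; rewrite num_maximal_Zp //.
  by split=> //; [split; apply: prime_isog_Zp | apply: cyclic_isog_Zp].
case=> [[E1 [E2 [T [[cycT nT] q2 abE1 abE2 defQ]]]] | [E [A [T [mq [cycT nT dT] abE oA defQ]]]]].
- do 5 right; left; exists #|T|, E1, E2, T; rewrite num_maximal_Zp //.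
  split=> //; last exact: cyclic_isog_Zp.
  by case: q q2 {eqs abE1 abE2} => [|[|[|]]].
do 7 right; exists q, #|T|, E, A, T; rewrite num_maximal_Zp //; have [q_pr _] := mq.
by split=> //; split; [apply: prime_isog_Zp | apply: cyclic_isog_Zp].
Qed.
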